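(* Let $X=(X_t)_{t\ge 0}$ be a killed subordinator which is not identically zero, with Laplace exponent $\Phi$ and potential measure $U$. Let $N\in\mathbb{N}$ be fixed. Assume the following two conditions. (A) There exist constants $n\in\mathbb{N}\cup\{0\}$, $c_0\in(0,+\infty)$, $c_1,\dots,c_n\in\mathbb{R}\setminus\{0\}$ and $\alpha_0>\alpha_1>\dots>\alpha_n>-N+1$ with $\alpha_0\in[0,1]$, and a locally integrable function $R:(0,+\infty)\to(0,+\infty)$ such that $R(t)$ is non-increasing on $(0,r)$ for some $r>0$, $R(t)=o(t^{-N-\alpha_n})$ as $t\to 0+$, and $$\Big(\frac{d}{dz}\Big)^{N}\Big(\frac{1}{\Phi(z)}-\sum_{k=0}^n\frac{1}{c_k z^{\alpha_k}}\Big)=O(R(|z|)),\quad\text{as } z\to 0 \text{ in } \{z\in\mathbb{C}\mid \mathrm{Re}\,z>0\}.$$ (B) For any $r>0$, $$\sup_{\lambda>0}\int_{\mathbb{R}\setminus(-r,r)}\Big|\Big(\Big(\frac{d}{dz}\Big)^N\frac{1}{\Phi}\Big)(\lambda+i\theta)\Big|\,d\theta<+\infty.$$ Then the potential measure $U|_{(0,+\infty)}(dx)$ restricted to $(0,+\infty)$ admits a continuous density $u(x)$ $(0<x<+\infty)$ which satisfies $$u(x)=\sum_{k=0}^n\frac{x^{-1+\alpha_k}}{c_k\Gamma(\alpha_k)}+O(\varepsilon_1(x)),\quad\text{as } x\to+\infty,$$ where $$\varepsilon_1(x)=x^{-N-1}R(x^{-1})+x^{-N}\int_{x^{-1}}^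{1}R(t)\,dt.$$
   Context: $\mathbb{N}=\{1,2,\dots\}$. A killed subordinator is a process $X$ for which there are a one-dimensional non-decreasing Lévy process $Y$ with $Y_0=0$ and an independent $(0,+\infty]$-valued exponentially distributed random variable $\zeta$ (with $\zeta=+\infty$ a.s. allowed, i.e. killing rate $0$) such that $X_t=Y_t$ for $t<\zeta$ and $X_t=\partial$ (a cemetery point) for $t\ge\zeta$. Its Laplace exponent $\Phi$ is determined by $\mathbb{E}[\exp(-zX_t)]=\exp(-\Phi(z)t)$ for $t\ge0$, $z\in\mathbb{C}$ with $\mathrm{Re}\,z\ge0$ (with $e^{-z\partial}=0$), and has the form $$\Phi(z)=a+bz+\int_{(0,+\infty)}(1-e^{-zx})\,\Pi(dx),\quad \mathrm{Re}\,z\ge 0,$$ with killing rate $a\ge0$, drift coefficient $b\ge0$ and Lévy measure $\Pi$, a $\sigma$-finite measure on $(0,+\infty)$ with $\int_{(0,+\infty)}(1\wedge x)\,\Pi(dx)<+\infty$. ''$X$ is not identically zero'' means $a>0$ or $b>0$ or $\Pi((0,+\infty))>0$; then $\mathrm{Re}\,\Phi(z)>0$ for $\mathrm{Re}\,z>0$. The potential measure $U$ is the locally finite measure on $[0,+\infty)$ defined by $U(A)=\mathbb{E}\big[\int_0^{+\infty}\mathbf{1}_{\{X_t\in A\}}\,dt\big]$ for Borel $A\subset[0,+\infty)$. Complex powers are principal values: $z^w=\exp(w\log z)$ with $\mathrm{Im}\log z\in(-\pi,\pi)$ for $z\in\mathbb{C}\setminus(-\infty,0]$. $1/\Gamma$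 denotes the (entire) reciprocal gamma function, so $1/\Gamma(-m)=0$ for $m\in\mathbb{N}\cup\{0\}$. $f=g+O(h)$ as $x\to a$ means $|f(x)-g(x)|\le C h(x)$ on some neighborhood of $a$ for some constant $C\in(0,+\infty)$; $f=g+o(h)$ means $|f-g|/h\to0$. *)

(* Defs.v *)
From HB Require Import structures.
From mathcomp Require Import all_boot all_order all_algebra.
From mathcomp Require Import all_classical all_reals all_analysis.
From mathcomp Require Import measurable_realfun.
From mathcomp Require Import complex.

Set Implicit Arguments.
Unset Strict Implicit.
Unset Printing Implicit Defensive.

Import Order.TTheory GRing.Theory Num.Theory.
Import numFieldNormedType.Exports.

Local Open Scope classical_set_scope.
Local Open Scope ring_scope.
Local Open Scope complex_scope.

Section complex_functions.
Context {R : realType}.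
Implicit Types z w : R[i].

(* The real-valued modulus; [`|z|] is the same number as an element of R[i]. *)
Definition cmod z : R := Normc.normc z.

Definition cexp z : R[i] :=
  (expR (complex.Re z) * cos (complex.Im z))
    +i* (expR (complex.Re z) * sin (complex.Im z)).

(* Principal argument: it lies in (-pi, pi) off the half-line (-oo, 0]. *)
Definition carg z : R :=
  let t := acos (complex.Re z / cmod z) in
  if 0 <= complex.Im z then t else - t.

Definition clog z : R[i] := ln (cmod z) +i* carg z.

Definition cpow z w : R[i] := cexp (w * clog z).

(* The N-th complex derivative: the difference quotients of [derive1] are taken
   over the field R[i], so increments tend to 0 in the complex plane. *)
Definition cderivn (N : nat) (f : R[i] -> R[i]) : R[i] -> R[i] :=
  derive1n N (f : R[i] -> R[i]^o).

Definition cintegral d (T : measurableType d) (mu : {measure set T -> \bar R})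
    (D : set T) (f : T -> R[i]) : R[i] :=
  (\int[mu]_(x in D) complex.Re (f x)) +i* (\int[mu]_(x in D) complex.Im (f x)).

End complex_functions.

Section reciprocal_gamma.
Context {R : realType}.

(* Euler's integral, meaningful for 0 < s. *)
Definition Gamma (s : R) : R :=
  \int[lebesgue_measure]_(t in `]0, +oo[) (t `^ (s - 1) * expR (- t)).

(* The entire function 1/Gamma on the real line, through
   Gamma (s + m) = s (s + 1) ... (s + m - 1) Gamma s with m large enough that
   0 < s + m. It vanishes at 0, -1, -2, ... *)
Definition rgamma (s : R) : R :=
  let m := (Num.truncn `|s|).+1 in
  (\prod_(i < m) (s + i%:R)) / Gamma (s + m%:R).

End reciprocal_gamma.

Section subordinators.
Context d (T : measurableType d) (R : realType) (P : probability T R).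

(* Taking some of the B i to be setT gives the product rule for subfamilies. *)
Definition mutually_independent (m : nat) (Z : 'I_m -> T -> R) :=
  forall B : 'I_m -> set R, (forall i, measurable (B i)) ->
    P (\bigcap_(i in [set: 'I_m]) (Z i @^-1` B i)) =
    (\prod_(i < m) P (Z i @^-1` B i))%E.

(* Processes are indexed by t : R, and only the times 0 <= t are relevant. *)
Definition independent_increments (Y : R -> T -> R) :=
  forall (m : nat) (t : nat -> R), 0 <= t 0%N ->
    (forall i, t i <= t i.+1) ->
    mutually_independent (fun (i : 'I_m) w => Y (t i.+1) w - Y (t i) w).

Definition stationary_increments (Y : R -> T -> R) :=
  forall s h : R, 0 <= s -> 0 <= h ->
  forall B : set R, measurable B ->
    P ((fun w => Y (s + h) w - Y s w) @^-1` B) =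
    P ((fun w => Y h w - Y 0 w) @^-1` B).

Definition cadlag (y : R -> R) :=
  (forall t, 0 <= t -> y s @[s --> t^'+] --> y t) /\
  (forall t, 0 < t -> cvg (y s @[s --> t^'-])).

Definition levy_process (Y : R -> T -> R) :=
  [/\ (forall t, 0 <= t -> measurable_fun setT (Y t)),
      {ae P, forall w, Y 0 w = 0},
      independent_increments Y,
      stationary_increments Y &
      {ae P, forall w, cadlag (Y ^~ w)}].

Definition subordinator (Y : R -> T -> R) :=
  levy_process Y /\
  {ae P, forall w, forall s t : R, 0 <= s -> s <= t -> Y s w <= Y t w}.

(* Values in (0, +oo]; the rate q = 0 forces zeta = +oo almost surely. *)
Definition exponential_time (q : R) (zeta : T -> \bar R) :=
  [/\ measurable_fun setT zeta,
      (forall w, (0 < zeta w)%E) &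
      forall t : R, 0 <= t ->
        P [set w | (t%:E < zeta w)%E] = (expR (- (q * t)))%:E].

Definition process_sigma_algebra (Y : R -> T -> R) : set (set T) :=
  <<s [set E | exists t : R, exists B : set R,
        [/\ 0 <= t, measurable B & E = Y t @^-1` B]] >>.

Definition independent_of_process (Y : R -> T -> R) (zeta : T -> \bar R) :=
  forall (E : set T) (B : set (\bar R)),
    process_sigma_algebra Y E -> measurable B ->
    P (E `&` zeta @^-1` B) = (P E * P (zeta @^-1` B))%E.

(* The cemetery point is [None]. *)
Definition killed_subordinator (X : R -> T -> option R) :=
  exists (Y : R -> T -> R) (zeta : T -> \bar R) (q : R),
    [/\ subordinator Y, 0 <= q, exponential_time q zeta,
        independent_of_process Y zeta &
        forall (t : R) (w : T), 0 <= t ->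
          X t w = if (t%:E < zeta w)%E then Some (Y t w) else None].

(* exp (- z x), with the convention that it is 0 at the cemetery point. *)
Definition exp_killed (z : R[i]) (x : option R) : R[i] :=
  if x is Some y then cexp (- (z * y%:C)) else 0.

Definition laplace_exponent (X : R -> T -> option R) (Phi : R[i] -> R[i]) :=
  forall (t : R) (z : R[i]), 0 <= t -> 0 <= complex.Re z ->
    cintegral P setT (fun w => exp_killed z (X t w)) = cexp (- (Phi z * t%:C)).

Definition potential (X : R -> T -> option R) (A : set R) : \bar R :=
  (\int[P]_w \int[lebesgue_measure]_(t in `[0%R, +oo[)
     (\1_(Some @` A) (X t w))%:E)%E.

End subordinators.

(* Phi (z) = a + b z + \int_(0, +oo) (1 - exp (- z x)) Pi(dx) for 0 <= Re z.
   Only the restriction of the measure Pi to (0, +oo) plays a role. *)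
Definition levy_khintchine (R : realType) (Phi : R[i] -> R[i]) (a b : R)
    (Pi : {measure set (measurableTypeR R) -> \bar R}) :=
  [/\ 0 <= a, 0 <= b, @sigma_finite _ (measurableTypeR R) R `]0, +oo[ Pi,
      (\int[Pi]_(x in `]0%R, +oo[) (Num.min 1 x)%:E < +oo)%E &
      forall z : R[i], 0 <= complex.Re z ->
        Phi z = a%:C + b%:C * z +
          cintegral Pi `]0, +oo[ (fun x : R => 1 - cexp (- (z * x%:C)))].

(* Main.v *)
Require Import Defs.
From HB Require Import structures.
From mathcomp Require Import all_boot all_order all_algebra.
From mathcomp Require Import all_classical all_reals all_analysis.
From mathcomp Require Import measurable_realfun.
From mathcomp Require Import complex.
From mathcomp Require Import ring lra.
Set Implicit Arguments.
Unset Strict Implicit.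
Unset Printing Implicit Defensive.
Import Order.TTheory GRing.Theory Num.Theory.
Import numFieldNormedType.Exports.
Local Open Scope classical_set_scope.
Local Open Scope ring_scope.
Local Open Scope complex_scope.

(** The potential measure U of the killed subordinator X is a measure on the
    half-line, and exchanging the expectation with the integral over time
    gives 1 / Phi (z) = int exp (- z x) U(dx) for Re z > 0 (lemma
    [potential_laplace]); the integral over time of exp (- Phi (z) t)
    converges because Re Phi > 0 there, by the Levy-Khintchine formula. Hence,
    up to the sign (-1)^N, the N-th derivative of 1 / Phi is the Laplace
    transform L of the measure x^N U(dx). The hypothesis [hB] makes L
    integrable on every vertical line, and Fourier inversion then produces a
    continuous density of x^N U(dx),

      v (x) = (exp (a x) / pi) int_(t > 0) Re (exp (i t x) L (a + i t)) dt,

    whose value at x > 0 does not depend on a > 0. The measure exp (- a x) x^N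
    U(dx) is finite, and the inversion is done for finite measures by
    convolution with the Poisson kernel ([measure_invdens],
    [bromwich_density]). The density of U on (0, +oo) is u (x) = x^(- N) v
    (x).

    The same formula inverts the transforms Gamma (s) z^(- s) of x^(s - 1) for
    s > 1. Differentiating z^(- alpha_k) / c_k N times gives a multiple of
    z^(- s_k) with s_k = alpha_k + N > 1, and the functional equation of Gamma
    turns the corresponding multiple of x^(s_k - 1), divided by x^N, into
    x^(alpha_k - 1) / (c_k Gamma (alpha_k)), including the values of alpha_k
    where 1 / Gamma vanishes ([rgamma_Gamma]). By linearity
    ([bromwich_sub_powers]) the error v (x) - sum_k kappa_k x^(s_k - 1) is at
    most (exp (a x) / pi) int_(t > 0) |H (a + i t)| dt, where H is the
    difference of the transforms.

    Take a = 1 / x, so that exp (a x) = e. The hypothesis [hA] bounds |H (z)|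
    by a multiple of rho (|z|) near 0: the range t <= 1 / x contributes at
    most a multiple of rho (1 / x) / x, because rho is non-increasing near 0,
    and the range 1 / x < t < r at most a multiple of the integral of rho over
    (1 / x, 1). The range t >= r contributes a constant, by [hB] and the decay
    of the powers; it is absorbed by the integral of rho, which is bounded
    below as x grows ([bromwich_asymptotics]). *)

(** * The exponential function and the modulus *)

Section modulus.
Context {R : realType}.
Implicit Types (z w : R[i]) (a b x : R).

Lemma normC_cmod z : `|z| = (cmod z)%:C. Proof. by []. Qed.

Lemma cmod_ge0 z : 0 <= cmod z.
Proof. by rewrite /cmod; case: z => a b; exact: sqrtr_ge0. Qed.

Lemma cmodM z w : cmod (z * w) = cmod z * cmod w.
Proof. exact: Normc.normcM. Qed.

Lemma cmodD z w : cmod (z + w) <= cmod z + cmod w.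
Proof. exact: le_normcD. Qed.

Lemma cmodN z : cmod (- z) = cmod z.
Proof. exact: normcN. Qed.

Lemma cmodV z : cmod z^-1 = (cmod z)^-1.
Proof. exact: Normc.normcV. Qed.

Lemma cmod0 : cmod 0 = 0 :> R.
Proof. exact: Normc.normc0. Qed.

Lemma cmod_eq0 z : cmod z = 0 -> z = 0.
Proof. exact: Normc.eq0_normc. Qed.

Lemma cmod_sqr z : cmod z ^+ 2 = complex.Re z ^+ 2 + complex.Im z ^+ 2.
Proof. by case: z => a b; rewrite /cmod /= sqr_sqrtr// addr_ge0// sqr_ge0. Qed.

Lemma cmod_real x : cmod x%:C = `|x|.
Proof. by rewrite /cmod /= expr0n /= addr0 sqrtr_sqr. Qed.

Lemma cmod_Re z : `|complex.Re z| <= cmod z.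
Proof.
by rewrite -ler_sqr ?nnegrE ?cmod_ge0// cmod_sqr real_normK ?num_real// lerDl sqr_ge0.
Qed.

Lemma cmod_Im z : `|complex.Im z| <= cmod z.
Proof.
by rewrite -ler_sqr ?nnegrE ?cmod_ge0// cmod_sqr real_normK ?num_real// lerDr sqr_ge0.
Qed.

Lemma cmod_le_ReIm z : cmod z <= `|complex.Re z| + `|complex.Im z|.
Proof.
rewrite -ler_sqr ?nnegrE ?cmod_ge0 ?addr_ge0// cmod_sqr sqrrD.
rewrite !real_normK ?num_real// lerD2r lerDl mulrn_wge0// mulr_ge0//.
Qed.

Lemma Re_add z w : complex.Re (z + w) = complex.Re z + complex.Re w.
Proof. by case: z; case: w. Qed.
Lemma Im_add z w : complex.Im (z + w) = complex.Im z + complex.Im w.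
Proof. by case: z; case: w. Qed.
Lemma Re_opp z : complex.Re (- z) = - complex.Re z.
Proof. by case: z. Qed.
Lemma Im_opp z : complex.Im (- z) = - complex.Im z.
Proof. by case: z. Qed.
Lemma Re_mul z w : complex.Re (z * w) =
  complex.Re z * complex.Re w - complex.Im z * complex.Im w.
Proof. by case: z; case: w. Qed.
Lemma Im_mul z w : complex.Im (z * w) =
  complex.Re z * complex.Im w + complex.Im z * complex.Re w.
Proof. by case: z => a b; case: w => c d. Qed.

Definition ReIm := (Re_add, Im_add, Re_opp, Im_opp, Re_mul, Im_mul).

Lemma complex_ext z w :
  complex.Re z = complex.Re w -> complex.Im z = complex.Im w -> z = w.
Proof. by case: z => a b; case: w => c d /= -> ->. Qed.

Lemma cexp0 : cexp 0 = 1 :> R[i].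
Proof. by rewrite /cexp /= expR0 cos0 sin0 mulr1 mulr0. Qed.

Lemma cexpD z w : cexp (z + w) = cexp z * cexp w.
Proof.
apply: complex_ext; rewrite !ReIm /= ?ReIm expRD ?(cosD, sinD); ring.
Qed.

Lemma cmod_cexp z : cmod (cexp z) = expR (complex.Re z).
Proof.
apply/eqP; rewrite -(@eqrXn2 _ 2)// ?cmod_ge0 ?expR_ge0// cmod_sqr /=.
by rewrite !exprMn -mulrDr cos2Dsin2 mulr1.
Qed.

Lemma cexp_neq0 z : cexp z != 0.
Proof.
apply/eqP => h; have := cmod_cexp z; rewrite h cmod0 => /esym/eqP.
by rewrite expR_eq0.
Qed.

Lemma cexpN z : cexp (- z) = (cexp z)^-1.
Proof.
by apply: (mulfI (cexp_neq0 z)); rewrite -cexpD subrr cexp0 mulfV ?cexp_neq0.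
Qed.

End modulus.

Section exponential_estimates.
Context {R : realType}.
Implicit Types (z w : R[i]) (a b x : R).

Lemma expR_sub1_le a : `|expR a - 1| <= `|a| * expR `|a|.
Proof.
have h1 := expR_ge1Dx a.
have h2 : expR a - 1 <= a * expR a.
  have := expR_ge1Dx (- a); rewrite -(ler_pM2l (expR_gt0 a)) -expRD subrr expR0.
  lra.
have h3 : expR a <= expR `|a| by rewrite ler_expR ler_norm.
have h4 : 1 <= expR `|a| by rewrite -expR0 ler_expR.
have h5 := expR_gt0 a.
have [a0|a0] := lerP 0 a; first by rewrite (ger0_norm a0) ger0_norm; lra.
have e1 : expR a <= 1 by rewrite -expR0 ler_expR ltW.
by rewrite (ltr0_norm a0) in h4 *; rewrite ler0_norm; nra.
Qed.

Lemma expR_sub1B_le a : `|expR a - 1 - a| <= a ^+ 2 * expR `|a|.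
Proof.
have h1 := expR_ge1Dx a.
have h2 : expR a - 1 <= a * expR a.
  have := expR_ge1Dx (- a); rewrite -(ler_pM2l (expR_gt0 a)) -expRD subrr expR0.
  lra.
have h0 := expR_sub1_le a.
rewrite ger0_norm; last lra.
apply: (@le_trans _ _ (a * (expR a - 1))); first lra.
apply: (le_trans (ler_norm _)); rewrite normrM.
rewrite -real_normK ?num_real// expr2 -mulrA ler_wpM2l//.
Qed.

Lemma cos_sub1_le_norm b : `|cos b - 1| <= `|b| /\ `|sin b| <= `|b|.
Proof.
suff H x : 0 <= x -> `|cos x - 1| <= x /\ `|sin x| <= x.
  have [b0|b0] := lerP 0 b; first by rewrite (ger0_norm b0); exact: H.
  have [] : `|cos (- b) - 1| <= - b /\ `|sin (- b)| <= - b by apply: H; lra.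
  by rewrite (ltr0_norm b0) cosN sinN normrN.
rewrite le_eqVlt => /predU1P[<-|x0].
  by rewrite cos0 sin0 subrr normr0.
split.
  have [|c _] := @MVT_segment R cos (fun x => - sin x) 0 x (ltW x0)
    (fun y _ => is_derive_cos y).
    by apply: continuous_subspaceT => y; exact: continuous_cos.
  rewrite cos0 subr0 => ->; rewrite normrM normrN (gtr0_norm x0).
  rewrite ger_pMl//.
  by have := sin_le1 c; have := sin_geN1 c; rewrite ler_norml => -> ->.
have [|c _] := @MVT_segment R sin cos 0 x (ltW x0) (fun y _ => is_derive_sin y).
  by apply: continuous_subspaceT => y; exact: continuous_sin.
rewrite sin0 !subr0 => ->; rewrite normrM (gtr0_norm x0).
rewrite ger_pMl//.
by have := cos_le1 c; have := cos_geN1 c; rewrite ler_norml => -> ->.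
Qed.

Lemma sin_sub_le b : `|sin b - b| <= b ^+ 2.
Proof.
suff H x : 0 <= x -> `|sin x - x| <= x ^+ 2.
  have [b0|b0] := lerP 0 b; first exact: H.
  have : `|sin (- b) - (- b)| <= (- b) ^+ 2 by apply: H; lra.
  by rewrite sinN -opprD normrN sqrrN.
rewrite le_eqVlt => /predU1P[<-|x0].
  by rewrite sin0 subrr normr0 expr0n.
have [|c cx] := @MVT_segment R (fun x => sin x - x) (fun x => cos x - 1) 0 x (ltW x0)
  (fun y _ => is_deriveB (is_derive_sin y) (is_derive_id y 1)).
  by apply: continuous_subspaceT => y; apply: continuousB; [exact: continuous_sin|exact: cvg_id].
rewrite sin0 !subr0 => ->; rewrite normrM (gtr0_norm x0) expr2.
rewrite ler_wpM2r// ?(ltW x0)//.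
move: cx; rewrite in_itv /= => /andP[c0 cx].
have [h _] := cos_sub1_le_norm c; apply: (le_trans h).
by rewrite ger0_norm.
Qed.

Lemma cos_sub1_le b : `|cos b - 1| <= b ^+ 2.
Proof.
have -> : cos b = 1 - sin (b / 2) ^+ 2 * 2.
  rewrite [in LHS](_ : b = b / 2 + b / 2) ?cosD; last by field.
  have := cos2Dsin2 (b / 2); rewrite !expr2; lra.
rewrite addrAC subrr sub0r normrN normrM normrX (ger0_norm (_ : 0 <= 2))//.
have [_] := cos_sub1_le_norm (b / 2).
rewrite normrM => h.
have : `|sin (b / 2)| ^+ 2 <= (`|b| * `|2^-1|) ^+ 2.
  by rewrite lerXn2r// nnegrE ?mulr_ge0.
rewrite exprMn !real_normK ?num_real// => h2.
have := sqr_ge0 b; rewrite (_ : 2^-1 ^+ 2 = 4^-1 :> R) in h2; last by field.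
lra.
Qed.

(** A quadratic remainder with an explicit constant yields at once the derivative
    of exp and a bound that can be integrated, which differentiation under the
    integral sign calls for. *)
Lemma cexp_sub1B_le z : cmod (cexp z - 1 - z) <= 4 * cmod z ^+ 2 * expR (cmod z).
Proof.
apply: (le_trans (cmod_le_ReIm _)).
have ea := cmod_Re z; have eb := cmod_Im z.
have c2 := cmod_sqr z.
rewrite !ReIm /= !subr0.
set a := complex.Re z in ea c2 *; set b := complex.Im z in eb c2 *.
set M := cmod z in ea eb c2 *.
have M0 : 0 <= M by exact: cmod_ge0.
have eaM : expR a <= expR M by rewrite ler_expR (le_trans (ler_norm _) ea).
have eaM' : expR `|a| <= expR M by rewrite ler_expR.
have eM1 : 1 <= expR M by rewrite -expR0 ler_expR.
have ea0 := expR_gt0 a.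
have h1 : `|expR a * cos b - 1 - a| <= M ^+ 2 * expR M.
  have -> : expR a * cos b - 1 - a = (expR a - 1 - a) + expR a * (cos b - 1) by ring.
  apply: (le_trans (ler_normD _ _)).
  rewrite normrM (gtr0_norm ea0) c2 mulrDl lerD//.
    by apply: (le_trans (expR_sub1B_le _)); rewrite ler_wpM2l// sqr_ge0.
  by rewrite mulrC ler_pM// ?cos_sub1_le// ltW.
have h2 : `|expR a * sin b - b| <= 3 * M ^+ 2 * expR M.
  have -> : expR a * sin b - b = expR a * (sin b - b) + (expR a - 1) * b by ring.
  apply: (le_trans (ler_normD _ _)).
  have k1 : `|expR a * (sin b - b)| <= M ^+ 2 * expR M.
    rewrite normrM (gtr0_norm ea0) mulrC ler_pM ?(ltW ea0)//.
    by apply: (le_trans (sin_sub_le _)); rewrite c2 lerDr sqr_ge0.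
  have k2 : `|(expR a - 1) * b| <= M ^+ 2 * expR M.
    rewrite normrM expr2 mulrAC -mulrA [X in _ <= X]mulrA ler_pM//.
    by apply: (le_trans (expR_sub1_le _)); rewrite ler_pM// expR_ge0.
  have := mulr_ge0 (sqr_ge0 M) (expR_ge0 M); lra.
have := lerD h1 h2; lra.
Qed.

End exponential_estimates.

(** * Complex differentiation *)

Section complex_derivative.
Context {R : realType}.
Implicit Types (f g : R[i] -> R[i]) (z w h l : R[i]).

(** The derivative is part of the data, and the modulus is real: derivatives of
    sums, products and integrals are then obtained from real inequalities. *)
Definition cdiff f z l := forall e : R, 0 < e ->
  exists2 d : R, 0 < d & forall h, cmod h < d ->
    cmod (f (z + h) - f z - l * h) <= e * cmod h.

Lemma cdiff_derive1 f z l : cdiff f z l ->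
  derive1 (f : R[i] -> R[i]^o) z = l.
Proof.
move=> fl; rewrite /derive1; apply/cvg_lim; first exact: norm_hausdorff.
apply/cvgrPdist_le => /= e e0.
have [eR er] : 0 < complex.Re e /\ e = (complex.Re e)%:C.
  by move: e0; rewrite ltcE /= => /andP[/eqP i0 ->]; split=> //; apply: complex_ext.
have [d d0 H] := fl _ eR.
have d0c : 0 < d%:C by rewrite ltcR.
near=> h.
have h0 : h != 0 by near: h; exact: (@nbhs_dnbhs_neq (R[i]^o)).
have hd : cmod h < d.
  have : `|h| < d%:C.
    near: h; exact: (@dnbhs0_lt _ (R[i]^o)).
  by rewrite normC_cmod ltcR.
have := H h hd; rewrite (addrC z h) => {}H.
rewrite er normC_cmod lecR -cmodN opprB.
have -> : h^-1 *: (f (h + z) - f z) - l = h^-1 * (f (h + z) - f z - l * h).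
  by rewrite mulrBr [h^-1 * (l * h)]mulrC mulfK.
rewrite cmodM cmodV.
have ch : 0 < cmod h.
  rewrite lt_neqAle cmod_ge0 andbT eq_sym; apply: contra h0 => /eqP/cmod_eq0 ->//.
by rewrite mulrC ler_pdivrMr.
Unshelve. all: by end_near. Qed.

Lemma cdiff_near f g z l (d0 : R) : 0 < d0 ->
  (forall h, cmod h < d0 -> f (z + h) = g (z + h)) -> cdiff f z l -> cdiff g z l.
Proof.
move=> d00 fg fl e /fl[d dp H]; exists (Num.min d d0); first by rewrite lt_min dp.
move=> h; rewrite lt_min => /andP[hd hd0]; rewrite -fg//.
by rewrite -[z in g z]addr0 -fg ?cmod0// addr0 H.
Qed.

Lemma cdiff_quadratic f z l (K d : R) : 0 < d ->
  (forall h, cmod h < d -> cmod (f (z + h) - f z - l * h) <= K * cmod h ^+ 2) ->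
  cdiff f z l.
Proof.
move=> d0 H e e0.
have K1 : 0 < `|K| + 1 by rewrite ltr_wpDl.
exists (Num.min d (e / (`|K| + 1))); first by rewrite lt_min d0 divr_gt0.
move=> h; rewrite lt_min => /andP[hd]; rewrite ltr_pdivlMr// => he.
apply: (le_trans (H h hd)); rewrite expr2 mulrA ler_wpM2r ?cmod_ge0//.
have := cmod_ge0 h; have := ler_norm K; nra.
Qed.

Lemma cdiff_cst c z : cdiff (fun=> c) z 0.
Proof.
move=> e e0; exists 1 => // h _.
by rewrite subrr mul0r subr0 cmod0 mulr_ge0 ?cmod_ge0 ?ltW.
Qed.

Lemma cdiffD f g z l m : cdiff f z l -> cdiff g z m ->
  cdiff (fun s => f s + g s) z (l + m).
Proof.
move=> fl gm e e0; have e2 : 0 < e / 2 by rewrite divr_gt0.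
have [d1 d10 H1] := fl _ e2; have [d2 d20 H2] := gm _ e2.
exists (Num.min d1 d2); first by rewrite lt_min d10.
move=> h; rewrite lt_min => /andP[/H1 {}H1 /H2 {}H2].
have -> : f (z + h) + g (z + h) - (f z + g z) - (l + m) * h =
  (f (z + h) - f z - l * h) + (g (z + h) - g z - m * h) by ring.
apply: (le_trans (cmodD _ _)); apply: (le_trans (lerD H1 H2)); lra.
Qed.

Lemma cdiffZ c f z l : cdiff f z l -> cdiff (fun s => c * f s) z (c * l).
Proof.
move=> fl e e0.
have K1 : 0 < cmod c + 1 by rewrite ltr_wpDl ?cmod_ge0.
have [d d0 H] := fl _ (divr_gt0 e0 K1); exists d => // h /H {}H.
have -> : c * f (z + h) - c * f z - c * l * h =
  c * (f (z + h) - f z - l * h) by ring.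
rewrite cmodM; have := cmod_ge0 h; have c0 := cmod_ge0 c => h0.
apply: (@le_trans _ _ (cmod c * (e / (cmod c + 1) * cmod h))).
  by rewrite ler_wpM2l.
rewrite mulrA ler_wpM2r// mulrA ler_pdivrMr// mulrC; nra.
Qed.

Lemma cdiff_sum n (f : 'I_n -> R[i] -> R[i]) (l : 'I_n -> R[i]) z :
  (forall i, cdiff (f i) z (l i)) ->
  cdiff (fun s => \sum_(i < n) f i s) z (\sum_(i < n) l i).
Proof.
elim: n f l => [f l _|n IH f l H].
  rewrite big_ord0; have := @cdiff_cst 0 z; congr cdiff.
  by apply/funext => s; rewrite big_ord0.
rewrite big_ord_recl (_ : (fun s => _) =
    (fun s => f ord0 s + \sum_(i < n) f (lift ord0 i) s)).
  by apply: cdiffD => //; apply: IH => i.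
by apply/funext => s; rewrite big_ord_recl.
Qed.

Lemma cdiff_cont f z l (e : R) : cdiff f z l -> 0 < e ->
  exists2 d : R, 0 < d & forall h, cmod h < d -> cmod (f (z + h) - f z) <= e.
Proof.
move=> fl e0; have [d d0 H] := fl 1 ltr01.
have K1 : 0 < 1 + cmod l by rewrite ltr_wpDr ?cmod_ge0.
exists (Num.min d (e / (1 + cmod l))); first by rewrite lt_min d0 divr_gt0.
move=> h; rewrite lt_min => /andP[/H {}H]; rewrite ltr_pdivlMr// => he.
have -> : f (z + h) - f z = (f (z + h) - f z - l * h) + l * h by ring.
apply: (le_trans (cmodD _ _)); rewrite cmodM; lra.
Qed.

Lemma cdiff_lip f z l : cdiff f z l ->
  exists2 d : R, 0 < d & forall h, cmod h < d ->
    cmod (f (z + h) - f z) <= (1 + cmod l) * cmod h.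
Proof.
move=> fl; have [d d0 H] := fl 1 ltr01.
exists d => // h /H {}H.
have -> : f (z + h) - f z = (f (z + h) - f z - l * h) + l * h by ring.
apply: (le_trans (cmodD _ _)); rewrite cmodM; lra.
Qed.

Lemma cdiff_comp f g z l m : cdiff f z l -> cdiff g (f z) m ->
  cdiff (fun s => g (f s)) z (m * l).
Proof.
move=> fl gm e e0.
have m1 : 0 < 2 * (1 + cmod m) by rewrite mulr_gt0// ltr_wpDr ?cmod_ge0.
have l1 : 0 < 2 * (1 + cmod l) by rewrite mulr_gt0// ltr_wpDr ?cmod_ge0.
have [d1 d10 H1] := fl _ (divr_gt0 e0 m1).
have [d2 d20 H2] := gm _ (divr_gt0 e0 l1).
have [d3 d30 H3] := cdiff_lip fl.
have d20' : 0 < d2 / 2 by rewrite divr_gt0.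
have [d4 d40 H4] := cdiff_cont fl d20'.
exists (Num.min (Num.min d1 d3) d4); first by rewrite !lt_min d10 d30.
move=> h; rewrite !lt_min => /andP[/andP[/H1 {}H1 /H3 {}H3] /H4 {}H4].
have /H2 {}H2 : cmod (f (z + h) - f z) < d2 by apply: le_lt_trans H4 _; lra.
rewrite (_ : f z + (f (z + h) - f z) = f (z + h)) in H2; last by ring.
have -> : g (f (z + h)) - g (f z) - m * l * h =
  (g (f (z + h)) - g (f z) - m * (f (z + h) - f z)) +
  m * (f (z + h) - f z - l * h) by ring.
apply: (le_trans (cmodD _ _)); rewrite cmodM.
have h0 := cmod_ge0 h; have m0 := cmod_ge0 m; have l0 := cmod_ge0 l.
have k1 : e / (2 * (1 + cmod l)) * cmod (f (z + h) - f z) <= e / 2 * cmod h.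
  apply: (@le_trans _ _ (e / (2 * (1 + cmod l)) * ((1 + cmod l) * cmod h))).
    by rewrite ler_wpM2l// divr_ge0 ?ltW.
  by rewrite le_eqVlt; apply/orP; left; apply/eqP; field; rewrite lt0r_neq0// ltr_wpDr.
have k2 : cmod m * cmod (f (z + h) - f z - l * h) <= e / 2 * cmod h.
  apply: (@le_trans _ _ (cmod m * (e / (2 * (1 + cmod m)) * cmod h))).
    by rewrite ler_wpM2l.
  rewrite mulrA ler_wpM2r// mulrA ler_pdivrMr//; nra.
apply: (le_trans (lerD (le_trans H2 k1) k2)); lra.
Qed.

(** The product rule reduces to linearity, since (f - f z) (g - g z) is quadratic
    in the increment. *)
Lemma cdiffM f g z l m : cdiff f z l -> cdiff g z m ->
  cdiff (fun s => f s * g s) z (f z * m + l * g z).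
Proof.
move=> fl gm.
have A : cdiff (fun s => f z * g s) z (f z * m) by exact: cdiffZ.
have B : cdiff (fun s => g z * f s) z (g z * l) by exact: cdiffZ.
have C : cdiff (fun s => (f s - f z) * (g s - g z)) z 0.
  have [d1 d10 H1] := cdiff_lip fl; have [d2 d20 H2] := cdiff_lip gm.
  apply: (@cdiff_quadratic _ _ _ ((1 + cmod l) * (1 + cmod m)) (Num.min d1 d2)).
    by rewrite lt_min d10.
  move=> h; rewrite lt_min => /andP[/H1 {}H1 /H2 {}H2].
  rewrite !subrr !mul0r !subr0 cmodM.
  apply: (le_trans (ler_pM (cmod_ge0 _) (cmod_ge0 _) H1 H2)).
  by rewrite expr2 mulrACA.
have D := cdiffD (cdiffD A B) (cdiffD C (cdiff_cst (- (f z * g z)) z)).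
have := D; rewrite addr0 addr0 (mulrC (g z)); congr cdiff.
by apply/funext => s; ring.
Qed.

Lemma cdiff_cexp z : cdiff (@cexp R) z (cexp z).
Proof.
apply: (@cdiff_quadratic _ _ _ (cmod (cexp z) * (4 * expR 1)) 1) => // h h1.
rewrite cexpD; have -> : cexp z * cexp h - cexp z - cexp z * h =
  cexp z * (cexp h - 1 - h) by ring.
rewrite cmodM -mulrA ler_wpM2l ?cmod_ge0//.
apply: (le_trans (cexp_sub1B_le h)); rewrite mulrAC ler_wpM2r ?sqr_ge0//.
by rewrite ler_wpM2l// ler_expR ltW.
Qed.

(** The open right half-plane is where the Laplace transforms live; a chain of
    functions, each the derivative of the previous one there, computes the
    iterated derivative because the half-plane is open. *)
Lemma cderivn_halfplane (F : nat -> R[i] -> R[i]) (f : R[i] -> R[i]) :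
  (forall z, 0 < complex.Re z -> f z = F 0%N z) ->
  (forall k z, 0 < complex.Re z -> cdiff (F k) z (F k.+1 z)) ->
  forall n z, 0 < complex.Re z -> cderivn n f z = F n z.
Proof.
move=> f0 FS; elim=> [|n IH] z z0; first exact: f0.
rewrite /cderivn derive1nS; apply: cdiff_derive1.
apply: (cdiff_near z0 _ (FS n z z0)) => h hz.
rewrite -IH// Re_add.
by have := cmod_Re h; rewrite ler_norml => /andP[+ _]; lra.
Qed.

End complex_derivative.

Local Arguments cmod : simpl never.
Local Arguments clog : simpl never.

(** * Principal powers on the right half-plane *)

Section complex_power.
Context {R : realType}.
Implicit Types (z w h : R[i]) (a b x t : R).

Lemma cmod_gt0 z : 0 < complex.Re z -> 0 < cmod z.
Proof.
by move=> z0; apply: (lt_le_trans z0); exact: (le_trans (ler_norm _) (cmod_Re z)).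
Qed.

Lemma Re_gt0_neq0 z : 0 < complex.Re z -> z != 0.
Proof. by move=> z0; apply/eqP => z00; rewrite z00 /= ltxx in z0. Qed.

(** On the right half-plane the principal argument is atan (Im z / Re z), an
    expression whose continuity is immediate. *)
Lemma cos_atan_div z : 0 < complex.Re z ->
  cos (atan (complex.Im z / complex.Re z)) = complex.Re z / cmod z.
Proof.
move=> z0; have m0 := cmod_gt0 z0.
rewrite cos_atan; set t := _ / _.
have -> : 1 + t ^+ 2 = (cmod z / complex.Re z) ^+ 2.
  rewrite /t !expr_div_n cmod_sqr; field; exact: lt0r_neq0.
by rewrite sqrtr_sqr ger0_norm ?divr_ge0 ?ltW// invf_div.
Qed.

Lemma carg_atan z : 0 < complex.Re z ->
  carg z = atan (complex.Im z / complex.Re z).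
Proof.
move=> z0; rewrite /carg -cos_atan_div//; set t := atan _.
have tlt : t < pi / 2 by exact: atan_ltpi2.
have tgt : - (pi / 2) < t by exact: atan_gtNpi2.
have p0 := pi_gt0 R.
case: lerP => i0.
  rewrite cosK// in_itv /=; apply/andP; split; last lra.
  by rewrite -atan0 /t; apply: le_atan; rewrite divr_ge0// ltW.
rewrite cosKN ?opprK//; apply/andP; split; first lra.
by rewrite -atan0 /t; apply: le_atan; rewrite ler_pdivrMr// mul0r ltW.
Qed.

Lemma clogK z : 0 < complex.Re z -> cexp (clog z) = z.
Proof.
move=> z0; have m0 := cmod_gt0 z0.
rewrite /clog carg_atan// /cexp /= lnK ?posrE// cos_atan_div//.
have c0 : cos (atan (complex.Im z / complex.Re z)) != 0.
  by rewrite cos_atan_div// mulf_neq0 ?invr_neq0 ?lt0r_neq0.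
have : tan (atan (complex.Im z / complex.Re z)) = complex.Im z / complex.Re z.
  exact: atanK.
rewrite /tan => /(congr1 (fun u => u * cos (atan (complex.Im z / complex.Re z)))).
rewrite divfK// cos_atan_div// => ->.
apply: complex_ext => /=; field; rewrite !lt0r_neq0//.
Qed.

Lemma clog_cont z : 0 < complex.Re z -> forall e : R, 0 < e ->
  exists2 d : R, 0 < d & forall h, cmod h < d -> cmod (clog (z + h) - clog z) <= e.
Proof.
move=> z0 e e0; have m0 := cmod_gt0 z0.
have e2 : 0 < e / 2 by rewrite divr_gt0.
have := continuous_ln m0 => /cvgrPdist_le /(_ _ e2) [d1 /= d10 H1].
have := @continuous_atan R (complex.Im z / complex.Re z).
move=> /cvgrPdist_le /(_ _ e2) [d2 /= d20 H2].
set r := complex.Re z in z0 H2 *.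
have K0 : 0 < 4 * cmod z / r ^+ 2 by rewrite divr_gt0 ?mulr_gt0 ?exprn_gt0.
exists (Num.min (Num.min d1 (r / 2)) (d2 / (4 * cmod z / r ^+ 2))).
  by rewrite !lt_min d10 (divr_gt0 d20 K0) divr_gt0.
move=> h; rewrite !lt_min => /andP[/andP[hd1 hr] hd2].
have Rh := cmod_Re h; have Ih := cmod_Im h; have Iz := cmod_Im z; have Rz := cmod_Re z.
have rh : r / 2 < complex.Re (z + h).
  rewrite Re_add -/r; move: Rh; rewrite ler_norml => /andP[+ _]; lra.
have rh0 : 0 < complex.Re (z + h) by apply: lt_trans rh; rewrite divr_gt0.
apply: (le_trans (cmod_le_ReIm _)).
rewrite !ReIm /= !carg_atan//.
have k1 : `|ln (cmod (z + h)) - ln (cmod z)| <= e / 2.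
  rewrite distrC; apply: H1 => /=; apply: le_lt_trans hd1.
  rewrite ler_distlC; apply/andP; split.
    rewrite lerBlDr; have := cmodD (z + h) (- h); rewrite cmodN.
    by rewrite addrK.
  by have := cmodD z h.
have k2 : `|atan (complex.Im (z + h) / complex.Re (z + h)) - atan (complex.Im z / r)|
    <= e / 2.
  rewrite distrC; apply: H2 => /=.
  have -> : complex.Im z / r - complex.Im (z + h) / complex.Re (z + h) =
    (complex.Im z * complex.Re h - r * complex.Im h) / (r * complex.Re (z + h)).
    rewrite !ReIm -/r; field; rewrite -{2}/r -Re_add !lt0r_neq0//.
  apply: (@le_lt_trans _ _ (4 * cmod z / r ^+ 2 * cmod h)); last first.
    by rewrite mulrC -ltr_pdivlMr.
  rewrite normrM normfV (gtr0_norm (mulr_gt0 z0 rh0)) ler_pdivrMr ?mulr_gt0//.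
  have -> : 4 * cmod z / r ^+ 2 * cmod h * (r * complex.Re (z + h)) =
    2 * cmod z * cmod h * (complex.Re (z + h) / (r / 2)).
    field; exact: lt0r_neq0.
  have q1 : 1 <= complex.Re (z + h) / (r / 2) by rewrite ler_pdivlMr ?divr_gt0// mul1r ltW.
  apply: (@le_trans _ _ (2 * cmod z * cmod h)); last first.
    by rewrite ler_peMr// !mulr_ge0 ?cmod_ge0.
  apply: (le_trans (ler_normB _ _)); rewrite !normrM -mulrA mulrDl !mul1r lerD// ler_pM//.
have := lerD k1 k2; lra.
Qed.

(** The increment d of the logarithm solves exp (d) - 1 = h / z. By continuity d
    is small, so d = h / z up to an error quadratic in d, hence in h. *)
Lemma cdiff_clog z : 0 < complex.Re z -> cdiff (@clog R) z z^-1.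
Proof.
move=> z0; have m0 := cmod_gt0 z0; have zn0 := Re_gt0_neq0 z0.
have q0 : 0 < (8 * expR 1 : R)^-1 by rewrite invr_gt0 mulr_gt0 ?expR_gt0.
have [d1 d10 H1] := clog_cont z0 q0.
set K := 16 * expR 1 / cmod z ^+ 2.
apply: (@cdiff_quadratic _ _ _ _ K (Num.min d1 (complex.Re z))).
  by rewrite lt_min d10.
move=> h; rewrite lt_min => /andP[/H1 dl hr].
have zh0 : 0 < complex.Re (z + h).
  by rewrite Re_add; have := cmod_Re h; rewrite ler_norml => /andP[+ _]; lra.
set dd := clog (z + h) - clog z in dl *.
have E : h / z = cexp dd - 1.
  have : cexp (clog z + dd) = z + h by rewrite /dd addrC subrK clogK.
  rewrite cexpD clogK// => e1.
  by have -> : h = z * (cexp dd - 1) by [rewrite mulrBr e1; ring]; rewrite mulrC mulKf.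
have e10 := expR_gt0 (1 : R).
have e11 : (1 : R) <= expR 1 by rewrite -expR0 ler_expR.
have dd1 : cmod dd <= 1.
  by apply: (le_trans dl); rewrite invf_le1 ?mulr_gt0//; lra.
have B : cmod (h / z - dd) <= 4 * expR 1 * cmod dd ^+ 2.
  rewrite E; apply: (le_trans (cexp_sub1B_le dd)).
  by rewrite mulrAC ler_wpM2r ?sqr_ge0// ler_wpM2l// ler_expR.
have B2 : cmod dd <= 2 * cmod (h / z).
  have : cmod dd <= cmod (h / z) + cmod (h / z - dd).
    have {1}-> : dd = h / z + - (h / z - dd) by ring.
    by apply: (le_trans (cmodD _ _)); rewrite cmodN.
  have : 4 * expR 1 * cmod dd ^+ 2 <= cmod dd / 2.
    rewrite expr2 mulrA [leRHS]mulrC ler_wpM2r ?cmod_ge0//.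
    move: dl; rewrite -div1r ler_pdivlMr ?mulr_gt0//; lra.
  lra.
rewrite (mulrC z^-1) -cmodN opprB; apply: (le_trans B).
apply: (@le_trans _ _ (4 * expR 1 * (2 * cmod (h / z)) ^+ 2)).
  by rewrite ler_wpM2l ?mulr_ge0 ?(ltW e10)// lerXn2r ?nnegrE ?mulr_ge0 ?cmod_ge0.
rewrite cmodM cmodV /K le_eqVlt; apply/orP; left; apply/eqP; field.
exact: lt0r_neq0.
Qed.

Lemma cpowD z a b : cpow z (a + b)%:C = cpow z a%:C * cpow z b%:C.
Proof. by rewrite /cpow rmorphD /= mulrDl cexpD. Qed.

Lemma cpow_neq0 z w : cpow z w != 0.
Proof. exact: cexp_neq0. Qed.

Lemma cpowN z a : cpow z (- a)%:C = (cpow z a%:C)^-1.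
Proof. by rewrite /cpow rmorphN mulNr cexpN. Qed.

Lemma cpow1 z : 0 < complex.Re z -> cpow z 1%:C = z.
Proof. by move=> z0; rewrite /cpow mul1r clogK. Qed.

Lemma cmod_cpow z a : 0 < complex.Re z -> cmod (cpow z a%:C) = cmod z `^ a.
Proof.
move=> z0; rewrite /cpow cmod_cexp /= mul0r subr0 /powR.
by rewrite gt_eqF// cmod_gt0.
Qed.

Lemma cpow_real x a : 0 < x -> cpow x%:C a%:C = (x `^ a)%:C.
Proof.
move=> x0; rewrite /cpow /clog carg_atan//= mul0r atan0 cmod_real gtr0_norm//.
by apply: complex_ext; rewrite /= ?mul0r ?mulr0 ?subr0 ?addr0 ?cos0 ?sin0 ?mulr1 ?mulr0//
 /powR gt_eqF.
Qed.

Lemma cdiff_cpow z a : 0 < complex.Re z ->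
  cdiff (fun s => cpow s a%:C) z (a%:C * cpow z (a - 1)%:C).
Proof.
move=> z0.
have A := cdiffZ a%:C (cdiff_clog z0).
have := cdiff_comp A (cdiff_cexp (a%:C * clog z)).
rewrite -/(cpow z a%:C) mulrCA; congr (cdiff _ _ (_ * _)).
by rewrite cpowD cpowN cpow1.
Qed.

End complex_power.

(** * Measures with densities and integrals over the half-line *)

Section dominated_convergence_R.
Context d (T : measurableType d) (R : realType) (mu : {measure set T -> \bar R}).
Variables (D : set T) (mD : measurable D) (fn : nat -> T -> R) (f g : T -> R).
Hypothesis mfn : forall n, measurable_fun D (fn n).
Hypothesis fnf : forall x, D x -> fn n x @[n --> \oo] --> f x.
Hypothesis ig : mu.-integrable D (EFin \o g).
Hypothesis fng : forall n x, D x -> `|fn n x| <= g x.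

Let mf : measurable_fun D f.
Proof.
by apply: (measurable_fun_cvg mfn) => x Dx; exact: fnf.
Qed.

Let dct : mu.-integrable D (EFin \o f) /\
  ((\int[mu]_(x in D) (fn n x)%:E)%E @[n --> \oo] --> (\int[mu]_(x in D) (f x)%:E)%E).
Proof.
have [|||||h _ h2] := @dominated_convergence _ T _ mu D mD (fun n => EFin \o fn n)
    (EFin \o f) (EFin \o g) => //.
- by move=> n; exact/measurable_EFinP.
- exact/measurable_EFinP.
- by apply: aeW => x Dx; apply: cvg_EFin; [exact: nearW|exact: fnf].
- by apply: aeW => x n Dx; rewrite /= lee_fin fng.
Qed.

Lemma dominated_integrable_R : mu.-integrable D (EFin \o f).
Proof. exact: dct.1. Qed.

Lemma Rintegral_dominated_cvg :
  \int[mu]_(x in D) fn n x @[n --> \oo] --> \int[mu]_(x in D) f x.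
Proof.
have [h1 h2] := dct; rewrite /Rintegral; apply: fine_cvg.
rewrite fineK//; exact: integrable_fin_num.
Qed.

End dominated_convergence_R.

Section measure_with_density.
Context d (T : measurableType d) (R : realType).
Variables (mu : {measure set T -> \bar R}) (w : T -> R).
Hypotheses (mw : measurable_fun setT w) (w0 : forall x, 0 <= w x).
Local Open Scope ereal_scope.

(** The two proofs are arguments so that the measure structure can be inferred
    from the term. *)
Definition mdensity (mw : measurable_fun setT w) (w0 : forall x, (0 <= w x)%R)
  (A : set T) : \bar R := \int[mu]_(x in A) (w x)%:E.

Local Notation nu := (mdensity mw w0).

Let mdensity0 : nu set0 = 0. Proof. by rewrite /mdensity integral_set0. Qed.

Let mdensity_ge0 A : 0 <= nu A.
Proof. by apply: integral_ge0 => x _; rewrite lee_fin. Qed.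

Let mdensity_sigma_additive : semi_sigma_additive nu.
Proof.
move=> F mF tF mUF; rewrite /mdensity; apply: cvg_toP.
  apply: ereal_nondecreasing_is_cvgn => m n mn.
  apply: lee_sum_nneg_natr => // k _ _; apply: integral_ge0 => /= x Fkx.
  by rewrite lee_fin.
rewrite ge0_integral_bigcup//=.
- exact/measurable_funTS/measurableT_comp.
- by move=> x _; rewrite lee_fin.
Qed.

HB.instance Definition _ := isMeasure.Build _ _ _ nu
  mdensity0 mdensity_ge0 mdensity_sigma_additive.

Import HBNNSimple.

Let ge0_integral_mdensity_nnsfun D (h : {nnsfun T >-> R}) : measurable D ->
  \int[nu]_(x in D) (h x)%:E = \int[mu]_(x in D) (h x * w x)%:E.
Proof.
move=> mD.
under [LHS]eq_integral do rewrite fimfunE -fsumEFin//.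
rewrite [LHS]ge0_integral_fsum//; last 2 first.
  - by move=> r; exact/measurable_EFinP/measurableT_comp.
  - by move=> n x _; rewrite EFinM nnfun_muleindic_ge0.
under [RHS]eq_integral.
  move=> x xD; rewrite EFinM fimfunE -fsumEFin// ge0_mule_fsuml; last first.
    by move=> r; rewrite EFinM nnfun_muleindic_ge0.
  over.
rewrite [RHS]ge0_integral_fsum//; last 2 first.
  - move=> r; apply: emeasurable_funM; apply/measurable_EFinP; last exact: measurable_funTS.
    by do 2 apply/measurableT_comp => //.
  - by move=> n x _; apply: mule_ge0; rewrite ?EFinM ?nnfun_muleindic_ge0 ?lee_fin.
apply: eq_fsbigr => r _.
rewrite integralZl_indic_nnsfun//= integral_indic//.
have [r0|r0] := ltP r 0%R.
  rewrite preimage_nnfun0// set0I measure0 mule0 integral0_eq// => x _.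
  by rewrite indicE in_set0 mulr0 mul0e.
under [RHS]eq_integral do rewrite EFinM -muleA.
rewrite ge0_integralZl//; last 2 first.
  - apply: emeasurable_funM; apply/measurable_EFinP => //; exact: measurable_funTS.
  - by move=> x _; rewrite mule_ge0// lee_fin.
congr (_ * _); rewrite setIC -[LHS]/(mdensity _ _ _) /mdensity [in LHS]integral_mkcondr.
apply: eq_integral => x _.
rewrite patchE indicE; case: ifPn => /= _; by rewrite ?mul1e ?mul0e.
Qed.

Lemma ge0_integral_mdensity D (f : T -> \bar R) : measurable D ->
  measurable_fun D f -> (forall x, D x -> 0 <= f x) ->
  \int[nu]_(x in D) f x = \int[mu]_(x in D) (f x * (w x)%:E).
Proof.
move=> mD mf f0; pose f_ := nnsfun_approx mD mf.
have fcvg x : D x -> EFin \o f_^~ x @ \oo --> f x.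
  by move=> Dx; apply: cvg_nnsfun_approx.
have fnd x : {homo (f_ ^~ x) : m n / (m <= n)%N >-> (m <= n)%R}.
  by move=> m n mn; exact/lefP/nd_nnsfun_approx.
transitivity (limn (fun n => \int[nu]_(x in D) (f_ n x)%:E)).
  rewrite -monotone_convergence//=.
  - by apply: eq_integral => x /[!inE] xD; apply/esym/cvg_lim => //=; exact: fcvg.
  - by move=> n; exact/measurable_EFinP/measurable_funTS.
  - by move=> n x _; rewrite lee_fin.
  - by move=> x _ m n mn; rewrite lee_fin; exact: fnd.
under [in LHS]eq_fun do rewrite ge0_integral_mdensity_nnsfun//.
rewrite -monotone_convergence//=.
- apply: eq_integral => x /[!inE] xD; apply/cvg_lim => //=.
  under eq_fun do rewrite EFinM.
  by apply: cvgeZr => //; exact: fcvg.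
- by move=> n; apply/measurable_EFinP/measurable_funM; exact: measurable_funTS.
- by move=> n x _; rewrite lee_fin mulr_ge0.
- by move=> x _ m n mn; rewrite lee_fin ler_wpM2r// fnd.
Qed.

Lemma integrable_mdensity D (f : T -> R) : measurable D -> measurable_fun D f ->
  mu.-integrable D (fun x => (f x * w x)%:E) -> nu.-integrable D (EFin \o f).
Proof.
move=> mD mf /integrableP[_ h]; apply/integrableP; split; first exact/measurable_EFinP.
rewrite ge0_integral_mdensity//; last first.
  by apply: measurableT_comp => //; exact/measurable_EFinP.
apply: le_lt_trans h; apply: ge0_le_integral => //.
- by move=> x _; rewrite mule_ge0// lee_fin.
- apply: emeasurable_funM; last exact/measurable_EFinP/measurable_funTS.
  by apply: measurableT_comp => //; exact/measurable_EFinP.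
- apply: measurableT_comp => //; apply/measurable_EFinP/measurable_funM => //.
  exact/measurable_funTS.
- by move=> x _ /=; rewrite lee_fin normrM (ger0_norm (w0 _)).
Qed.

Lemma Rintegral_mdensity D (f : T -> R) : measurable D -> measurable_fun D f ->
  mu.-integrable D (fun x => (f x * w x)%:E) ->
  (\int[nu]_(x in D) f x = \int[mu]_(x in D) (f x * w x))%R.
Proof.
move=> mD mf h; rewrite /Rintegral; congr fine.
rewrite integralE [RHS]integralE.
have mfE : measurable_fun D (EFin \o f) by exact/measurable_EFinP.
rewrite !ge0_integral_mdensity//; [|exact: measurable_funeneg|exact: measurable_funepos].
congr (_ - _); apply: eq_integral => x _.
- by rewrite !funeposE -EFin_max -EFinM -EFin_max maxr_pMl// mul0r.
- by rewrite !funenegE -!EFinN -!EFin_max -EFinM maxr_pMl// mul0r mulNr.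
Qed.

End measure_with_density.

Section halfline_FTC.
Context {R : realType}.
Implicit Types (f F : R -> R) (l : R).
Local Notation mu := (@lebesgue_measure R).

(* compact intervals that exhaust the open half-line *)
Let E (n : nat) : set R := `[n.+1%:R^-1, n.+2%:R].

Let E_bigcup : \bigcup_n E n = `]0, +oo[%classic.
Proof.
apply/seteqP; split => x /=.
  move=> [n _]; rewrite /E /= !in_itv/= andbT => /andP[+ _].
  by apply: lt_le_trans; rewrite invr_gt0.
rewrite in_itv/= andbT => x0.
exists (Num.truncn x + Num.truncn x^-1)%N => //; rewrite /E /= in_itv/=.
have := truncnS_gt x; have := truncnS_gt x^-1 => h1 h2; apply/andP; split.
  rewrite invf_ple ?posrE//; apply: (le_trans (ltW h1)).
  by rewrite ler_nat ltnS leq_addl.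
by apply: (le_trans (ltW h2)); rewrite ler_nat ltnS (leq_trans (leq_addr _ _) (leqnSn _)).
Qed.

Let E_nd : nondecreasing_seq E.
Proof.
move=> m n mn; rewrite subsetEset => x; rewrite /E /= !in_itv/= => /andP[h1 h2].
apply/andP; split; last by rewrite (le_trans h2)// ler_nat !ltnS.
by apply: le_trans h1; rewrite lef_pV2 ?posrE// ler_nat ltnS.
Qed.

Let E_sub n : E n `<=` `]0, +oo[%classic.
Proof. by rewrite -E_bigcup => x Ex; exists n. Qed.

Lemma continuous_halfline_measurable f :
  (forall x : R, 0 < x -> {for x, continuous f}) -> measurable_fun (`]0, +oo[%classic : set R) f.
Proof.
move=> cf; apply: open_continuous_measurable_fun; first exact: interval_open.
by move=> x; rewrite inE/= in_itv/= andbT => /cf.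
Qed.

Section main.
Variables (f F : R -> R) (l0 l1 : R).
Hypothesis dF : forall x : R, 0 < x -> is_derive x 1 F (f x).
Hypothesis cf : forall x : R, 0 < x -> {for x, continuous f}.
Hypothesis F0 : F x @[x --> 0^'+] --> l0.
Hypothesis Fy : F x @[x --> +oo] --> l1.

Let FTC_seg n : (\int[mu]_(x in E n) (f x)%:E = (F n.+2%:R)%:E - (F n.+1%:R^-1)%:E)%E.
Proof.
have n0 : 0 < n.+1%:R^-1 :> R by rewrite invr_gt0.
have pn : n.+1%:R^-1 < n.+2%:R :> R.
  by apply: (@le_lt_trans _ _ 1); rewrite ?invf_le1 ?ler1n ?ltr1n.
have cF x : 0 < x -> {for x, continuous F}.
  by move=> /dF df; apply/differentiable_continuous/derivable1_diffP.
rewrite /E (@continuous_FTC2 _ f F)//.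
- apply: continuous_in_subspaceT => x; rewrite inE/= in_itv/= => /andP[h _].
  by apply: cf; exact: lt_le_trans h.
- split.
  + move=> x; rewrite in_itv/= => /andP[h _].
    by have /dF[] : 0 < x by exact: lt_trans h.
  + by apply: cvg_at_right_filter; exact: cF.
  + by apply: cvg_at_left_filter; apply: cF; rewrite ltr0n.
- move=> x; rewrite in_itv/= => /andP[h _].
  have x0 : 0 < x by exact: lt_trans h.
  have := dF x0 => dFx.
  by rewrite derive1E derive_val.
Qed.

Let cvgF : F n.+2%:R - F n.+1%:R^-1 @[n --> \oo] --> l1 - l0.
Proof.
apply: cvgB.
  apply: (cvg_comp (fun n => n.+2%:R) F _ Fy); apply/cvgryPge => A.
  near=> n; apply: (@le_trans _ _ n%:R); first by near: n; exact: nbhs_infty_ger.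
  by rewrite ler_nat (leq_trans (leqnSn _) (leqnSn _)).
move/cvg_at_rightP : F0 => /(_ (fun n => n.+1%:R^-1)); apply; split => //.
exact: cvg_harmonic.
Unshelve. all: by end_near. Qed.

Lemma ge0_FTC_halfline : (forall x : R, 0 < x -> 0 <= f x) ->
  (\int[mu]_(x in `]0%R, +oo[) (f x)%:E = (l1 - l0)%:E)%E.
Proof.
move=> f0; rewrite -E_bigcup.
have mf n : measurable_fun (E n) (EFin \o f).
  apply/measurable_EFinP; apply: measurable_funS (@E_sub n) _ => //.
  exact: continuous_halfline_measurable.
have H : (\int[mu]_(x in E i) (EFin \o f) x)%E @[i --> \oo] -->
    (\int[mu]_(x in \bigcup_i E i) (EFin \o f) x)%E.
  apply: ge0_nondecreasing_set_cvg_integral => //; first by move=> i; exact: measurable_itv.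
  move=> i x /E_sub /=; rewrite in_itv/= andbT => x0.
  by rewrite lee_fin f0.
apply: (cvg_unique _ H) => //.
rewrite /= (_ : (fun n => _) = (fun n => (F n.+2%:R - F n.+1%:R^-1)%:E)).
  by apply: cvg_EFin => //; exact: nearW.
by apply/funext => n; rewrite EFinB -FTC_seg.
Qed.

Lemma Rintegral_FTC_halfline : mu.-integrable `]0, +oo[ (EFin \o f) ->
  \int[mu]_(x in `]0, +oo[) f x = l1 - l0.
Proof.
move=> intf.
have mf : measurable_fun (`]0, +oo[%classic : set R) f.
  exact: continuous_halfline_measurable.
pose fn n := f \_ (E n).
have mE n : measurable (E n) by exact: measurable_itv.
have H : \int[mu]_(x in `]0, +oo[) fn n x @[n --> \oo] -->
     \int[mu]_(x in `]0, +oo[) f x.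
  apply: (@Rintegral_dominated_cvg _ _ _ mu _ (measurable_itv _) fn f (Num.norm \o f)).
  - move=> n; apply/(measurable_restrict _ (mE n)) => //.
    by apply: measurable_funS mf => // x [].
  - move=> x; rewrite -E_bigcup => -[m _ Emx].
    apply: cvg_near_cst; exists m => // n /= mn.
    rewrite /fn patchE mem_set//.
    by have := E_nd mn; rewrite subsetEset; apply.
  - exact: integrable_norm.
  - by move=> n x _; rewrite /fn patchE; case: ifP => //= _; rewrite normr0.
apply: (cvg_unique _ H) => //.
rewrite (_ : (fun n => _) = (fun n => F n.+2%:R - F n.+1%:R^-1))//.
apply/funext => n; have := FTC_seg n; rewrite -EFinB /fn -Rintegral_mkcondr.
by rewrite setIidr ?/Rintegral; [move=> ->|exact: E_sub].
Qed.

End main.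

End halfline_FTC.

(** * Complex integrals and Laplace transforms *)

Lemma cmod_rotate (R : realType) (z : R[i]) : cmod z != 0 ->
  exists2 c, cmod c = 1 & complex.Re (c * z) = cmod z.
Proof.
move=> z0; exists ((complex.Re z / cmod z) +i* (- complex.Im z / cmod z)).
  apply/eqP; rewrite -(@eqrXn2 _ 2)// ?cmod_ge0// cmod_sqr /= !expr_div_n sqrrN.
  by rewrite -mulrDl -cmod_sqr divff ?expr1n// expf_neq0.
rewrite Re_mul /=; transitivity (cmod z ^+ 2 / cmod z); first by rewrite cmod_sqr; field.
by rewrite expr2 mulfK.
Qed.

Section complex_integral.
Context d (T : measurableType d) (R : realType) (mu : {measure set T -> \bar R}).
Variable D : set T.
Hypothesis mD : measurable D.
Implicit Types (f g : T -> R[i]).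

Definition cmeasurable f := measurable_fun D (fun x => complex.Re (f x)) /\
  measurable_fun D (fun x => complex.Im (f x)).

Definition cintegrable f := mu.-integrable D (fun x => (complex.Re (f x))%:E) /\
  mu.-integrable D (fun x => (complex.Im (f x))%:E).

Lemma cintegrable_le f (g : T -> R) : cmeasurable f ->
  mu.-integrable D (EFin \o g) -> (forall x, D x -> cmod (f x) <= g x) ->
  cintegrable f.
Proof.
move=> [mr mi] ig fg; split.
- apply: (le_integrable mD _ _ ig); first exact/measurable_EFinP.
  move=> x Dx; rewrite /= lee_fin (le_trans (cmod_Re _))//.
  by rewrite (le_trans (fg _ Dx))// ler_norm.
- apply: (le_integrable mD _ _ ig); first exact/measurable_EFinP.
  move=> x Dx; rewrite /= lee_fin (le_trans (cmod_Im _))//.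
  by rewrite (le_trans (fg _ Dx))// ler_norm.
Qed.

Lemma cintegrable_cmeasurable f : cintegrable f -> cmeasurable f.
Proof.
by move=> [/measurable_int/measurable_EFinP h1 /measurable_int/measurable_EFinP h2].
Qed.

Lemma cmeasurable_cmod f : cmeasurable f -> measurable_fun D (fun x => cmod (f x)).
Proof.
move=> [h1 h2].
rewrite (_ : (fun x => _) = (fun x => Num.sqrt (complex.Re (f x) ^+ 2 + complex.Im (f x) ^+ 2))).
  apply: (measurableT_comp (continuous_measurable_fun (@sqrt_continuous R))).
  by apply: measurable_funD; apply: measurable_funX.
by apply/funext => x; case: (f x).
Qed.

Lemma cintegrable_cmod f : cintegrable f -> mu.-integrable D (fun x => (cmod (f x))%:E).
Proof.
move=> /[dup] /cintegrable_cmeasurable mf [h1 h2].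
have h1' := integrable_norm h1; have h2' := integrable_norm h2.
have h3 := integrableD mD h1' h2'.
apply: (le_integrable mD _ _ h3); first exact/measurable_EFinP/cmeasurable_cmod.
move=> x Dx; rewrite /= lee_fin (ger0_norm (cmod_ge0 _)).
by apply: (le_trans (cmod_le_ReIm _)); exact: ler_norm.
Qed.

Lemma cintegral_sub f g : cintegrable f -> cintegrable g ->
  cintegral mu D (fun x => f x - g x) = cintegral mu D f - cintegral mu D g.
Proof.
move=> [f1 f2] [g1 g2]; apply: complex_ext; rewrite /= ?ReIm /=.
  rewrite -RintegralB//; by apply: eq_Rintegral => x _; rewrite !ReIm.
rewrite -RintegralB//; by apply: eq_Rintegral => x _; rewrite !ReIm.
Qed.

Lemma cintegrableB f g : cintegrable f -> cintegrable g ->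
  cintegrable (fun x => f x - g x).
Proof.
move=> [f1 f2] [g1 g2]; split.
  have := integrableB mD f1 g1; congr (mu.-integrable D _).
  by apply/funext => x; rewrite !ReIm.
have := integrableB mD f2 g2; congr (mu.-integrable D _).
by apply/funext => x; rewrite !ReIm.
Qed.

Lemma cintegrableZ c f : cintegrable f -> cintegrable (fun x => c * f x).
Proof.
move=> [f1 f2]; split.
- rewrite (_ : (fun x => _) = (fun x => (complex.Re c)%:E * (complex.Re (f x))%:E
    - (complex.Im c)%:E * (complex.Im (f x))%:E)%E).
    by apply: integrableB => //; apply: integrableZl.
  by apply/funext => x; rewrite /= Re_mul EFinB !EFinM.
- rewrite (_ : (fun x => _) = (fun x => (complex.Re c)%:E * (complex.Im (f x))%:E
    + (complex.Im c)%:E * (complex.Re (f x))%:E)%E).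
    by apply: integrableD => //; apply: integrableZl.
  by apply/funext => x; rewrite /= Im_mul EFinD !EFinM.
Qed.

Lemma cintegralZ c f : cintegrable f ->
  cintegral mu D (fun x => c * f x) = c * cintegral mu D f.
Proof.
move=> [f1 f2]; apply: complex_ext; rewrite /= ?ReIm /=.
  rewrite -!RintegralZl// -RintegralB//; last 2 first.
  - by have := integrableZl mD (complex.Re c) f1.
  - by have := integrableZl mD (complex.Im c) f2.
  by apply: eq_Rintegral => x _; rewrite !ReIm.
rewrite -!RintegralZl// -RintegralD//; last 2 first.
- by have := integrableZl mD (complex.Re c) f2.
- by have := integrableZl mD (complex.Im c) f1.
by apply: eq_Rintegral => x _; rewrite !ReIm.
Qed.

(** Rotate the integral onto the positive real axis: its modulus becomes the
    integral of a real part, which is at most the modulus of the integrand. *)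
Lemma cmod_cintegral_le f : cintegrable f ->
  cmod (cintegral mu D f) <= \int[mu]_(x in D) cmod (f x).
Proof.
move=> intf; set I := cintegral mu D f.
have [I0|I0] := eqVneq (cmod I) 0.
  by rewrite I0; apply: Rintegral_ge0 => x _; exact: cmod_ge0.
have [c c1 cI] := cmod_rotate I0.
rewrite -cI -cintegralZ// /=.
apply: le_Rintegral => //.
- by case: (cintegrableZ c intf).
- exact: cintegrable_cmod.
- move=> x Dx; apply: (le_trans (ler_norm _)); apply: (le_trans (cmod_Re _)).
  by rewrite cmodM c1 mul1r.
Qed.

Lemma eq_cintegral f g : {in D, f =1 g} -> cintegral mu D f = cintegral mu D g.
Proof.
by move=> fg; congr Complex; apply: eq_Rintegral => x Dx; rewrite fg.
Qed.

End complex_integral.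

Section laplace_transform.
Context {R : realType}.
Variable U : {measure set (measurableTypeR R) -> \bar R}.
Implicit Types (w : R -> R) (z h : R[i]) (a : R).
Local Notation D := (`[0%R, +oo[%classic : set (measurableTypeR R)).

(** The weight w allows the measures x^n U(dx), which appear when the transform
    of U is differentiated, to be treated through U itself. *)
Definition laplace_admissible w := [/\ measurable_fun setT w,
  (forall x, 0 <= x -> 0 <= w x) &
  forall a, 0 < a -> U.-integrable D (fun x => (w x * expR (- (a * x)))%:E)].

Definition laplace w z : R[i] :=
  cintegral U D (fun x => (w x)%:C * cexp (- (z * x%:C))).

Let mD : measurable D. Proof. exact: measurable_itv. Qed.

Lemma measurable_expRN a : measurable_fun setT (fun x : R => expR (- (a * x))).
Proof.
by apply: measurableT_comp => //; apply: measurableT_comp => //; exact: measurable_funM.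
Qed.

(** One factor x costs half of the exponential decay: x exp (- a x / 2) is
    bounded by 2 / a. *)
Lemma laplace_admissible_mulx w : laplace_admissible w ->
  laplace_admissible (fun x => x * w x).
Proof.
move=> [mw w0 iw]; split.
- exact: measurable_funM.
- by move=> x x0; rewrite mulr_ge0// w0.
- move=> a a0; have a20 : 0 < a / 2 by rewrite divr_gt0.
  have h := integrableZl mD (2 / a) (iw _ a20).
  apply: (le_integrable mD _ _ h).
    apply/measurable_EFinP/measurable_funTS; apply: measurable_funM; first exact: measurable_funM.
    exact: measurable_expRN.
  move=> x; rewrite /= in_itv/= andbT => x0; rewrite lee_fin.
  have e1 := expR_ge1Dx (a / 2 * x).
  have w1 := w0 x x0.
  have E : expR (- (a / 2 * x)) = expR (a / 2 * x) * expR (- (a * x)).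
    by rewrite -expRD; congr expR; field.
  rewrite E !ger0_norm ?mulr_ge0 ?expR_ge0//; last first.
    by rewrite invr_ge0 ltW.
  have -> : x * w x * expR (- (a * x)) = (2 / a) * (w x * ((a / 2 * x) * expR (- (a * x)))).
    by field; exact: lt0r_neq0.
  rewrite ler_wpM2l ?divr_ge0 ?(ltW a0)// ler_wpM2l// ler_wpM2r ?expR_ge0//.
  by apply: le_trans e1; rewrite lerDr.
Qed.

Lemma laplace_cmeasurable (A : set (measurableTypeR R)) w z : measurable_fun setT w ->
  cmeasurable A (fun x : R => (w x)%:C * cexp (- (z * x%:C))).
Proof.
move=> mw.
have me : measurable_fun setT (fun x : R => expR (- (complex.Re z * x))).
  exact: measurable_expRN.
have mz : measurable_fun setT (fun x : R => - (complex.Im z * x)).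
  by apply: measurableT_comp => //; exact: measurable_funM.
split.
- rewrite (_ : (fun x : R => _) =
    (fun x => w x * (expR (- (complex.Re z * x)) * cos (- (complex.Im z * x))))).
    apply: measurable_funTS; apply: measurable_funM => //; apply: measurable_funM => //.
    by apply: (measurableT_comp _ mz); apply: continuous_measurable_fun; exact: continuous_cos.
  by apply/funext => x; rewrite !ReIm /= !ReIm /=; rewrite !(mulr0, mul0r, subr0, addr0, add0r).
- rewrite (_ : (fun x : R => _) =
    (fun x => w x * (expR (- (complex.Re z * x)) * sin (- (complex.Im z * x))))).
    apply: measurable_funTS; apply: measurable_funM => //; apply: measurable_funM => //.
    by apply: (measurableT_comp _ mz); apply: continuous_measurable_fun; exact: continuous_sin.
  by apply/funext => x; rewrite !ReIm /= !ReIm /=; rewrite !(mulr0, mul0r, subr0, addr0, add0r).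
Qed.

Lemma cmod_laplace_integrand w z x : 0 <= x -> 0 <= w x ->
  cmod ((w x)%:C * cexp (- (z * x%:C))) = w x * expR (- (complex.Re z * x)).
Proof.
move=> x0 w0; rewrite cmodM cmod_real ger0_norm// cmod_cexp.
by rewrite Re_opp Re_mul /= mulr0 subr0.
Qed.

Lemma laplace_cintegrable w z : laplace_admissible w -> 0 < complex.Re z ->
  cintegrable U D (fun x : R => (w x)%:C * cexp (- (z * x%:C))).
Proof.
move=> [mw w0 iw] z0; apply: (cintegrable_le mD _ (iw _ z0)).
  exact: laplace_cmeasurable.
by move=> x; rewrite /= in_itv/= andbT => x0; rewrite cmod_laplace_integrand// w0.
Qed.

(** Differentiation under the integral sign: for |h| <= Re z / 2 the remainder
    of the integrand is at most 4 |h|^2 x^2 w (x) exp (- Re z x / 2), which is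
    integrable. *)
Lemma cdiff_laplace w z : laplace_admissible w -> 0 < complex.Re z ->
  cdiff (laplace w) z (- laplace (fun x => x * w x) z).
Proof.
move=> wadm z0.
have xadm := laplace_admissible_mulx wadm.
have [mx x0 ix] := laplace_admissible_mulx xadm.
have z20 : 0 < complex.Re z / 2 by rewrite divr_gt0.
have z2z : complex.Re z / 2 < complex.Re z by rewrite ltr_pdivrMr// ltr_pMr// ltr1n.
apply: (@cdiff_quadratic _ _ _ _
  (4 * \int[U]_(x in D) (x * (x * w x) * expR (- (complex.Re z / 2 * x)))) _ z20).
move=> h hz; have Rh := cmod_Re h.
have zh0 : 0 < complex.Re (z + h).
  rewrite Re_add; move: Rh; rewrite ler_norml => /andP[+ _]; lra.
rewrite mulNr opprK /laplace.
have i1 := laplace_cintegrable wadm zh0.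
have i2 := laplace_cintegrable wadm z0.
have i3 := laplace_cintegrable xadm z0.
pose r (x : R) := (w x)%:C * cexp (- (z * x%:C)) *
  (cexp (- (h * x%:C)) - 1 - - (h * x%:C)).
have E : cintegral U D (fun x : R => (w x)%:C * cexp (- ((z + h) * x%:C))) -
  cintegral U D (fun x : R => (w x)%:C * cexp (- (z * x%:C))) +
  cintegral U D (fun x : R => (x * w x)%:C * cexp (- (z * x%:C))) * h =
  cintegral U D r /\ cintegrable U D r.
  have rE : r = fun x : R => (w x)%:C * cexp (- ((z + h) * x%:C)) -
    ((w x)%:C * cexp (- (z * x%:C)) - h * ((x * w x)%:C * cexp (- (z * x%:C)))).
    by apply/funext => x; rewrite /r mulrDl opprD cexpD rmorphM; ring.
  rewrite rE; split; last first.
    apply: cintegrableB => //; apply: cintegrableB => //; exact: cintegrableZ.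
  rewrite cintegral_sub//; last by apply: cintegrableB => //; exact: cintegrableZ.
  rewrite cintegral_sub//; last exact: cintegrableZ.
  by rewrite cintegralZ//; ring.
have [-> ir] := E.
apply: (le_trans (cmod_cintegral_le mD ir)).
have ix2 := ix _ z20.
rewrite mulrAC -RintegralZl//.
apply: le_Rintegral => //; first exact: cintegrable_cmod.
  by have := integrableZl mD (4 * cmod h ^+ 2) ix2.
move=> x; rewrite /= in_itv/= andbT => xx0.
have w1 : 0 <= w x by case: wadm => _ + _; apply.
rewrite /r cmodM cmod_laplace_integrand//.
apply: (@le_trans _ _ (w x * expR (- (complex.Re z * x)) *
   (4 * (cmod h * x) ^+ 2 * expR (complex.Re z / 2 * x)))).
  rewrite ler_wpM2l ?mulr_ge0 ?expR_ge0//; apply: (le_trans (cexp_sub1B_le _)).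
  rewrite cmodN cmodM cmod_real ger0_norm// ler_wpM2l ?mulr_ge0 ?cmod_ge0//.
  by rewrite ler_expR ler_wpM2r// ltW.
rewrite (_ : expR (- (complex.Re z / 2 * x)) =
  expR (- (complex.Re z * x)) * expR (complex.Re z / 2 * x)).
  by rewrite le_eqVlt; apply/orP; left; apply/eqP; ring.
by rewrite -expRD; congr expR; field.
Qed.

Lemma laplace_admissible_mulXn w n : laplace_admissible w ->
  laplace_admissible (fun x => x ^+ n * w x).
Proof.
move=> wadm; elim: n => [|n /laplace_admissible_mulx].
  by rewrite (_ : (fun x => _) = w)//; apply/funext => x; rewrite mul1r.
by congr laplace_admissible; apply/funext => x; rewrite exprS mulrA.
Qed.

Lemma cderivn_laplace w (f : R[i] -> R[i]) n z : laplace_admissible w ->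
  (forall s, 0 < complex.Re s -> f s = laplace w s) -> 0 < complex.Re z ->
  cderivn n f z = (-1) ^+ n * laplace (fun x => x ^+ n * w x) z.
Proof.
move=> wadm fE z0.
have adm k := laplace_admissible_mulXn k wadm.
apply: (cderivn_halfplane (F := fun k s => (-1) ^+ k * laplace (fun x => x ^+ k * w x) s)) => //.
  move=> s s0; rewrite mul1r fE//; congr laplace.
  by apply/funext => x; rewrite mul1r.
move=> k s s0; have := cdiffZ ((-1) ^+ k) (cdiff_laplace (adm k) s0).
rewrite [X in _ -> cdiff _ _ (_ * laplace X _)](_ : _ = fun x => x * (x ^+ k * w x)).
  by rewrite exprS mulN1r mulNr mulrN.
by apply/funext => x; rewrite exprS mulrA.
Qed.

End laplace_transform.

(** * Laplace transforms of powers *)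

Section gamma_integrals.
Context {R : realType}.
Implicit Types (s a b x : R) (z : R[i]).
Local Notation mu := (@lebesgue_measure R).
Local Notation D := (`[0%R, +oo[%classic : set (measurableTypeR R)).

Lemma expRN_cvgy a : 0 < a -> expR (- (a * x)) @[x --> +oo] --> (0 : R).
Proof.
move=> a0; apply: (@cvg_comp _ _ _ (fun x => a * x) (fun y => expR (- y)) _ +oo%R).
  exact: gt0_cvgMry.
exact: cvgr_expR.
Qed.

Lemma is_derive_expRN a x : is_derive x 1 (fun x => expR (- (a * x))) (- (a * expR (- (a * x)))).
Proof.
have h : is_derive x (1 : R) (fun x : R => - (a * x)) (- a).
  apply: is_derive_eq. by rewrite /GRing.scale /= mulr1.
by apply: is_derive_eq; rewrite /GRing.scale /= mulrN mulrC.
Qed.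

Lemma integrable_halfline_closed (f : R -> R) : measurable_fun setT f ->
  mu.-integrable `]0, +oo[ (EFin \o f) -> mu.-integrable D (EFin \o f).
Proof.
move=> mf /integrableP[_ h]; apply/integrableP; split.
  exact/measurable_EFinP/measurable_funTS.
rewrite -(@integral_itv_obnd_cbnd R 0 (BInfty R false))//.
by apply: measurableT_comp => //; exact/measurable_EFinP/measurable_funTS.
Qed.

Lemma integral_expRN a : 0 < a ->
  (\int[mu]_(x in `]0%R, +oo[) (expR (- (a * x)))%:E = (a^-1)%:E)%E.
Proof.
move=> a0.
have dF x : 0 < x -> is_derive x 1 (fun x => - (expR (- (a * x)) / a)) (expR (- (a * x))).
  have := is_derive_expRN a x => h _.
  apply: is_derive_eq.
  by rewrite scaler0 add0r /GRing.scale /=; field; exact: lt0r_neq0.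
rewrite (@ge0_FTC_halfline R _ (fun x => - (expR (- (a * x)) / a)) (- a^-1) 0 dF)
  ?sub0r ?opprK//.
- move=> x _; apply/differentiable_continuous/derivable1_diffP.
  by have [] := is_derive_expRN a x.
- apply: cvgN; rewrite -[X in _ --> X]mul1r; apply: cvgMl.
  rewrite -[X in _ --> X]expR0.
  have : {for 0, continuous (fun x => expR (- (a * x)))}.
    apply/differentiable_continuous/derivable1_diffP.
    by have [] := is_derive_expRN a 0.
  by move/cvg_at_right_filter; rewrite mulr0 oppr0.
- rewrite -oppr0; apply: cvgN; rewrite -(mul0r a^-1); apply: cvgMl.
  exact: expRN_cvgy.
Qed.

Lemma integrable_expRN a : 0 < a -> mu.-integrable D (EFin \o (fun x => expR (- (a * x)))).
Proof.
move=> a0; apply: integrable_halfline_closed; first exact: measurable_expRN.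
apply/integrableP; split.
  by apply/measurable_EFinP; apply: measurable_funTS; exact: measurable_expRN.
by under eq_integral do rewrite /= ger0_norm ?expR_ge0//; rewrite integral_expRN ?ltry.
Qed.

Lemma powR_cvgy s : 0 < s -> x `^ s @[x --> +oo] --> +oo.
Proof.
move=> s0; apply/cvgryPge => A; near=> x.
have x0 : 0 <= x by near: x; exact: nbhs_pinfty_ge.
have xA : `|A| `^ s^-1 <= x by near: x; exact: nbhs_pinfty_ge.
apply: (le_trans (ler_norm A)).
rewrite -[leLHS]powRr1// -(mulVf (lt0r_neq0 s0)) powRrM.
by rewrite ge0_ler_powR ?nnegrE ?powR_ge0 ?(ltW s0).
Unshelve. all: by end_near. Qed.

(* For s <= 1 the integrand is dominated near 0 by the derivative of
   - exp (- x^s), and for x > 1 by the exponential alone. *)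
Let admissible_powR_le1 s : 0 < s <= 1 ->
  laplace_admissible mu (fun x => x `^ (s - 1)).
Proof.
move=> /andP[s0 s1]; split.
- exact: measurable_powR.
- by move=> x _; exact: powR_ge0.
- move=> a a0.
have sn0 := lt0r_neq0 s0.
have mf : measurable_fun setT (fun x => x `^ (s - 1) * expR (- (a * x)) : R).
  by apply: measurable_funM; [exact: measurable_powR|exact: measurable_expRN].
have mg : measurable_fun setT (fun x => s * x `^ (s - 1) * expR (- (x `^ s)) : R).
  apply: measurable_funM; first by apply: measurable_funM => //; exact: measurable_powR.
  by apply: measurableT_comp => //; apply: measurableT_comp => //; exact: measurable_powR.
apply: (@integrable_halfline_closed (fun x => x `^ (s - 1) * expR (- (a * x)))) => //.
have dG x : 0 < x -> is_derive x 1 (fun x => expR (- x `^ s))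
   (- (s * x `^ (s - 1) * expR (- (x `^ s)))).
  move=> x0; have h := is_derive1_powR s x0.
  apply: is_derive_eq; rewrite /GRing.scale /=; ring.
have dF x : 0 < x -> is_derive x 1 (fun x => - expR (- x `^ s))
   (s * x `^ (s - 1) * expR (- (x `^ s))).
  by move=> x0; have h := dG x x0; apply: is_derive_eq; rewrite opprK.
have ig : mu.-integrable `]0, +oo[ (EFin \o (fun x => s * x `^ (s - 1) * expR (- (x `^ s)))).
  apply/integrableP; split; first by apply/measurable_EFinP; exact: measurable_funTS.
  under eq_integral do rewrite /= ger0_norm ?mulr_ge0 ?expR_ge0 ?powR_ge0 ?(ltW s0)//.
  rewrite (@ge0_FTC_halfline R _ (fun x => - expR (- (x `^ s))) (- 1) 0 dF) ?ltry//.
  - move=> x x0; apply/differentiable_continuous/derivable1_diffP.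
    have h := is_derive1_powR s x0; have h2 := is_derive1_powR (s - 1) x0.
    apply: derivableM; first by apply: derivableM => //; exact: derivable_cst.
    by have [] := dG x x0.
  - apply: cvgN; rewrite -expR0 -[X in expR X]oppr0.
    apply: (continuous_cvg _ (@continuous_expR R _)); apply: cvgN; exact: powR_cvg0.
  - rewrite -oppr0; apply: cvgN.
    apply: (@cvg_comp _ _ _ (fun x => x `^ s) (fun y => expR (- y)) _ +oo%R); last exact: cvgr_expR.
    exact: powR_cvgy.
  - by move=> x _; rewrite !mulr_ge0 ?expR_ge0 ?powR_ge0 ?(ltW s0).
have mD0 : measurable (`]0, +oo[%classic : set (measurableTypeR R)).
  exact: measurable_itv.
have i1 := integrableZl mD0 (expR 1 / s) ig.
have i2 : mu.-integrable `]0, +oo[ (EFin \o (fun x => expR (- (a * x)))).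
  apply: integrableS (integrable_expRN a0) => // y /=.
  by rewrite !in_itv/= !andbT => /ltW.
have i3 := integrableD mD0 i1 i2.
apply: (le_integrable mD0 _ _ i3).
  by apply/measurable_EFinP; exact: measurable_funTS.
move=> x; rewrite /= in_itv/= andbT => x0; rewrite lee_fin.
have e0 := expR_gt0 (1 : R).
have p1 : 0 <= x `^ (s - 1) by exact: powR_ge0.
have q1 := expR_gt0 (- (a * x)); have q2 := expR_gt0 (- (x `^ s)).
rewrite !ger0_norm ?addr_ge0 ?mulr_ge0 ?invr_ge0 ?(ltW q1) ?(ltW q2) ?(ltW e0) ?(ltW s0)//.
have [x1|x1] := lerP x 1.
  apply: (@le_trans _ _ (x `^ (s - 1))).
    by rewrite ler_piMr// -expR0 ler_expR oppr_le0 mulr_ge0// ltW.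
  have -> : expR 1 / s * (s * x `^ (s - 1) * expR (- x `^ s)) =
    x `^ (s - 1) * expR (1 - x `^ s) by rewrite expRD; field.
  rewrite -[leLHS]addr0 lerD ?(ltW q1)// ler_peMr// -expR0 ler_expR subr_ge0.
  apply: (@le_trans _ _ (1 `^ s)); last by rewrite powR1 expR0.
  by rewrite ge0_ler_powR ?nnegrE ?(ltW s0) ?(ltW x0).
rewrite -[leLHS]add0r lerD ?mulr_ge0 ?invr_ge0 ?(ltW q2) ?(ltW e0) ?(ltW s0)//.
rewrite -[leRHS]mul1r ler_wpM2r ?(ltW q1)//.
apply: (@le_trans _ _ (x `^ 0)); last by rewrite powRr0.
by rewrite ler_powR ?(ltW x1)//; lra.
Qed.

(** Multiplication by x raises s by one, which reduces to 0 < s <= 1. *)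
Lemma powR_admissible s : 0 < s -> laplace_admissible mu (fun x => x `^ (s - 1)).
Proof.
move=> s0.
have [n sn] : exists n : nat, s <= n.+1%:R.
  by exists (Num.truncn s); rewrite ltW// truncnS_gt.
elim: n s s0 sn => [|n IH] s s0 sn; first by apply: admissible_powR_le1; rewrite s0.
have [s1|s1] := lerP s 1; first by apply: admissible_powR_le1; rewrite s0.
have /laplace_admissible_mulx : laplace_admissible mu (fun x => x `^ (s - 1 - 1)).
  by apply: IH; move: sn; rewrite ?subr_gt0// (natrD _ 1 n.+1); lra.
move=> [m1 m2 m3]; split.
- exact: measurable_powR.
- by move=> x _; exact: powR_ge0.
- move=> a /m3; apply: eq_integrable => // x; rewrite inE/= in_itv/= andbT => x0.
  by rewrite mulr_powRB1// subr_gt0.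
Qed.

(** Along a line a complex derivative becomes a pair of real ones, to which the
    mean value theorem and the fundamental theorem of calculus apply. *)
Lemma cdiff_is_derive_line (f : R[i] -> R[i]) (q v l : R[i]) (t : R) :
  cdiff f (q + t%:C * v) l ->
  is_derive t (1 : R) (fun s : R => complex.Re (f (q + s%:C * v))) (complex.Re (l * v)) /\
  is_derive t (1 : R) (fun s : R => complex.Im (f (q + s%:C * v))) (complex.Im (l * v)).
Proof.
move=> fl.
have key : forall e : R, 0 < e -> \forall h \near (0 : R)^',
  cmod (h^-1%:C * (f (q + (h + t)%:C * v) - f (q + t%:C * v)) - l * v) <= e.
  move=> e e0; have v1 : 0 < cmod v + 1 by rewrite ltr_wpDl ?cmod_ge0.
  have [d d0 H] := fl _ (divr_gt0 e0 v1).
  near=> h.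
  have h0 : h != 0 by near: h; exact: nbhs_dnbhs_neq.
  have hd : `|h| < d / (cmod v + 1) by near: h; apply: dnbhs0_lt; exact: divr_gt0.
  have hn : 0 < `|h| by rewrite normr_gt0.
  have hcv : cmod (h%:C * v) <= `|h| * (cmod v + 1).
    by rewrite cmodM cmod_real ler_wpM2l// lerDl.
  have := H (h%:C * v).
  have -> : q + t%:C * v + h%:C * v = q + (h + t)%:C * v by rewrite rmorphD /=; ring.
  move=> /(_ _)/wrap[]; first by apply: (le_lt_trans hcv); rewrite -ltr_pdivlMr.
  move=> {}H.
  have hc0 : h%:C != 0 :> R[i].
    by apply/eqP => /(congr1 (@complex.Re R)) /= h00; rewrite h00 eqxx in h0.
  have -> : h^-1%:C * (f (q + (h + t)%:C * v) - f (q + t%:C * v)) - l * v =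
    h%:C^-1 * (f (q + (h + t)%:C * v) - f (q + t%:C * v) - l * (h%:C * v)).
    rewrite fmorphV; field; exact: hc0.
  rewrite cmodM cmodV cmod_real ler_pdivrMl//; apply: (le_trans H).
  apply: (@le_trans _ _ (e / (cmod v + 1) * (`|h| * (cmod v + 1)))).
    by rewrite ler_wpM2l// divr_ge0 ?(ltW e0) ?(ltW v1).
  by rewrite le_eqVlt; apply/orP; left; apply/eqP; field; exact: lt0r_neq0.
have dr (g : R[i] -> R) (m : R) (gl : forall x y : R[i], `|g x - g y| <= cmod (x - y))
   (gZ : forall (x : R) (y : R[i]), g (x%:C * y) = x * g y)
   (gB : forall x y : R[i], g (x - y) = g x - g y) :
   m = g (l * v) -> is_derive t (1 : R) (fun s : R => g (f (q + s%:C * v))) m.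
  move=> me.
  have H : (fun h : R => h^-1 *: (g (f (q + (h *: (1 : R) + t)%:C * v)) - g (f (q + t%:C * v))))
      @ 0^' --> m.
    apply/cvgrPdist_le => e e0; have := key _ e0; apply: filterS => h {}key.
    rewrite [h%:A]mulr1 distrC me /GRing.scale /= -gB -gZ.
    exact: (le_trans (gl _ _)).
  split; first by apply/cvg_ex; exists m.
  by apply: cvg_lim H.
split.
- apply: (dr (@complex.Re R)) => //.
  + by move=> x y; rewrite -Re_opp -Re_add; exact: cmod_Re.
  + by move=> x y; rewrite Re_mul /= mul0r subr0.
  + by move=> x y; rewrite Re_add Re_opp.
- apply: (dr (@complex.Im R)) => //.
  + by move=> x y; rewrite -Im_opp -Im_add; exact: cmod_Im.
  + by move=> x y; rewrite Im_mul /= mul0r addr0.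
  + by move=> x y; rewrite Im_add Im_opp.
Unshelve. all: by end_near. Qed.

Lemma cdiff0_halfplane_cst (f : R[i] -> R[i]) :
  (forall z, 0 < complex.Re z -> cdiff f z 0) ->
  forall z w, 0 < complex.Re z -> 0 < complex.Re w -> f z = f w.
Proof.
move=> df z w z0 w0.
have lineE (t : R) : 0 <= t <= 1 -> cdiff f (w + t%:C * (z - w)) 0.
  move=> /andP[t0 t1]; apply: df; rewrite !ReIm /= mul0r subr0; nra.
have cst (g : R -> R) : (forall t : R, 0 <= t <= 1 -> is_derive t (1 : R) g 0) -> g 1 = g 0.
  move=> dg.
  have [||c _] := @MVT_segment R g (fun=> 0) 0 1 ler01.
  - by move=> x; rewrite in_itv/= => /andP[x0 x1]; apply: dg; rewrite !ltW.
  - apply: derivable_within_continuous => x; rewrite in_itv/= => /dg h.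
    exact: ex_derive.
  - by rewrite mul0r => /eqP; rewrite subr_eq0 => /eqP.
have e1 : w + (1 : R)%:C * (z - w) = z by rewrite mul1r addrC subrK.
have e0 : w + (0 : R)%:C * (z - w) = w by rewrite mul0r addr0.
have hR := cst (fun t => complex.Re (f (w + t%:C * (z - w)))).
have hI := cst (fun t => complex.Im (f (w + t%:C * (z - w)))).
apply: complex_ext.
- rewrite e1 e0 in hR; apply: hR => t /lineE/cdiff_is_derive_line[+ _].
  by rewrite mul0r.
- rewrite e1 e0 in hI; apply: hI => t /lineE/cdiff_is_derive_line[_].
  by rewrite mul0r.
Qed.

Lemma derivable_continuous_at (f : R -> R) x (l : R) : is_derive x (1 : R) f l ->
  {for x, continuous f}.
Proof. by move=> [df _]; apply/differentiable_continuous/derivable1_diffP. Qed.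

Lemma powR_expRN_cvgy s a : 0 < s -> 0 < a ->
  x `^ s * expR (- (a * x)) @[x --> +oo] --> (0 : R).
Proof.
move=> s0 a0.
pose n := Num.truncn s.
have sn : s <= n.+1%:R by rewrite ltW// truncnS_gt.
have a20 : 0 < a / 2 by rewrite divr_gt0.
pose K := (n.+1)`!%:R / (a / 2) ^+ n.+1.
have K0 : 0 <= K by rewrite divr_ge0// exprn_ge0// ltW.
apply: (@squeeze_cvgr _ _ _ _ (cst 0) (fun x => K * expR (- (a / 2 * x)))).
- near=> x.
  have x1 : 1 <= x by near: x; exact: nbhs_pinfty_ge.
  have x0 : 0 <= x by exact: le_trans x1.
  rewrite /cst mulr_ge0 ?powR_ge0 ?expR_ge0//=.
  have -> : expR (- (a / 2 * x)) = expR (a / 2 * x) * expR (- (a * x)).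
    by rewrite -expRD; congr expR; field.
  rewrite mulrA ler_wpM2r ?expR_ge0//.
  apply: (@le_trans _ _ (x ^+ n.+1)); first by rewrite -powR_mulrn// ler_powR.
  have h : 0 <= a / 2 * x by rewrite mulr_ge0// ltW.
  have := expR_ge1Dxn n h => h1.
  have {}h1 : (a / 2 * x) ^+ n.+1 / n.+1`!%:R <= expR (a / 2 * x).
    by apply: le_trans h1; rewrite lerDr.
  apply: (le_trans _ (ler_wpM2l K0 h1)).
  have c0 : (a / 2) ^+ n.+1 != 0 by rewrite expf_neq0// lt0r_neq0.
  have f0 : n.+1`!%:R != 0 :> R by rewrite pnatr_eq0 -lt0n fact_gt0.
  rewrite /K [(a / 2 * x) ^+ _]exprMn.
  move: c0 f0; move: ((a / 2) ^+ _) (_`!%:R) => c f c0 f0.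
  by rewrite le_eqVlt; apply/orP; left; apply/eqP; field; rewrite ?c0 ?f0.
- exact: cvg_cst.
- rewrite -(mulr0 K); apply: cvgMr; exact: expRN_cvgy.
Unshelve. all: by end_near. Qed.

(** The derivative of x^s exp (- z x) has integral 0 over the half-line, as this
    function vanishes at both ends. *)
Lemma laplace_powR_rec s z : 0 < s -> 0 < complex.Re z ->
  s%:C * laplace mu (fun x => x `^ (s - 1)) z =
  z * laplace mu (fun x => x * x `^ (s - 1)) z.
Proof.
move=> s0 z0.
have adm := powR_admissible s0.
have admx := laplace_admissible_mulx adm.
have i1 := laplace_cintegrable adm z0.
have i2 := laplace_cintegrable admx z0.
have mD : measurable D by exact: measurable_itv.
have j1 := cintegrableZ mD s%:C i1.
have j2 := cintegrableZ mD z i2.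
apply/eqP; rewrite -subr_eq0; apply/eqP.
rewrite /laplace -!cintegralZ// -cintegral_sub//.
pose E (x : R) := cexp (- (z * x%:C)).
set f := (X in cintegral _ _ X).
have fi : cintegrable mu D f by exact: cintegrableB.
have dE x : is_derive x (1 : R) (fun x => complex.Re (E x)) (complex.Re (- z * E x)) /\
            is_derive x (1 : R) (fun x => complex.Im (E x)) (complex.Im (- z * E x)).
  have := @cdiff_is_derive_line (@cexp R) 0 (- z) _ x (cdiff_cexp _).
  rewrite add0r.
  rewrite (_ : cexp (x%:C * - z) = E x); last by rewrite /E mulrN mulrC.
  rewrite (_ : (fun s0 => complex.Re _) = (fun x => complex.Re (E x))); last first.
    by apply/funext => y; rewrite add0r mulrN mulrC.
  rewrite (_ : (fun s0 => complex.Im _) = (fun x => complex.Im (E x))); last first.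
    by apply/funext => y; rewrite add0r mulrN mulrC.
  by rewrite (mulrC (E x)).
have mE x : 0 <= x -> cmod (E x) = expR (- (complex.Re z * x)).
  by move=> x0; rewrite cmod_cexp Re_opp Re_mul /= mulr0 subr0.
have main (g : R -> R) (g' : R -> R) :
   (forall x, is_derive x (1 : R) g (g' x)) ->
   (forall x, {for x, continuous g'}) ->
   (forall x, `|g x| <= cmod (E x)) ->
   mu.-integrable D (EFin \o (fun x => s * x `^ (s - 1) * g x + x * x `^ (s - 1) * g' x)) ->
   \int[mu]_(x in D) (s * x `^ (s - 1) * g x + x * x `^ (s - 1) * g' x) = 0.
  move=> dg cg' gE ig.
  have ig' : mu.-integrable `]0, +oo[
      (EFin \o (fun x => s * x `^ (s - 1) * g x + x * x `^ (s - 1) * g' x)).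
    apply: integrableS ig => // y /=.
    by rewrite !in_itv/= !andbT => /ltW.
  rewrite -Rintegral_itv_obnd_cbnd//.
  have cg x : {for x, continuous g} by exact: derivable_continuous_at (dg x).
  have dF x : 0 < x -> is_derive x 1 (fun x => x `^ s * g x)
     (s * x `^ (s - 1) * g x + x * x `^ (s - 1) * g' x).
    move=> x0; have h := is_derive1_powR s x0; have h2 := dg x.
    apply: is_derive_eq; rewrite /GRing.scale /= mulr_powRB1 ?(ltW x0)//; ring.
  rewrite (@Rintegral_FTC_halfline R _ (fun x => x `^ s * g x) 0 0 dF) ?subr0//.
  - move=> x x0.
    have cp := derivable_continuous_at (is_derive1_powR (s - 1) x0).
    apply: (@continuousD _ _ _ (fun x => s * x `^ (s - 1) * g x)).
      by apply: continuousM; [apply: continuousM => //; exact: cst_continuous|exact: cg].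
    by apply: continuousM; [apply: continuousM => //; exact: cvg_id|exact: cg'].
  - rewrite -[X in _ --> X](mul0r (g 0)); apply: cvgM; first exact: powR_cvg0.
    by apply: cvg_at_right_filter; exact: cg.
  - apply/norm_cvg0P.
    apply: (@squeeze_cvgr _ _ _ _ (cst 0) (fun x => x `^ s * expR (- (complex.Re z * x)))).
    + near=> x.
      have x0 : 0 <= x by near: x; exact: nbhs_pinfty_ge.
      rewrite /cst normr_ge0/= normrM (ger0_norm (powR_ge0 _ _)) ler_wpM2l ?powR_ge0//.
      by rewrite -mE.
    + exact: cvg_cst.
    + exact: powR_expRN_cvgy.
have cRI x : {for x, continuous (fun x => complex.Re (E x))} /\
  {for x, continuous (fun x => complex.Im (E x))}.
  by have [h1 h2] := dE x; split; [exact: derivable_continuous_at h1|exact: derivable_continuous_at h2].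
have [fr fI] := fi.
have e1 : (fun x : R => complex.Re (f x)) = (fun x => s * x `^ (s - 1) * complex.Re (E x) +
    x * x `^ (s - 1) * complex.Re (- z * E x)).
  by apply/funext => x; rewrite /f -/(E x) !ReIm /=; ring.
have e2 : (fun x : R => complex.Im (f x)) = (fun x => s * x `^ (s - 1) * complex.Im (E x) +
    x * x `^ (s - 1) * complex.Im (- z * E x)).
  by apply/funext => x; rewrite /f -/(E x) !ReIm /=; ring.
have h1 : \int[mu]_(x in D) (complex.Re (f x)) = 0.
  rewrite e1; apply: (main (fun x => complex.Re (E x)) (fun x => complex.Re (- z * E x))).
  - by move=> x; have [] := dE x.
  - move=> x; rewrite (_ : (fun x => complex.Re (- z * _)) =
      (fun x => - complex.Re z * complex.Re (E x) + complex.Im z * complex.Im (E x))).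
      have [k1 k2] := cRI x.
      apply: continuousD; apply: continuousM => //; exact: cst_continuous.
    by apply/funext => y; rewrite !ReIm; ring.
  - by move=> x; exact: cmod_Re.
  - by rewrite -e1.
have h2 : \int[mu]_(x in D) (complex.Im (f x)) = 0.
  rewrite e2; apply: (main (fun x => complex.Im (E x)) (fun x => complex.Im (- z * E x))).
  - by move=> x; have [] := dE x.
  - move=> x; rewrite (_ : (fun x => complex.Im (- z * _)) =
      (fun x => - complex.Re z * complex.Im (E x) - complex.Im z * complex.Re (E x))).
      have [k1 k2] := cRI x.
      apply: continuousB; apply: continuousM => //; exact: cst_continuous.
    by apply/funext => y; rewrite !ReIm; ring.
  - by move=> x; exact: cmod_Im.
  - by rewrite -e2.
by rewrite /cintegral h1 h2.
Unshelve. all: by end_near. Qed.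

Lemma laplace_powR1 s : 0 < s ->
  laplace mu (fun x => x `^ (s - 1)) 1 = (Gamma s)%:C.
Proof.
move=> s0; apply: complex_ext => /=.
- rewrite /Gamma Rintegral_itv_obnd_cbnd; last first.
    have [_ _ /(_ 1 ltr01)] := powR_admissible s0.
    move=> ig; apply: integrableS; last first.
    + apply: eq_integrable ig; first exact: measurable_itv.
      by move=> x _; rewrite mul1r.
    + by move=> y /=; rewrite !in_itv/= !andbT => /ltW.
    + exact: measurable_itv.
    + exact: measurable_itv.
  apply: eq_Rintegral => x _; rewrite !mul1r !mul0r !(oppr0, addr0).
  by rewrite cos0 mulr1.
- rewrite -[RHS](Rintegral_set0 mu (fun=> 0 : R)).
  rewrite [RHS](_ : _ = \int[mu]_(x in D) 0); last first.
    by rewrite Rintegral_set0 Rintegral_cst ?mul0r//; exact: measurable_itv.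
  apply: eq_Rintegral => x _; rewrite !mul1r !mul0r !(oppr0, addr0).
  by rewrite sin0 !mulr0.
Qed.

(** Both sides solve f' = - (s / z) f on the half-plane, so the quotient is
    constant there, and z = 1 is Euler's integral. *)
Lemma laplace_powR s z : 0 < s -> 0 < complex.Re z ->
  laplace mu (fun x => x `^ (s - 1)) z = (Gamma s)%:C * cpow z (- s)%:C.
Proof.
move=> s0 z0.
have adm := powR_admissible s0.
suff E : laplace mu (fun x => x `^ (s - 1)) z * cpow z s%:C = (Gamma s)%:C.
  by rewrite -E cpowN mulfK// cpow_neq0.
have D1 : 0 < complex.Re (1 : R[i]) by rewrite /= ltr01.
rewrite (@cdiff0_halfplane_cst (fun z => laplace mu (fun x => x `^ (s - 1)) z * cpow z s%:C) _ z 1 z0 D1).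
  rewrite laplace_powR1// (_ : 1 = (1 : R)%:C)// cpow_real//.
  by rewrite powR1 mulr1.
move=> y y0; have yn0 := Re_gt0_neq0 y0.
have := cdiffM (cdiff_laplace adm y0) (cdiff_cpow s y0).
congr cdiff.
rewrite cpowD cpowN cpow1//.
have := laplace_powR_rec s0 y0.
set L := laplace _ _ _; set L1 := laplace _ _ _ => e.
have -> : L1 = s%:C * L / y by rewrite e mulrC mulKf.
by field.
Qed.

Lemma GammaD1 s : 0 < s -> Gamma (s + 1) = s * Gamma s.
Proof.
move=> s0; have s10 : 0 < s + 1 by rewrite addr_gt0.
have D1 : 0 < complex.Re (1 : R[i]) by rewrite /= ltr01.
have := laplace_powR_rec s0 D1; rewrite laplace_powR1// mul1r.
have -> : laplace mu (fun x => x * x `^ (s - 1)) 1 = laplace mu (fun x => x `^ (s + 1 - 1)) 1.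
  apply: eq_cintegral => x; rewrite inE/= in_itv/= andbT => x0.
  by rewrite mulr_powRB1// addrK.
by rewrite laplace_powR1// => /(congr1 (@complex.Re R)); rewrite /= mul0r subr0 => ->.
Qed.

Lemma Gamma_gt0 s : 0 < s -> 0 < Gamma s.
Proof.
move=> s0; have [_ _ /(_ 1 ltr01)] := powR_admissible s0 => ig.
have mI : measurable (`[1, 2]%classic : set (measurableTypeR R)) by exact: measurable_itv.
have mO : measurable (`]0, +oo[%classic : set (measurableTypeR R)) by exact: measurable_itv.
have c0 : 0 < 2^-1 * expR (- 2) :> R by rewrite mulr_gt0 ?expR_gt0.
have iO : mu.-integrable `]0, +oo[ (EFin \o (fun x => x `^ (s - 1) * expR (- x))).
  apply: integrableS; last first.
  + apply: eq_integrable ig; first exact: measurable_itv.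
    by move=> x _; rewrite mul1r.
  + by move=> y /=; rewrite !in_itv/= !andbT => /ltW.
  + exact: measurable_itv.
  + exact: measurable_itv.
have sub : (`[1, 2]%classic : set R) `<=` `]0, +oo[%classic.
  by move=> y /=; rewrite !in_itv/= !andbT => /andP[y1 _]; exact: lt_le_trans y1.
apply: (lt_le_trans c0).
rewrite -lee_fin /Gamma /Rintegral fineK; last exact: integrable_fin_num.
apply: (@le_trans _ _ (\int[mu]_(x in `[1%R, 2%R]) (x `^ (s - 1) * expR (- x))%:E)%E).
  apply: (@le_trans _ _ (\int[mu]_(x in `[1%R, 2%R]) (2^-1 * expR (- 2))%:E)%E).
    rewrite integral_cst// [X in (_ * X)%E](_ : _ = 1%:E) ?mule1//.
    transitivity (mu `[1, 2]%classic) => //.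
    rewrite lebesgue_measure_itv/= lte_fin ltr1n -EFinB; congr EFin; lra.
  apply: ge0_le_integral => //.
  - apply/measurable_EFinP; apply: measurable_funTS; apply: measurable_funM.
      exact: measurable_powR.
    by apply: measurableT_comp.
  - move=> x; rewrite /= in_itv/= => /andP[x1 x2]; rewrite lee_fin.
    have x0 : 0 < x by exact: lt_le_trans x1.
    have p1 : 1 <= x `^ s.
      by rewrite -(powRr0 x) ler_powR// ltW.
    rewrite ler_pM ?expR_ge0//; last by rewrite ler_expR lerN2.
    rewrite -(mulr_powRB1 (ltW x0) s0) in p1.
    have p0 := powR_ge0 x (s - 1).
    by rewrite -[2^-1]mul1r ler_pdivrMr//; nra.
apply: ge0_subset_integral => //.
- by apply/measurable_EFinP; case/integrableP: iO => /measurable_EFinP.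
- by move=> x _; rewrite lee_fin mulr_ge0 ?powR_ge0 ?expR_ge0.
Qed.

(** By the functional equation the quotient of the product by Gamma (a + n) is the
    same for all n with a + n > 0; the definition of [rgamma] takes one of them. *)
Lemma rgamma_Gamma a n : 0 < a + n%:R ->
  rgamma a * Gamma (a + n%:R) = \prod_(i < n) (a + i%:R).
Proof.
pose P m := \prod_(i < m) (a + i%:R).
have step m k : 0 < a + m%:R -> P (m + k)%N / Gamma (a + (m + k)%:R) = P m / Gamma (a + m%:R).
  move=> m0; elim: k => [|k IH]; first by rewrite addn0.
  have mk0 : 0 < a + (m + k)%:R.
    by rewrite natrD addrA ltr_wpDr.
  have GE : Gamma (a + (m + k).+1%:R) = (a + (m + k)%:R) * Gamma (a + (m + k)%:R).
    by rewrite -natr1 addrA GammaD1.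
  rewrite -IH addnS GE {1}/P big_ord_recr -/(P (m + k)%N).
  by rewrite invfM mulrA (mulfK (lt0r_neq0 mk0)).
move=> n0; rewrite /rgamma; set m := (_).+1.
have m0 : 0 < a + m%:R.
  have := ler_norm (- a); have := truncnS_gt `|a|; rewrite normrN -/m; lra.
rewrite -[X in X * _]/(P m / Gamma (a + m%:R)) -[RHS]/(P n).
have -> : P m / Gamma (a + m%:R) = P n / Gamma (a + n%:R).
  by rewrite -(step m n m0) -(step n m n0) addnC.
by rewrite divfK// lt0r_neq0// Gamma_gt0.
Qed.

End gamma_integrals.

(** * Fourier inversion by the Poisson kernel *)

Section poisson_kernel.
Context {R : realType}.
Implicit Types (e s x y p q : R).
Local Notation mu := (@lebesgue_measure R).
Local Notation Do := (`]0%R, +oo[%classic : set (measurableTypeR R)).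

Lemma Gamma1 : Gamma 1 = 1 :> R.
Proof.
rewrite /Gamma -[RHS]/(fine 1%:E) -[X in X%:E]invr1 -(integral_expRN ltr01); congr fine.
by apply: eq_integral => x _; rewrite subrr powRr0 !mul1r.
Qed.

(** The real part of the transform 1 / (e + i s) of the constant 1. *)
Lemma integral_halfline_expRN_cos e s : 0 < e ->
  \int[mu]_(x in Do) (expR (- (e * x)) * cos (s * x)) = e / (e ^+ 2 + s ^+ 2).
Proof.
move=> e0.
have := @laplace_powR R 1 (e +i* s) ltr01 e0.
rewrite Gamma1 cpowN cpow1// mul1r => /(congr1 (@complex.Re R)) /= E.
rewrite -E Rintegral_itv_obnd_cbnd; last first.
  apply: (@le_integrable _ _ _ mu Do _ _ (EFin \o (fun x => expR (- (e * x))))).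
  - exact: measurable_itv.
  - apply/measurable_EFinP; apply: measurable_funTS; apply: measurable_funM.
      exact: measurable_expRN.
    apply: (measurableT_comp (continuous_measurable_fun (@continuous_cos R))).
    exact: measurable_funM.
  - move=> x _; rewrite /= lee_fin normrM ler_piMr// ler_norml.
    by rewrite cos_le1 cos_geN1.
  - apply: integrableS (integrable_expRN e0) => //.
    by move=> y /=; rewrite !in_itv/= !andbT => /ltW.
apply: eq_Rintegral => x _; rewrite subrr powRr0 mul1r !mul0r subr0 !mulr0 add0r !subr0.
by rewrite cosN.
Qed.

Lemma is_derive_atan x : is_derive x (1 : R) (@atan R) (1 + x ^+ 2)^-1.
Proof. by split; [exact: derivable_atan|rewrite -derive1E derive1_atan]. Qed.

Lemma integral_poisson_kernel e y p q : 0 < e -> p < q ->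
  (\int[mu]_(x in `[p, q]) (e / (e ^+ 2 + (x - y) ^+ 2))%:E =
  (atan ((q - y) / e) - atan ((p - y) / e))%:E)%E.
Proof.
move=> e0 pq.
pose F x := atan ((x - y) / e).
have en0 := lt0r_neq0 e0.
have dn0 x : e ^+ 2 + (x - y) ^+ 2 != 0.
  by rewrite lt0r_neq0// ltr_wpDr ?sqr_ge0// exprn_gt0.
have dF x : is_derive x (1 : R) F (e / (e ^+ 2 + (x - y) ^+ 2)).
  have h1 : is_derive x (1 : R) (fun x => (x - y) / e) e^-1.
    apply: is_derive_eq; rewrite /GRing.scale /=; ring.
  have h2 := is_derive_atan ((x - y) / e).
  rewrite /F; apply: is_derive_eq; rewrite /GRing.scale /=; field.
  by rewrite en0 dn0.
have cF x : {for x, continuous F} by exact: derivable_continuous_at (dF x).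
rewrite (@continuous_FTC2 _ _ F)//.
- apply: continuous_subspaceT => x.
  apply: cvgM; first exact: cvg_cst.
  apply: cvgV; first exact: dn0.
  apply: cvgD; first exact: cvg_cst.
  have h : (fun t => t - y) t @[t --> x] --> x - y by apply: cvgB; [exact: cvg_id|exact: cvg_cst].
  exact: (cvgM h h).
- split.
  + by move=> x _; have [] := dF x.
  + by apply: cvg_at_right_filter; exact: cF.
  + by apply: cvg_at_left_filter; exact: cF.
- by move=> x _; have h := dF x; rewrite derive1E derive_val.
Qed.

Variable nu : {finite_measure set (measurableTypeR R) -> \bar R}.
Local Notation T := (measurableTypeR R).

(** The real part of exp (i t x) times the Fourier transform of nu at t: working
    with it from the start keeps the inversion real and over t > 0. *)
Definition cosint (t x : R) : R := \int[nu]_y cos (t * (x - y)).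

Let nuT_fin : nu setT \is a fin_num. Proof. exact: fin_num_measure. Qed.

Lemma measurable_cos_shift (t x : R) :
  measurable_fun setT (fun y : T => cos (t * (x - y))).
Proof.
apply: (measurableT_comp (continuous_measurable_fun (@continuous_cos R))).
by apply: measurable_funM => //; exact: measurable_funB.
Qed.

Let int_cst (k : R) : nu.-integrable setT (fun _ : T => k%:E).
Proof. exact: finite_measure_integrable_cst. Qed.

Lemma cos_norm_le1 (t : R) : `|cos t| <= 1.
Proof. by rewrite ler_norml cos_le1 cos_geN1. Qed.

Let int_cos (t x : R) : nu.-integrable setT (EFin \o (fun y : T => cos (t * (x - y)))).
Proof.
apply: le_integrable (int_cst 1) => //; first by apply/measurable_EFinP; exact: measurable_cos_shift.
by move=> y _; rewrite /= lee_fin normr1 cos_norm_le1.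
Qed.

Let cosint_cvg (t x : nat -> R) (t0 x0 : R) : t n @[n --> \oo] --> t0 ->
  x n @[n --> \oo] --> x0 -> cosint (t n) (x n) @[n --> \oo] --> cosint t0 x0.
Proof.
move=> tt0 xx0; rewrite /cosint.
apply: (@Rintegral_dominated_cvg _ T R nu setT _ _ _ (fun=> 1)) => //.
- by move=> n; exact: measurable_cos_shift.
- move=> y _; apply: continuous_cvg; first exact: continuous_cos.
  by apply: cvgM => //; apply: cvgB => //; exact: cvg_cst.
- exact: (int_cst 1).
- by move=> n y _; exact: cos_norm_le1.
Qed.

Lemma continuous_cosint_l x : continuous (cosint ^~ x).
Proof.
move=> t; apply/(@cvg_nbhsP _ R^o) => u ut.
by apply: cosint_cvg => //; exact: cvg_cst.
Qed.

Lemma continuous_cosint_r (t : R) : continuous (cosint t).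
Proof.
move=> x; apply/(@cvg_nbhsP _ R^o) => u ut.
by apply: cosint_cvg => //; exact: cvg_cst.
Qed.

Let measurable_cosint x : measurable_fun setT (cosint ^~ x).
Proof. by apply: continuous_measurable_fun; exact: continuous_cosint_l. Qed.

Let poisson_ge0 e x y : 0 < e -> 0 <= e / (e ^+ 2 + (x - y) ^+ 2).
Proof. by move=> e0; rewrite divr_ge0 ?(ltW e0)// addr_ge0 ?sqr_ge0. Qed.

(** Exchanging the two integrals turns the damped cosine transform of nu into
    the convolution of nu with the Poisson kernel of the half-plane. *)
Lemma cosint_poisson e x : 0 < e ->
  \int[mu]_(t in Do) (expR (- (e * t)) * cosint t x) =
  \int[nu]_y (e / (e ^+ 2 + (x - y) ^+ 2)).
Proof.
move=> e0.
pose E (t : T) : R := \1_Do t * expR (- (e * t)).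
have mDo : measurable Do by exact: measurable_itv.
have mE : measurable_fun setT E.
  by apply: measurable_funM; [exact: measurable_indic|exact: measurable_expRN].
pose f (p : T * T) : \bar R := (E p.1 * cos (p.1 * (x - p.2)))%:E.
have mf : measurable_fun setT f.
  apply/measurable_EFinP; apply: measurable_funM; first exact: (measurableT_comp mE).
  apply: (measurableT_comp (continuous_measurable_fun (@continuous_cos R))).
  by apply: measurable_funM => //; exact: measurable_funB.
have E0 t : 0 <= E t by rewrite mulr_ge0 ?expR_ge0.
have iE : mu.-integrable setT (EFin \o E).
  have : mu.-integrable Do (EFin \o (fun x => expR (- (e * x)))).
    apply: integrableS (integrable_expRN e0) => //.
    by move=> y /=; rewrite !in_itv/= !andbT => /ltW.
  move/(integrable_mkcond _ mDo).1; apply: eq_integrable => // t _.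
  rewrite patchE /= /E indicE; case: ifP => _ /=; by rewrite ?mul1r ?mul0r.
have mEc t : measurable_fun setT (fun y : T => E t * cos (t * (x - y))).
  by apply: measurable_funM; [exact: measurable_cst|exact: measurable_cos_shift].
have intf : (mu \x nu)%E.-integrable setT f.
  apply/(integrable12ltyP _ _ mf).
  apply: (@le_lt_trans _ _ (\int[mu]_t (E t * fine (nu setT))%:E)%E).
    apply: ge0_le_integral => //.
    - by move=> t _; exact: integral_ge0.
    - apply: (measurable_fun_fubini_tonelli_F (abse \o f)) => //=.
      by apply: measurableT_comp.
    - by apply/measurable_EFinP; apply: measurable_funM.
    - move=> t _.
      apply: (@le_trans _ _ (\int[nu]_y (E t)%:E)%E).
        apply: ge0_le_integral => //.
        + by apply: measurableT_comp => //; apply/measurable_EFinP; exact: mEc.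
        + by move=> y _; rewrite /= lee_fin normrM (ger0_norm (E0 t)) ler_piMr// cos_norm_le1.
      by rewrite integral_cst// [leRHS]EFinM fineK.
  under eq_integral do rewrite EFinM muleC.
  rewrite ge0_integralZl//; [|by apply/measurable_EFinP|by move=> t _; rewrite lee_fin|];
    last by rewrite lee_fin fine_ge0.
  rewrite -ge0_fin_numE.
    by rewrite fin_numM//; exact: (integrable_fin_num _ iE).
  by apply: mule_ge0; [rewrite lee_fin fine_ge0|apply: integral_ge0 => t _; rewrite lee_fin].
have := Fubini intf.
have -> : (fun t => (\int[nu]_y f (t, y))%E) = (fun t => (E t * cosint t x)%:E).
  apply/funext => t; rewrite /f /=.
  under eq_integral do rewrite EFinM.
  rewrite integralZl//; last exact: (int_cos t x).
  rewrite [RHS]EFinM /cosint /Rintegral fineK//.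
  exact: integrable_fin_num (int_cos t x).
have -> : (fun y => (\int[mu]_t f (t, y))%E) = (fun y => (e / (e ^+ 2 + (x - y) ^+ 2))%:E).
  apply/funext => y; rewrite -(integral_halfline_expRN_cos (x - y) e0).
  have i1 : mu.-integrable setT (EFin \o (fun t => E t * cos (t * (x - y)))).
    apply: (le_integrable _ _ _ iE) => //.
      apply/measurable_EFinP; apply: measurable_funM => //.
      apply: (measurableT_comp (continuous_measurable_fun (@continuous_cos R))).
      exact: measurable_funM.
    by move=> t _; rewrite /= lee_fin normrM ler_piMr// cos_norm_le1.
  transitivity ((\int[mu]_t (E t * cos (t * (x - y))))%:E).
    by rewrite /Rintegral fineK//; exact: (integrable_fin_num _ i1).
  congr EFin; rewrite [RHS]Rintegral_mkcond; apply: eq_Rintegral => t _.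
  rewrite patchE /= /E indicE mulrC; case: ifP => _ /=.
    by rewrite !mul1r (mulrC (x - y)) [RHS]mulrC.
  by rewrite !mul0r mulr0.
move=> /(congr1 fine) H; rewrite -[RHS]H [LHS]Rintegral_mkcond; congr fine.
apply: eq_integral => t _; congr EFin.
rewrite patchE /= /E indicE; case: ifP => _ /=; by rewrite ?mul1r ?mul0r.
Qed.

Section density.
Variable m : R -> R.
Hypothesis im : mu.-integrable Do (EFin \o m).
Hypothesis cm : forall t x, 0 < t -> `|cosint t x| <= m t.

Definition invdens (x : R) : R := pi^-1 * \int[mu]_(t in Do) cosint t x.

Let mDo : measurable Do. Proof. exact: measurable_itv. Qed.

Let Do0 (t : T) : Do t -> 0 < t. Proof. by rewrite /= in_itv/= andbT. Qed.

Let pi0 : 0 < pi :> R. Proof. exact: pi_gt0. Qed.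

Let V := pi^-1 * \int[mu]_(t in Do) m t.

Let cosint_integrable x : mu.-integrable Do (EFin \o (cosint ^~ x)).
Proof.
apply: le_integrable im => //; first by apply/measurable_EFinP; exact: measurable_funTS (measurable_cosint x).
by move=> t /Do0 t0; rewrite /= lee_fin (le_trans (cm x t0))// ler_norm.
Qed.

Let V0 : 0 <= V.
Proof.
rewrite mulr_ge0 ?invr_ge0 ?(ltW pi0)// Rintegral_ge0// => t /Do0 t0.
by rewrite (le_trans _ (cm 0 t0)).
Qed.

Lemma continuous_invdens : continuous invdens.
Proof.
move=> x; apply/(@cvg_nbhsP _ R^o) => u ux.
apply: cvgMr; apply: (@Rintegral_dominated_cvg _ T R mu Do _ _ _ m) => //.
- by move=> n; exact: measurable_funTS (measurable_cosint _).
- by move=> t _; apply: continuous_cvg => //; exact: continuous_cosint_r.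
- by move=> n t /Do0; exact: cm.
Qed.

(* The damping exp (- e t) replaces nu by its convolution with the Poisson
   kernel of width e, which is non-negative. *)
Let smoothed (e x : R) := pi^-1 * \int[mu]_(t in Do) (expR (- (e * t)) * cosint t x).

Let en (n : nat) : R := n.+1%:R^-1.
Let en0 n : 0 < en n. Proof. by rewrite invr_gt0. Qed.

Let damped_le e t x : 0 < e -> Do t -> `|expR (- (e * t)) * cosint t x| <= m t.
Proof.
move=> e0 /Do0 t0; rewrite normrM ger0_norm ?expR_ge0//.
apply: le_trans (cm x t0); rewrite ler_piMl// -expR0 ler_expR oppr_le0.
by rewrite mulr_ge0// ltW.
Qed.

Let measurable_damped e x : measurable_fun Do (fun t : T => expR (- (e * t)) * cosint t x).
Proof.
apply: measurable_funTS; apply: measurable_funM; first exact: measurable_expRN.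
exact: measurable_cosint.
Qed.

Let smoothed_cvg x : smoothed (en n) x @[n --> \oo] --> invdens x.
Proof.
apply: cvgMr; apply: (@Rintegral_dominated_cvg _ T R mu Do _ _ _ m) => //.
- move=> t _; rewrite -[X in _ --> X]mul1r; apply: cvgMl.
  rewrite -expR0; apply: continuous_cvg; first exact: continuous_expR.
  rewrite -[X in _ --> X]oppr0; apply: cvgN; rewrite -[X in _ --> X](mul0r t).
  by apply: cvgMl; exact: cvg_harmonic.
- by move=> n t; exact: damped_le.
Qed.

Let smoothedE e x : 0 < e ->
  smoothed e x = pi^-1 * \int[nu]_y (e / (e ^+ 2 + (x - y) ^+ 2)).
Proof. by move=> e0; rewrite /smoothed cosint_poisson. Qed.

Let smoothed_ge0 e x : 0 < e -> 0 <= smoothed e x.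
Proof.
move=> e0; rewrite smoothedE// mulr_ge0 ?invr_ge0 ?(ltW pi0)// Rintegral_ge0// => y _.
exact: poisson_ge0.
Qed.

Let smoothed_le e x : 0 < e -> `|smoothed e x| <= V.
Proof.
move=> e0; rewrite normrM ger0_norm ?invr_ge0 ?(ltW pi0)//.
rewrite ler_wpM2l ?invr_ge0 ?(ltW pi0)//.
have id : mu.-integrable Do (EFin \o (fun t => expR (- (e * t)) * cosint t x)).
  apply: le_integrable im => //; first by apply/measurable_EFinP.
  by move=> t Dt; rewrite /= lee_fin (le_trans (damped_le x e0 Dt))// ler_norm.
apply: (le_trans (le_normr_Rintegral mDo id)).
apply: le_Rintegral => //; first exact: integrable_norm.
by move=> t Dt; exact: damped_le.
Qed.

Lemma invdens_ge0 x : 0 <= invdens x.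
Proof.
rewrite -(cvg_lim _ (@smoothed_cvg x))//; apply: limr_ge; first exact/cvgP/smoothed_cvg.
by apply: nearW => n; exact: smoothed_ge0.
Qed.

Let invdens_le x : invdens x <= V.
Proof.
rewrite -(cvg_lim _ (@smoothed_cvg x))//; apply: limr_le; first exact/cvgP/smoothed_cvg.
by apply: nearW => n; rewrite (le_trans (ler_norm _))// smoothed_le.
Qed.

Let measurable_invdens : measurable_fun setT (invdens : T -> R).
Proof. by apply: continuous_measurable_fun; exact: continuous_invdens. Qed.

(* the Poisson mass of [p, q] seen from y *)
Let J (e p q y : R) := pi^-1 * (atan ((q - y) / e) - atan ((p - y) / e)).

Let measurable_smoothed e : 0 < e -> measurable_fun setT (smoothed e : T -> R).
Proof.
move=> e0; apply: continuous_measurable_fun => x; apply/(@cvg_nbhsP _ R^o) => u ux.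
apply: cvgMr; apply: (@Rintegral_dominated_cvg _ T R mu Do _ _ _ m) => //.
- move=> t _; apply: cvgMr; apply: continuous_cvg => //; exact: continuous_cosint_r.
- by move=> n t; exact: damped_le.
Qed.

Let pq_measure p q : p < q -> mu (`[p, q]%classic : set T) = (q - p)%:E.
Proof. by move=> pq; rewrite lebesgue_measure_itv/= lte_fin pq. Qed.

Let int_cst_pq (k p q : R) : p < q -> mu.-integrable (`[p, q]%classic : set T) (fun=> k%:E).
Proof.
move=> pq; apply/integrableP; split => //.
rewrite integral_cst/=; last exact: measurable_itv.
by rewrite [X in (_ * X)%E](pq_measure pq) -EFinM ltry.
Qed.

Let integral_smoothed e p q : 0 < e -> p < q ->
  \int[mu]_(x in `[p, q]) smoothed e x = \int[nu]_y J e p q y.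
Proof.
move=> e0 pq.
have mpq : measurable (`[p, q]%classic : set T) by exact: measurable_itv.
pose f (xy : T * T) : \bar R :=
  (\1_(`[p, q]%classic : set T) xy.1 * (pi^-1 * (e / (e ^+ 2 + (xy.1 - xy.2) ^+ 2))))%:E.
have f0 xy : (0 <= f xy)%E.
  by rewrite lee_fin !mulr_ge0 ?invr_ge0 ?(ltW pi0) ?(ltW e0)// addr_ge0 ?sqr_ge0.
have cg : continuous (fun s : R => pi^-1 * (e / (e ^+ 2 + s ^+ 2))).
  move=> s; apply: cvgMr; apply: cvgMr; apply: cvgV.
    by rewrite lt0r_neq0// ltr_wpDr ?sqr_ge0// exprn_gt0.
  by apply: cvgD; [exact: cvg_cst|exact: (cvgM cvg_id cvg_id)].
have mk : measurable_fun setT (fun xy : T * T => pi^-1 * (e / (e ^+ 2 + (xy.1 - xy.2) ^+ 2))).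
  apply: (measurableT_comp (continuous_measurable_fun cg)).
  exact: measurable_funB.
have mf : measurable_fun setT f.
  apply/measurable_EFinP; apply: measurable_funM => //.
  by apply: (measurableT_comp (measurable_indic mpq)).
have := @fubini_tonelli _ _ T T R mu nu f mf f0.
have -> : (fun x => (\int[nu]_y f (x, y))%E) =
    (fun x => (\1_(`[p, q]%classic : set T) x * smoothed e x)%:E).
  apply/funext => x; rewrite smoothedE//.
  have ik : nu.-integrable setT (EFin \o (fun y => e / (e ^+ 2 + (x - y) ^+ 2))).
    apply: le_integrable (int_cst (e^-1)) => //.
      apply/measurable_EFinP.
      have cg' : continuous (fun y : R => e / (e ^+ 2 + (x - y) ^+ 2)).
        move=> s; apply: cvgMr; apply: cvgV.
          by rewrite lt0r_neq0// ltr_wpDr ?sqr_ge0// exprn_gt0.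
        apply: cvgD; first exact: cvg_cst.
        have h : x - t @[t --> s] --> x - s by apply: cvgB; [exact: cvg_cst|exact: cvg_id].
        exact: (cvgM h h).
      exact: continuous_measurable_fun.
    move=> y _; rewrite /= lee_fin !ger0_norm ?invr_ge0 ?(ltW e0) ?poisson_ge0//.
    rewrite ler_pdivrMr ?ltr_wpDr ?sqr_ge0 ?exprn_gt0//.
    rewrite mulrDr expr2 mulKf ?lt0r_neq0// lerDl mulr_ge0 ?sqr_ge0 ?invr_ge0 ?(ltW e0)//.
  transitivity (\int[nu]_y ((\1_(`[p, q]%classic : set T) x * pi^-1)%:E *
      (e / (e ^+ 2 + (x - y) ^+ 2))%:E))%E.
    by apply: eq_integral => y _; rewrite /f /= -EFinM mulrA.
  rewrite integralZl// [in RHS]mulrA [RHS]EFinM; congr (_ * _)%E.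
  by rewrite /Rintegral fineK//; exact: (integrable_fin_num _ ik).
have -> : (fun y => (\int[mu]_x f (x, y))%E) = (fun y => (J e p q y)%:E).
  apply/funext => y.
  transitivity (\int[mu]_(x in `[p, q]) (pi^-1%:E * (e / (e ^+ 2 + (x - y) ^+ 2))%:E))%E.
    rewrite [RHS]integral_mkcond; apply: eq_integral => x _.
    rewrite patchE /f /= indicE; case: ifP => _ /=; by rewrite ?mul1r ?mul0r.
  rewrite ge0_integralZl//; last 3 first.
  - apply/measurable_EFinP; apply: measurable_funTS.
    have cg' : continuous (fun x : R => e / (e ^+ 2 + (x - y) ^+ 2)).
      move=> s; apply: cvgMr; apply: cvgV.
        by rewrite lt0r_neq0// ltr_wpDr ?sqr_ge0// exprn_gt0.
      apply: cvgD; first exact: cvg_cst.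
      have h : t - y @[t --> s] --> s - y by apply: cvgB; [exact: cvg_id|exact: cvg_cst].
      exact: (cvgM h h).
    exact: continuous_measurable_fun.
  - by move=> x _; rewrite lee_fin poisson_ge0.
  - by rewrite lee_fin invr_ge0 ltW.
  by rewrite integral_poisson_kernel.
move=> /(congr1 fine) H; rewrite -[RHS]H [LHS]Rintegral_mkcond; congr fine.
apply: eq_integral => x _; congr EFin.
rewrite patchE /= indicE; case: ifP => _ /=; by rewrite ?mul1r ?mul0r.
Qed.

(* the limit of atan (s / e) as e tends to 0 from the right *)
Let K (s : R) : R := if 0 < s then pi / 2 else if s < 0 then - (pi / 2) else 0.

Let atan_cvg (s : R) : atan (s / en n) @[n --> \oo] --> K s.
Proof.
have pos (r : R) : 0 < r -> atan (r / en n) @[n --> \oo] --> pi / 2.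
  move=> r0.
  suff h : r / en n @[n --> \oo] --> +oo by exact: (cvg_comp _ _ h (@cvgy_atan R)).
  apply/cvgryPge => A; near=> n; rewrite /en invrK mulrC -ler_pdivrMr//.
  apply: (@le_trans _ _ n%:R); first by near: n; exact: nbhs_infty_ger.
  by rewrite ler_nat.
rewrite /K; have [s0|s0|<-] := ltgtP 0 s; first exact: pos.
- rewrite (_ : (fun n => _) = (fun n => - atan (- s / en n))).
    by apply: cvgN; apply: pos; rewrite oppr_gt0.
  by apply/funext => n; rewrite -atanN mulNr opprK.
- under eq_fun do rewrite mul0r atan0.
  exact: cvg_cst.
Unshelve. all: by end_near. Qed.

(* the indicator of [p, q] with the weight 1/2 at the two ends *)
Let Jl (p q y : R) := pi^-1 * (K (q - y) - K (p - y)).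

Let J_le1 e p q y : `|J e p q y| <= 1.
Proof.
rewrite /J normrM ger0_norm ?invr_ge0 ?(ltW pi0)// ler_pdivrMl// mulr1.
have h1 := atan_gtNpi2 ((q - y) / e); have h2 := atan_ltpi2 ((q - y) / e).
have h3 := atan_gtNpi2 ((p - y) / e); have h4 := atan_ltpi2 ((p - y) / e).
by rewrite ler_norml; apply/andP; split; lra.
Qed.

Let measurable_J e p q : measurable_fun setT (J e p q : T -> R).
Proof.
have h (r : R) : measurable_fun setT (fun y : T => atan ((r - y) / e)).
  apply: (measurableT_comp (continuous_measurable_fun (@continuous_atan R))).
  by apply: measurable_funM => //; exact: measurable_funB.
by apply: measurable_funM => //; exact: measurable_funB.
Qed.

Let J_cvg p q (y : T) : setT y -> J (en n) p q y @[n --> \oo] --> Jl p q y.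
Proof. by move=> _; apply: cvgMr; apply: cvgB; exact: atan_cvg. Qed.

Let integrable_Jl p q : nu.-integrable setT (EFin \o (Jl p q : T -> R)).
Proof.
apply: (@dominated_integrable_R _ T R nu setT _ (fun n => J (en n) p q) _ (fun=> 1)) => //.
- by move=> y Ty; exact: J_cvg.
- exact: (int_cst 1).
Qed.

Let Ipq p q := \int[mu]_(x in `[p, q]) invdens x.

Let int_invdens p q : p < q -> mu.-integrable (`[p, q]%classic : set T) (EFin \o invdens).
Proof.
move=> pq; apply: le_integrable (int_cst_pq V pq) => //.
  by apply/measurable_EFinP; exact: measurable_funTS measurable_invdens.
by move=> x _; rewrite /= lee_fin !ger0_norm ?invdens_ge0 ?invdens_le.
Qed.

Let IpqE p q : p < q -> (Ipq p q)%:E = (\int[nu]_y (Jl p q y)%:E)%E.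
Proof.
move=> pq; rewrite -[RHS]fineK; last exact: (integrable_fin_num _ (integrable_Jl p q)).
congr EFin.
have H1 : \int[nu]_y J (en n) p q y @[n --> \oo] --> Ipq p q.
  rewrite (_ : (fun n => _) = (fun n => \int[mu]_(x in `[p, q]) smoothed (en n) x)).
    apply: (@Rintegral_dominated_cvg _ T R mu _ _ _ _ (fun=> V)) => //.
    + by move=> n; apply: measurable_funTS; exact: measurable_smoothed.
    + exact: int_cst_pq.
    + by move=> n x _; exact: smoothed_le.
  by apply/funext => n; rewrite integral_smoothed.
have H2 : \int[nu]_y J (en n) p q y @[n --> \oo] --> \int[nu]_y Jl p q y.
  apply: (@Rintegral_dominated_cvg _ T R nu setT _ _ _ (fun=> 1)) => //.
  + by move=> y Ty; exact: J_cvg.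
  + exact: (int_cst 1).
exact: (cvg_unique _ H1 H2).
Qed.

Let Jl_bounds p q y : p < q ->
  [/\ (\1_(`]p, q[%classic : set T) y <= Jl p q y)%R,
      (Jl p q y <= \1_(`[p, q]%classic : set T) y)%R &
      (2^-1 * \1_[set p] y <= Jl p q y)%R].
Proof.
move=> pq; have pn0 := lt0r_neq0 pi0.
have piK2 : pi^-1 * (pi / 2) = 2^-1 :> R by rewrite mulKf.
have piK : pi^-1 * (pi / 2 - - (pi / 2)) = 1 :> R by rewrite opprK mulrDr piK2; lra.
have Eo : (y \in (`]p, q[%classic : set T)) = (p < y) && (y < q).
  by apply/idP/idP; rewrite inE/= in_itv.
have Ec : (y \in (`[p, q]%classic : set T)) = (p <= y) && (y <= q).
  by apply/idP/idP; rewrite inE/= in_itv.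
have Ep : (y \in [set p]) = (y == p).
  by apply/idP/eqP => [|->]; rewrite inE.
rewrite !indicE Eo Ec Ep /Jl /K !subr_gt0 !subr_lt0.
have [yq|yq|yq] := ltgtP y q; have [yp|yp|yp] := ltgtP y p => //=;
 rewrite ?(subr0, sub0r, subrr, mulr0, opprK, piK, piK2, mulr1); split; lra.
Qed.

Let Ipq_le p q : p < q -> Ipq p q <= V * (q - p).
Proof.
move=> pq; apply: (@le_trans _ _ (\int[mu]_(x in `[p, q]) V)).
  apply: le_Rintegral => //; [exact: int_invdens|exact: int_cst_pq].
rewrite Rintegral_cst//.
by rewrite [X in _ * fine X](pq_measure pq).
Qed.

Let indic_le_Jl p q (A : set T) (k : R) : measurable A -> p < q -> 0 <= k ->
  (forall y, k * \1_A y <= Jl p q y) -> (k%:E * nu A <= (Ipq p q)%:E)%E.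
Proof.
move=> mA pq k0 H; rewrite IpqE//.
have -> : (k%:E * nu A = \int[nu]_y (k * \1_A y)%:E)%E.
  under eq_integral do rewrite EFinM.
  rewrite ge0_integralZl//; last exact/measurable_EFinP/measurable_indic.
  by rewrite integral_indic// setIT.
apply: ge0_le_integral => //.
- by move=> y _; rewrite lee_fin mulr_ge0.
- by apply/measurable_EFinP; apply: measurable_funM => //; exact: measurable_indic.
- exact: measurable_int (integrable_Jl p q).
- by move=> y _; rewrite lee_fin.
Qed.

(* Half the mass of an atom at p is at most the integral of the density over
   [p, q], which is at most V (q - p) for every q > p. *)
Let no_atom p : nu [set p] = 0%E.
Proof.
apply/eqP; rewrite eq_le measure_ge0 andbT.
have fn : nu [set p] \is a fin_num by apply: fin_num_measure; exact: measurable_set1.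
rewrite -(fineK fn) lee_fin; apply/ler_addgt0Pr => e e0; rewrite add0r.
have V1 : 0 < 2 * (V + 1) by rewrite mulr_gt0// ltr_wpDl.
have pq : p < p + e / (2 * (V + 1)) by rewrite ltrDl divr_gt0.
have h : ((2^-1)%:E * nu [set p] <= (Ipq p (p + e / (2 * (V + 1))))%:E)%E.
  by apply: indic_le_Jl => // y; have [] := Jl_bounds y pq.
have := Ipq_le pq; move: h; rewrite -(fineK fn) -EFinM lee_fin addrAC subrr add0r => h1 h2.
have {h1 h2} h : 2^-1 * fine (nu [set p]) <= V * (e / (2 * (V + 1))) by exact: le_trans h2.
have h3 : V * (e / (2 * (V + 1))) <= e / 2.
  rewrite (_ : e / (2 * (V + 1)) = (e / 2) / (V + 1)); last first.
    by field; rewrite lt0r_neq0// ltr_wpDl.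
  rewrite mulrCA ler_piMr ?divr_ge0 ?(ltW e0)//.
  by rewrite ler_pdivrMr ?ltr_wpDl// mul1r lerDl.
by have := le_trans h h3; lra.
Qed.

Let nu_oc p q : p < q -> nu (`]p, q]%classic : set T) = (Ipq p q)%:E.
Proof.
move=> pq.
have mo : measurable (`]p, q[%classic : set T) by exact: measurable_itv.
have mc : measurable (`[p, q]%classic : set T) by exact: measurable_itv.
have E1 : nu (`]p, q]%classic : set T) = nu (`]p, q[%classic : set T).
  have -> : (`]p, q]%classic : set T) = `]p, q[%classic `|` [set q].
    by rewrite (setUitv1 true)// bnd_simp.
  rewrite measureU//; last first.
    by apply/seteqP; split => // x /= [h xq]; move: h; rewrite xq in_itv/= ltxx andbF.
  by rewrite [X in (_ + X)%E]no_atom adde0.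
have E2 : nu (`[p, q]%classic : set T) = nu (`]p, q]%classic : set T).
  have -> : (`[p, q]%classic : set T) = [set p] `|` `]p, q]%classic.
    by rewrite (setU1itv false)// bnd_simp ltW.
  rewrite measureU//; last first.
    by apply/seteqP; split => // x /= [->]; rewrite in_itv/= ltxx.
  by rewrite [X in (X + _)%E]no_atom add0e.
apply/eqP; rewrite eq_le; apply/andP; split.
  rewrite E1 -[leLHS]mul1e; apply: indic_le_Jl => // y.
  by rewrite mul1r; have [] := Jl_bounds y pq.
rewrite -E2 IpqE// -(setIT `[p, q]%classic) -integral_indic//.
apply: ge0_le_integral => //.
- move=> y _; rewrite lee_fin.
  by have [_ _] := Jl_bounds y pq; apply: le_trans; rewrite mulr_ge0.
- exact: measurable_int (integrable_Jl p q).
- by apply/measurable_EFinP; exact: measurable_indic.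
- by move=> y _; rewrite lee_fin; have [] := Jl_bounds y pq.
Qed.

(** Fourier inversion for a finite measure whose transform is dominated by an
    integrable function: as the width of the Poisson kernel tends to 0, the
    smoothed densities converge to [invdens] and their masses of [p, q] to the nu
    mass, the ends of the interval being harmless since nu has no atom. *)
Theorem measure_invdens (A : set T) : measurable A ->
  nu A = (\int[mu]_(x in A) (invdens x)%:E)%E.
Proof.
pose M : {measure set T -> \bar R} := mdensity mu measurable_invdens invdens_ge0.
move=> mA; rewrite -[RHS]/(M A).
apply: (@measure_unique _ R T (@ocitv R) (fun n => `](- n%:R), n%:R]%classic)) => //.
- exact: ocitvI.
- by move=> i; exists (- i%:R, i%:R).
- apply/seteqP; split => // x _; exists (Num.truncn `|x|).+1 => //=.
  have h := truncnS_gt `|x|; rewrite in_itv/=; apply/andP; split.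
    by rewrite ltrNl (le_lt_trans _ h)// -normrN ler_norm.
  by rewrite (le_trans (ler_norm _))// ltW.
- move=> B [[p q] _ <-] /=.
  have [pq|qp] := ltP p q; last by rewrite set_itv_ge ?measure0// bnd_simp -leNgt.
  rewrite nu_oc// /M /= /mdensity.
  rewrite [RHS](@integral_itv_obnd_cbnd R p (BRight q)); last first.
    exact/measurable_EFinP/measurable_funTS.
  by rewrite /Ipq /Rintegral fineK//; exact: (integrable_fin_num _ (int_invdens pq)).
- by move=> k; rewrite ltey_eq fin_num_measure.
Qed.

End density.

End poisson_kernel.

(** * Inversion of Laplace transforms *)

Section laplace_inversion.
Context {R : realType}.
Local Notation T := (measurableTypeR R).
Local Notation mu := (@lebesgue_measure R).
Local Notation Do := (`]0%R, +oo[%classic : set T).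
Local Notation Dc := (`[0%R, +oo[%classic : set T).

(** Both functions are the derivative of the same integral. *)
Lemma continuous_density_unique (f g : R -> R) :
  (forall x : R, 0 < x -> {for x, continuous f}) ->
  (forall x : R, 0 < x -> {for x, continuous g}) ->
  (forall p q : R, 0 < p -> \int[mu]_(x in `[p, q]) f x = \int[mu]_(x in `[p, q]) g x) ->
  forall x : R, 0 < x -> f x = g x.
Proof.
move=> cf cg fg x x0.
have int_c (h : R -> R) : (forall x : R, 0 < x -> {for x, continuous h}) ->
    mu.-integrable `[x / 2, x + 1] (EFin \o h).
  move=> ch; apply: continuous_compact_integrable; first exact: segment_compact.
  apply: continuous_in_subspaceT => y; rewrite inE/= in_itv/= => /andP[y1 _].
  by apply: ch; apply: lt_le_trans y1; rewrite divr_gt0.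
have x2 : x / 2 < x by rewrite ltr_pdivrMr// ltr_pMr// ltr1n.
have xx1 : x < x + 1 by rewrite ltrDl.
have [_ <-] := continuous_FTC1_closed xx1 (int_c f cf) x2 (cf x x0).
have [_ <-] := continuous_FTC1_closed xx1 (int_c g cg) x2 (cg x x0).
by congr (derive1 _ x); apply/funext => y; apply: fg; rewrite divr_gt0.
Qed.

Variable U : {measure set T -> \bar R}.
Variable w : R -> R.
Hypothesis wadm : laplace_admissible U w.

(** The inverse Laplace integral over the line Re z = a; the conjugation symmetry
    of the transform folds it onto t > 0. *)
Definition bromwich (a x : R) : R := expR (a * x) * (pi^-1 *
  \int[mu]_(t in Do) complex.Re (cexp (0 +i* (t * x)) * laplace U w (a +i* t))).

Section abscissa.
Variables (a : R) (m : R -> R).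
Hypothesis a0 : 0 < a.
Hypothesis im : mu.-integrable Do (EFin \o m).
Hypothesis hm : forall t : R, 0 < t -> cmod (laplace U w (a +i* t)) <= m t.

Let mDc : measurable Dc. Proof. exact: measurable_itv. Qed.

Let d (y : T) : R := (fun y => w y * expR (- (a * y))) \_ Dc y.

Let mwe : measurable_fun setT (fun y : T => w y * expR (- (a * y))).
Proof. by case: wadm => mw _ _; apply: measurable_funM => //; exact: measurable_expRN. Qed.

Let md : measurable_fun setT d.
Proof. exact: ((measurable_restrictT (fun y : T => w y * expR (- (a * y))) mDc).1
  (measurable_funTS mwe)). Qed.

Let d0 y : 0 <= d y.
Proof.
rewrite /d patchE; case: ifPn => //; rewrite inE/= in_itv/= andbT => y0.
by rewrite mulr_ge0 ?expR_ge0//; case: wadm => _ + _; apply.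
Qed.

Let nu0 : {measure set T -> \bar R} := mdensity U md d0.

Let nu0_fin : fin_num_fun nu0.
Proof.
apply: lty_fin_num_fun; rewrite /nu0 /= /mdensity.
have [_ _ /(_ a a0) iw] := wadm.
have iw2 := integrable_fin_num mDc iw.
rewrite (_ : \int[U]_x (d x)%:E = \int[U]_(x in Dc) (w x * expR (- (a * x)))%:E)%E.
  by rewrite ltey_eq iw2.
rewrite [RHS]integral_mkcond; apply: eq_integral => y _.
by rewrite /d !patchE; case: ifP.
Qed.

(** The finite measure exp (- a y) w (y) U(dy) on the closed half-line, whose
    Fourier transform is the Laplace transform of w U on the line Re z = a. *)
Definition tilted : set T -> \bar R := nu0.
HB.instance Definition _ := Measure.on tilted.
HB.instance Definition _ := Measure_isFinite.Build _ T R tilted nu0_fin.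
Let nu : {finite_measure set T -> \bar R} := tilted.

Let cosintE t x : cosint nu t x =
  complex.Re (cexp (0 +i* (t * x)) * laplace U w (a +i* t)).
Proof.
have a0' : 0 < complex.Re (a +i* t) by [].
rewrite /laplace -cintegralZ//; last exact: laplace_cintegrable.
rewrite /cosint /= -[LHS]/(\int[mdensity U md d0]_y cos (t * (x - y))).
have mcos := measurable_cos_shift t x.
have [_ _ /(_ a a0) iw] := wadm.
rewrite Rintegral_mdensity//; last first.
  apply: (le_integrable _ _ _ ((integrable_mkcond _ mDc).1 iw)) => //.
    by apply/measurable_EFinP; exact: measurable_funM.
  move=> y _ /=; rewrite /d !patchE; case: ifP => _ /=; last by rewrite mulr0.
  by rewrite lee_fin normrM ler_piMl// cos_norm_le1.
rewrite [RHS]Rintegral_mkcond; apply: eq_Rintegral => y _.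
rewrite /d !patchE; case: ifP => _; last by rewrite mulr0.
rewrite !(mul0r, mulr0, subr0, addr0, add0r, expR0, mul1r).
rewrite cosN sinN mulrBr cosB; ring.
Qed.

Let hcos t x : 0 < t -> `|cosint nu t x| <= m t.
Proof.
move=> t0; rewrite cosintE; apply: (le_trans (cmod_Re _)).
by rewrite cmodM cmod_cexp /= expR0 mul1r; exact: hm.
Qed.

Let bromwichE x : bromwich a x = expR (a * x) * invdens nu x.
Proof. by congr (_ * (_ * _)); apply: eq_Rintegral => t _; rewrite cosintE. Qed.

Lemma continuous_bromwich : continuous (bromwich a).
Proof.
move=> x; rewrite (_ : bromwich a = fun x => expR (a * x) * invdens nu x); last first.
  by apply/funext => y; exact: bromwichE.
apply: cvgM; last exact: (continuous_invdens im hcos).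
apply: continuous_cvg; first exact: continuous_expR.
by apply: cvgM; [exact: cvg_cst|exact: cvg_id].
Qed.

Lemma bromwich_ge0 x : 0 <= bromwich a x.
Proof. by rewrite bromwichE mulr_ge0 ?expR_ge0// (invdens_ge0 im hcos). Qed.

(** Undoing the tilt exp (- a x) in the Fourier inversion of [tilted]. The factor h
    leaves room for the division by x^N. *)
Lemma bromwich_density (A : set T) (h : T -> R) : measurable A -> A `<=` Dc ->
  measurable_fun A h -> (forall x, A x -> 0 <= h x) ->
  (\int[U]_(x in A) (h x * w x)%:E = \int[mu]_(x in A) (h x * bromwich a x)%:E)%E.
Proof.
move=> mA AD mh h0.
have mi : measurable_fun setT (invdens nu : T -> R).
  by apply: continuous_measurable_fun; exact: (continuous_invdens im hcos).
have me : measurable_fun A (fun x : T => h x * expR (a * x)).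
  apply: measurable_funM => //; apply: measurable_funTS.
  by apply: measurableT_comp => //; exact: measurable_funM.
have he0 x : A x -> (0 <= (h x * expR (a * x))%:E)%E.
  by move=> Ax; rewrite lee_fin mulr_ge0 ?expR_ge0// h0.
transitivity (\int[nu]_(x in A) (h x * expR (a * x))%:E)%E.
  transitivity (\int[mdensity U md d0]_(x in A) (h x * expR (a * x))%:E)%E => //.
  rewrite ge0_integral_mdensity//; last exact/measurable_EFinP.
  apply: eq_integral => x xA; rewrite -EFinM /d patchE mem_set; last first.
    by apply: AD; rewrite inE in xA.
  congr EFin; rewrite -mulrA; congr (_ * _).
  by rewrite mulrCA -expRD subrr expR0 mulr1.
transitivity (\int[mdensity mu mi (invdens_ge0 im hcos)]_(x in A) (h x * expR (a * x))%:E)%E.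
  by apply: eq_measure_integral => B mB _; exact: (measure_invdens im hcos).
rewrite ge0_integral_mdensity//; last exact/measurable_EFinP.
by apply: eq_integral => x _; rewrite -EFinM bromwichE mulrA.
Qed.

End abscissa.
End laplace_inversion.

(** * The potential measure of a killed subordinator *)

Section potential_measure.
Context d (Om : measurableType d) (R : realType) (P : probability Om R).
Local Notation T := (measurableTypeR R).
Local Notation mu := (@lebesgue_measure R).
Local Notation Dc := (`[0%R, +oo[%classic : set T).

Import HBNNSimple.

(** Integrals of non-negative functions are suprema over simple functions, so
    that modifying the integrand on a null set is harmless even when one of the
    two versions fails to be measurable. *)
Lemma ge0_integral_eq_off_null (N : set Om) (f g : Om -> \bar R) :
  measurable N -> P N = 0%E -> (forall x, 0 <= f x)%E -> (forall x, 0 <= g x)%E ->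
  (forall x, ~ N x -> f x = g x) -> (\int[P]_x f x = \int[P]_x g x)%E.
Proof.
move=> mN N0 f0 g0 fg.
suff le (u v : Om -> \bar R) : (forall x, 0 <= u x)%E -> (forall x, 0 <= v x)%E ->
    (forall x, ~ N x -> u x = v x) -> (\int[P]_x u x <= \int[P]_x v x)%E.
  by apply/eqP; rewrite eq_le !le// => x /fg.
move=> u0 v0 uv; rewrite ge0_integralTE// ge0_integralTE//.
apply: ge_ereal_sup => _ [h /= hu <-].
have mC : measurable (~` N) by exact: measurableC.
apply: (@le_trans _ _ (sintegral P (proj_nnsfun h mC))).
  have sE (k : {nnsfun Om >-> R}) : sintegral P k = (\int[P]_x (k x)%:E)%E.
    by rewrite integral_nnsfun// patch_setT.
  rewrite !sE le_eqVlt; apply/orP; left; apply/eqP.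
  apply: ae_eq_integral => //; [exact/measurable_EFinP|exact/measurable_EFinP|].
  exists N; split => // x /= /not_implyP[_] hx; apply: contrapT => Nx; apply: hx.
  by rewrite mindicE mem_set// mulr1.
apply: ereal_sup_ubound; exists (proj_nnsfun h mC) => // x /=.
rewrite mindicE; case: (boolP (x \in ~` N)) => [|_]; last by rewrite mulr0.
by rewrite inE => Nx; rewrite mulr1 -uv.
Qed.

Variables (Y : R -> Om -> R) (zeta : Om -> \bar R) (X : R -> Om -> option R).
Hypothesis mY : forall t, 0 <= t -> measurable_fun setT (Y t).
Hypothesis mzeta : measurable_fun setT zeta.
Hypothesis XE : forall t w, 0 <= t ->
  X t w = if (t%:E < zeta w)%E then Some (Y t w) else None.
Variable G : set Om.
Hypothesis mG : measurable G.
Hypothesis G1 : P (~` G) = 0%E.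
Hypothesis Y0 : forall w, G w -> Y 0 w = 0.
Hypothesis Ymono : forall w, G w -> forall s t, 0 <= s -> s <= t -> Y s w <= Y t w.
Hypothesis Yright : forall w, G w -> forall t, 0 <= t -> Y s w @[s --> t^'+] --> Y t w.

(** Restricting to a set G of good paths makes the position measurable as a
    function of the path and the time, without completeness of the probability
    space. *)
Definition alive : set (Om * T) := [set p | [/\ G p.1, 0 <= p.2 & (p.2%:E < zeta p.1)%E]].

Definition position (p : Om * T) : R := if p \in alive then Y p.2 p.1 else 0.

Lemma measurable_alive : measurable alive.
Proof.
have -> : alive = (G `*` Dc) `&` [set p | (p.2%:E < zeta p.1)%E].
  apply/seteqP; split => [[w t] /= [h1 h2 h3]|[w t] /= [[h1 h2] h3]].
    by split => //; split => //; rewrite in_itv/= andbT.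
  by split => //; move: h2; rewrite in_itv/= andbT.
apply: measurableI; first by apply: measurableX => //; exact: measurable_itv.
rewrite -[X in measurable X]setTI; apply: emeasurable_fun_lt => //.
- exact/measurable_EFinP.
- exact: (measurableT_comp mzeta).
Qed.

Lemma position_ge0 p : 0 <= position p.
Proof.
rewrite /position; case: ifPn => //; rewrite inE => -[Gp p0 _].
by rewrite -(Y0 Gp) Ymono.
Qed.

(** Right-continuity and monotonicity reduce an event at the moving time t to
    countably many fixed rational times: Y t < x iff Y q < x for some q > t. *)
Lemma measurable_position : measurable_fun setT position.
Proof.
have key x : measurable (alive `&` [set p | Y p.2 p.1 < x]).
  pose F (q : rat) : set (Om * T) :=
    if 0 <= (ratr q : R) then [set w | Y (ratr q) w < x] `*` `]-oo, (ratr q : R)[%classic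
    else set0.
  have -> : alive `&` [set p | Y p.2 p.1 < x] = alive `&` \bigcup_q F q.
    apply/seteqP; split => [[w t] /= [al Yx]|[w t] /= [al [q _ Fq]]]; split => //.
      have [Gw t0 tz] := al.
      have := Yright Gw t0 => /cvgrPdist_lt /(_ (x - Y t w)).
      rewrite subr_gt0 => /(_ Yx) [e /= e0 He].
      have /rat_in_itvoo[q] : t < t + e by rewrite ltrDl.
      rewrite in_itv/= => /andP[tq qe].
      have q0 : 0 <= (ratr q : R) by rewrite (le_trans t0)// ltW.
      exists q => //; rewrite /F q0; split => /=; last by rewrite in_itv.
      have := He (ratr q); rewrite /= ltr0_norm ?subr_lt0// => /(_ _ tq).
      rewrite opprB ltrBlDl => /(_ qe).
      rewrite ler0_norm ?subr_le0 ?Ymono ?(ltW tq)//; lra.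
    move: Fq; rewrite /F; case: ifPn => // q0 [/= Yq]; rewrite in_itv/= => tq.
    have [Gw t0 tz] := al.
    by apply: le_lt_trans Yq; rewrite Ymono// ltW.
  apply: measurableI; first exact: measurable_alive.
  apply: bigcupT_measurable_rat => q; rewrite /F; case: ifPn => // q0.
  apply: measurableX; last exact: measurable_itv.
  rewrite -[X in measurable X]setTI.
  have -> : [set w | Y (ratr q) w < x] = Y (ratr q) @^-1` `]-oo, x[%classic.
    by apply/seteqP; split => w /=; rewrite in_itv.
  by apply: mY => //; exact: measurable_itv.
apply: (measurability _ (RGenInftyO.measurableE R)) => //.
move=> _ [_ [x ->] <-]; rewrite setTI.
have -> : position @^-1` `]-oo, x[%classic =
    (alive `&` [set p | Y p.2 p.1 < x]) `|` (~` alive `&` [set p | 0 < x]).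
  apply/seteqP; split => p /=; rewrite in_itv/= /position.
    by case: ifPn; rewrite ?inE ?notin_setE => h1 h2; [left|right].
  by move=> [[h1 h2]|[h1 h2]]; [rewrite mem_set|rewrite memNset].
apply: measurableU; first exact: key.
apply: measurableI; first by apply: measurableC; exact: measurable_alive.
have [x0|x0] := ltP 0 x.
  by rewrite (_ : [set p | _] = setT)//; apply/seteqP; split.
by rewrite (_ : [set p | _] = set0)//; apply/seteqP; split.
Qed.

Let PL : {measure set (Om * T) -> \bar R} := (P \x mu)%E.

Let dens (p : Om * T) : R := \1_alive p.

Let mdens : measurable_fun setT dens.
Proof. exact: measurable_indic measurable_alive. Qed.

Let dens0 p : 0 <= dens p. Proof. by []. Qed.

Let occ : {measure set (Om * T) -> \bar R} := mdensity PL mdens dens0.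

Let mpos : measurable_fun setT (position : Om * T -> T).
Proof. exact: measurable_position. Qed.

(** The image of P x dt, restricted to [alive], under the position; the default
    position 0 of dead pairs carries no mass. *)
Definition occupation : {measure set T -> \bar R} :=
  @measure_function_pushforward__canonical__measure_function_Measure
    _ _ _ T _ occ position mpos.

Let posDc : position @^-1` Dc = setT.
Proof. by apply/seteqP; split => // p _ /=; rewrite in_itv/= andbT position_ge0. Qed.

Let mDc : measurable Dc. Proof. exact: measurable_itv. Qed.

Let mcp (c : T -> R) : measurable_fun setT c -> measurable_fun setT (c \o position).
Proof. by move=> mc; exact: (measurableT_comp mc mpos). Qed.

Let ge0_integral_occ (c : T -> R) : measurable_fun setT c ->
  (forall x, 0 <= x -> 0 <= c x) ->
  (\int[occupation]_(x in Dc) (c x)%:E =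
   \int[P \x mu]_p (c (position p) * dens p)%:E)%E.
Proof.
move=> mc c0; rewrite /occupation ge0_integral_pushforward//; last 2 first.
- by apply/measurable_EFinP; exact: measurable_funTS mc.
- by move=> x; rewrite inE/= in_itv/= andbT => x0; rewrite lee_fin c0.
rewrite posDc /occ.
transitivity (\int[mdensity PL mdens dens0]_p (c (position p))%:E)%E => //.
rewrite ge0_integral_mdensity//; last 2 first.
- by apply/measurable_EFinP; exact: mcp.
- by move=> p _; rewrite lee_fin c0// position_ge0.
Qed.

Let fubini_GE (c : T -> R) :
  (\int[mu]_t fubini_G P (fun p => (c (position p) * dens p)%:E) t =
   \int[mu]_(t in Dc) \int[P]_w (c (position (w, t)) * \1_alive (w, t))%:E)%E.
Proof.
rewrite [RHS]integral_mkcond; apply: eq_integral => t _; rewrite /fubini_G patchE.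
case: ifPn => //; rewrite notin_setE/= in_itv/= andbT => t0.
apply: integral0_eq => w _; rewrite /dens indicE memNset ?mulr0//.
by rewrite /alive /= => -[_ h _]; exact: t0.
Qed.

Lemma ge0_integral_occupation (c : T -> R) : measurable_fun setT c ->
  (forall x, 0 <= x -> 0 <= c x) ->
  (\int[occupation]_(x in Dc) (c x)%:E =
   \int[mu]_(t in Dc) \int[P]_w (c (position (w, t)) * \1_alive (w, t))%:E)%E.
Proof.
move=> mc c0; rewrite ge0_integral_occ// fubini_tonelli2 ?fubini_GE//.
- by apply/measurable_EFinP; apply: measurable_funM => //; exact: mcp.
- by move=> p; rewrite lee_fin mulr_ge0// c0// position_ge0.
Qed.

Lemma Rintegral_occupation (c : T -> R) : measurable_fun setT c ->
  occupation.-integrable Dc (EFin \o c) ->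
  \int[occupation]_(x in Dc) c x =
  fine (\int[mu]_(t in Dc) \int[P]_w (c (position (w, t)) * \1_alive (w, t))%:E)%E.
Proof.
move=> mc ic.
pose f (p : Om * T) : R := c (position p) * dens p.
have mf : measurable_fun setT f by apply: measurable_funM => //; exact: mcp.
have if_ : (P \x mu)%E.-integrable setT (EFin \o f).
  apply/integrableP; split; first exact/measurable_EFinP.
  have /integrableP[_] := ic; apply: le_lt_trans; rewrite le_eqVlt; apply/orP; left.
  rewrite eq_sym (ge0_integral_occ (c := Num.norm \o c)) => [|  |x _] /=; last 2 first.
  - exact: (measurableT_comp _ mc).
  - exact: normr_ge0.
  by apply/eqP/eq_integral => p _; rewrite /f normrM (ger0_norm (dens0 p)).
have iocc : occ.-integrable setT (EFin \o (c \o position)).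
  by apply: integrable_mdensity => //; exact: mcp.
rewrite /Rintegral /occupation integral_pushforward//; last 2 first.
- exact/measurable_EFinP.
- by rewrite posDc.
rewrite posDc.
transitivity (\int[mdensity PL mdens dens0]_p (c (position p))) => //.
rewrite Rintegral_mdensity//; last exact: mcp.
rewrite /Rintegral -(@integral21_prod_meas1 _ _ _ _ _ P mu _ if_) fubini_GE //.
Qed.

(** The section of the alive pairs at a good path w is the set of times at which
    X visits A, so that the two sides are one iterated integral. *)
Lemma potentialE (A : set R) : measurable A -> potential P X A = occupation A.
Proof.
move=> mA.
have mA' : measurable (position @^-1` A) by rewrite -[X in measurable X]setTI; exact: mpos.
transitivity (\int[PL]_(p in position @^-1` A) (dens p)%:E)%E => //.
have -> : (\int[PL]_(p in position @^-1` A) (dens p)%:E = PL (alive `&` position @^-1` A))%E.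
  by rewrite integral_indic//; exact: measurable_alive.
rewrite /PL /= /product_measure1 /potential.
have ma : measurable (alive `&` position @^-1` A).
  by apply: measurableI => //; exact: measurable_alive.
apply: (@ge0_integral_eq_off_null (~` G)) => //.
- exact: measurableC.
- move=> w; apply: integral_ge0 => t _; by rewrite lee_fin.
- move=> w /contrapT Gw /=.
rewrite -[xsection _ _]setIT -integral_indic//; last exact: measurable_xsection.
rewrite [LHS]integral_mkcond; apply: eq_integral => t _.
rewrite patchE !indicE mem_xsection; case: ifPn => [|]; last first.
  rewrite notin_setE/= in_itv/= andbT => t0; rewrite memNset//.
  by rewrite /alive /= => -[[_ h _] _]; exact: t0.
rewrite inE/= in_itv/= andbT => t0; congr (_%:R%:E).
rewrite XE//; case: ifPn => tz.
  have al : (w, t) \in alive by rewrite inE.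
  congr nat_of_bool; apply/idP/idP; rewrite !inE.
    move=> [y Ay [yE]]; split; first by rewrite inE in al.
    by rewrite /= /position al /= -yE.
  by move=> [_ /=]; rewrite /position al /= => Ay; exists (Y t w).
rewrite memNset; last by move=> [].
by rewrite memNset// => -[[_ _ /= h] _]; rewrite h in tz.
Qed.

(** Off a null set of paths the two descriptions of the killed process agree at
    each time; expectations of bounded functions of X t are thus integrals over
    the section of the alive set at height t. *)
Lemma integral_alive (e : option R -> R) (t : R) : 0 <= t -> e None = 0 ->
  measurable_fun setT (e \o Some) -> (forall x, 0 <= x -> `|e (Some x)| <= 1) ->
  (\int[P]_w (e (Some (position (w, t))) * \1_alive (w, t))%:E =
   (\int[P]_w e (X t w))%:E)%E.
Proof.
move=> t0 eN me e1.
have mtz : measurable [set w | (t%:E < zeta w)%E].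
  rewrite -[X in measurable X]setTI; apply: emeasurable_fun_lt => //; exact: measurable_cst.
have mL : measurable_fun setT (fun w => e (Some (position (w, t))) * \1_alive (w, t)).
  apply: (measurableT_comp (f := fun p => e (Some (position p)) * \1_alive p)) => //.
  by apply: measurable_funM; [exact: (measurableT_comp me measurable_position)|
    exact: measurable_indic measurable_alive].
have mR : measurable_fun setT (fun w => e (X t w)).
  rewrite (_ : (fun w => _) = (fun w => e (Some (Y t w)) * \1_[set w | (t%:E < zeta w)%E] w)).
    by apply: measurable_funM; [exact: (measurableT_comp me (mY t0))|exact: measurable_indic].
  apply/funext => w; rewrite XE// indicE; case: ifPn => h; first by rewrite mem_set ?mulr1.
  by rewrite memNset ?mulr0//; exact/negP.
have E w : G w -> e (Some (position (w, t))) * \1_alive (w, t) = e (X t w).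
  move=> Gw; rewrite XE// /position indicE; case: ifPn => [|].
    by rewrite inE => -[_ _ /= ->]; rewrite mulr1.
  rewrite notin_setE mulr0; case: ifPn => // h al.
  by exfalso; apply: al; split.
have b1 w : `|e (Some (position (w, t))) * \1_alive (w, t)| <= 1.
  rewrite normrM mulr_ile1//; first by rewrite e1// position_ge0.
  by rewrite indicE; case: (_ \in _); rewrite ?normr1 ?normr0.
have iL : P.-integrable setT (EFin \o (fun w => e (Some (position (w, t))) * \1_alive (w, t))).
  have i1 : P.-integrable setT (EFin \o cst (1 : R)) by exact: finite_measure_integrable_cst.
  apply: (le_integrable measurableT _ _ i1) => //.
    exact/measurable_EFinP.
  by move=> w _ /=; rewrite lee_fin normr1.
transitivity (\int[P]_w (e (Some (position (w, t))) * \1_alive (w, t)))%:E.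
  by rewrite /Rintegral fineK//; exact: integrable_fin_num iL.
congr EFin; rewrite /Rintegral; congr fine; apply: ae_eq_integral => //.
- exact/measurable_EFinP.
- exact/measurable_EFinP.
- exists (~` G); split => //; first exact: measurableC.
  by move=> w /= h Gw; apply: h => _; rewrite E.
Qed.

Variable Phi : R[i] -> R[i].
Hypothesis hPhi : laplace_exponent P X Phi.
Hypothesis Phi0 : forall z, 0 < complex.Re z -> 0 < complex.Re (Phi z).

Let exp_killed_le1 (z : R[i]) (x : R) : 0 <= complex.Re z -> 0 <= x -> cmod (exp_killed z (Some x)) <= 1.
Proof.
move=> z0 x0; rewrite /exp_killed cmod_cexp !ReIm /= mulr0 subr0 -expR0 ler_expR.
by rewrite oppr_le0 mulr_ge0.
Qed.

Let mcexp (A : set T) (z : R[i]) : cmeasurable A (fun x : T => cexp (- (z * x%:C))).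
Proof.
have := @laplace_cmeasurable R A (fun=> 1) z (@measurable_cst _ _ _ _ _ _).
by congr cmeasurable; apply/funext => x; rewrite mul1r.
Qed.

Let integral_alive_Re (z : R[i]) (t : R) : 0 < complex.Re z -> 0 <= t ->
  (\int[P]_w (complex.Re (cexp (- (z * (position (w, t))%:C))) * \1_alive (w, t))%:E =
   (complex.Re (cexp (- (Phi z * t%:C))))%:E)%E.
Proof.
move=> z0 t0; rewrite -(hPhi t0 (ltW z0)) /=.
rewrite (@integral_alive (fun x => complex.Re (exp_killed z x)))//.
  by case: (mcexp setT z).
by move=> x x0; rewrite (le_trans (cmod_Re _))// exp_killed_le1// ltW.
Qed.

Let integral_alive_Im (z : R[i]) (t : R) : 0 < complex.Re z -> 0 <= t ->
  (\int[P]_w (complex.Im (cexp (- (z * (position (w, t))%:C))) * \1_alive (w, t))%:E =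
   (complex.Im (cexp (- (Phi z * t%:C))))%:E)%E.
Proof.
move=> z0 t0; rewrite -(hPhi t0 (ltW z0)) /=.
rewrite (@integral_alive (fun x => complex.Im (exp_killed z x)))//.
  by case: (mcexp setT z).
by move=> x x0; rewrite (le_trans (cmod_Im _))// exp_killed_le1// ltW.
Qed.

(** The integral of exp (- r x) against the occupation measure is the integral over
    time of exp (- Phi (r) t). *)
Lemma occupation_admissible : laplace_admissible occupation (fun=> 1).
Proof.
split=> // r r0.
pose c (x : T) : R := expR (- (r * x)).
have mc : measurable_fun setT c by exact: measurable_expRN.
rewrite (_ : (fun x => _) = EFin \o c); last by apply/funext => x; rewrite mul1r.
apply/integrableP; split; first by apply/measurable_EFinP; exact: measurable_funTS.
rewrite (_ : (fun x => _) = (EFin \o c)); last first.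
  by apply/funext => x /=; rewrite ger0_norm ?expR_ge0.
rewrite (ge0_integral_occupation mc); last by move=> x _; exact: expR_ge0.
have r0' : 0 < complex.Re (r%:C : R[i]) by [].
have p0 := Phi0 r0'.
have := integrable_expRN p0 => /integrableP[_]; apply: le_lt_trans.
pose e (t : T) : R := complex.Re (cexp (- (Phi r%:C * t%:C))).
have eE t : Dc t -> (\int[P]_w (c (position (w, t)) * \1_alive (w, t))%:E = (e t)%:E)%E.
  rewrite /= in_itv/= andbT => t0; rewrite /e -integral_alive_Re//.
  apply: eq_integral => w _; congr (_ * _)%:E.
  by rewrite /c -rmorphM -rmorphN /= cos0 mulr1.
rewrite (eq_integral (EFin \o e)); last by move=> t; rewrite inE; exact: eE.
have [me _] := mcexp Dc (Phi r%:C).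
apply: ge0_le_integral => //.
- move=> t Dt; rewrite /= -eE//; apply: integral_ge0 => w _.
  by rewrite lee_fin mulr_ge0 ?expR_ge0.
- exact/measurable_EFinP.
- apply: measurableT_comp => //; apply/measurable_EFinP.
  by apply: measurable_funTS; exact: measurable_expRN.
- move=> t _ /=; rewrite lee_fin (ger0_norm (expR_ge0 _)).
  rewrite (le_trans (ler_norm _))// (le_trans (cmod_Re _))// cmod_cexp !ReIm /=.
  by rewrite mulr0 subr0.
Qed.

(** By Fubini the transform of the occupation measure at z is the integral of
    exp (- Phi (z) t) over t > 0, that is the transform at Phi (z) of the constant
    1 = x^(1 - 1). *)
Lemma laplace_occupation z : 0 < complex.Re z -> laplace occupation (fun=> 1) z = (Phi z)^-1.
Proof.
move=> z0; have p0 := Phi0 z0.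
have [iR iI] := laplace_cintegrable occupation_admissible z0.
have [mR mI] := @laplace_cmeasurable R setT (fun=> 1) z (@measurable_cst _ _ _ _ _ _).
rewrite -[in RHS](cpow1 p0) -cpowN -[RHS]mul1r -[X in X%:C * _](@Gamma1 R).
rewrite -(laplace_powR ltr01 p0) /laplace /cintegral.
rewrite (Rintegral_occupation mR iR) (Rintegral_occupation mI iI).
congr (_ +i* _); congr fine; apply: eq_integral => t; rewrite inE => Dt;
  have t0 : 0 <= t by move: Dt; rewrite /= in_itv/= andbT.
- rewrite subrr powRr0 mul1r -integral_alive_Re//.
  by apply: eq_integral => w _; rewrite mul1r.
- rewrite subrr powRr0 mul1r -integral_alive_Im//.
  by apply: eq_integral => w _; rewrite mul1r.
Qed.

End potential_measure.

(** The real part of 1 - exp (- z x) is at least 1 - exp (- x Re z), which is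
    positive for x > 0; its integral vanishes only if (0, +oo) is a null set of
    the Levy measure. *)
Lemma laplace_exponent_Re_gt0 (R : realType) (Phi : R[i] -> R[i]) (a b : R)
    (Pi : {measure set (measurableTypeR R) -> \bar R}) z :
  levy_khintchine Phi a b Pi ->
  [\/ 0 < a, 0 < b | (0 < Pi [set x : R | (0 < x)%R])%E] ->
  0 < complex.Re z -> 0 < complex.Re (Phi z).
Proof.
move=> [a0 b0 _ Pi1 PhiE] nz z0.
pose D : set (measurableTypeR R) := `]0%R, +oo[%classic.
have mD : measurable D by exact: measurable_itv.
have DP (x : R) : D x -> 0 < x by rewrite /D /= in_itv/= andbT.
pose f (x : R) := 1 - expR (- (complex.Re z * x)) * cos (complex.Im z * x).
have PhiRe : complex.Re (Phi z) = a + b * complex.Re z + \int[Pi]_(x in D) f x.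
  rewrite PhiE ?(ltW z0)// !ReIm /= mul0r subr0; congr (_ + _).
  apply: eq_Rintegral => x _.
  by rewrite !ReIm /= !(mulr0, mul0r, subr0, addr0, add0r) cosN.
have fpos x : 0 < x -> 0 < f x.
  move=> x0; rewrite subr_gt0.
  have h : expR (- (complex.Re z * x)) < 1 by rewrite expR_lt1 oppr_lt0 mulr_gt0.
  by apply: le_lt_trans h; rewrite ler_piMr ?expR_ge0// cos_le1.
have mf : measurable_fun D f.
  have [mR _] := @laplace_cmeasurable R D (fun=> 1) z (@measurable_cst _ _ _ _ _ _).
  apply: measurable_funB; first exact: measurable_cst.
  move: mR; congr measurable_fun; apply/funext => x.
  by rewrite !ReIm /= !ReIm /= !(mulr0, mul0r, subr0, addr0, add0r, mul1r) cosN.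
have if_ : Pi.-integrable D (EFin \o f).
  pose K := 2 + complex.Re z + `|complex.Im z|.
  have i1 : Pi.-integrable D (EFin \o (Num.min 1 : R -> R)).
    apply/integrableP; split.
      apply/measurable_EFinP; apply: measurable_funTS.
      by apply: measurable_minr; [exact: measurable_cst|exact: measurable_id].
    apply: le_lt_trans Pi1; rewrite le_eqVlt; apply/orP; left; apply/eqP.
    apply: eq_integral => x; rewrite inE => /DP x0.
    by rewrite /= ger0_norm// le_min ler01 ltW.
  have iK := integrableZl mD K i1.
  apply: (le_integrable mD _ _ iK); first exact/measurable_EFinP.
  move=> x /DP x0; rewrite lee_fin.
  have m0 : 0 <= Num.min 1 x by rewrite le_min ler01 ltW.
  have K0 : 0 <= K by rewrite !addr_ge0 ?(ltW z0).
  rewrite (ger0_norm (ltW (fpos x x0))) ger0_norm ?mulr_ge0//.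
  have e0 := expR_ge0 (- (complex.Re z * x)).
  have e1 : expR (- (complex.Re z * x)) <= 1 by rewrite expR_le1 oppr_le0 mulr_ge0 ?ltW.
  have [x1|x1] := leP 1 x.
    rewrite mulr1; apply: (@le_trans _ _ 2); last by rewrite /K -addrA lerDl addr_ge0 // ltW.
    have : - (expR (- (complex.Re z * x)) * cos (complex.Im z * x)) <= 1.
      by rewrite -mulrN (le_trans _ e1)// ler_piMr// lerNl cos_geN1.
    rewrite /f; lra.
  have [/ler_normlP[+ _] _] := cos_sub1_le_norm (complex.Im z * x).
  rewrite opprB normrM (gtr0_norm x0) => c1.
  have c2 : expR (- (complex.Re z * x)) * (1 - cos (complex.Im z * x)) <= `|complex.Im z| * x.
    apply: le_trans c1; rewrite ler_piMl// subr_ge0; exact: cos_le1.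
  have e2 := expR_ge1Dx (- (complex.Re z * x)).
  have := ltW x0; rewrite /f /K; nra.
have I0 : 0 <= \int[Pi]_(x in D) f x.
  by apply: Rintegral_ge0 => x /DP /fpos; exact: ltW.
have bz0 : 0 <= b * complex.Re z by rewrite mulr_ge0 // ltW.
rewrite PhiRe; case: nz => [a1|b1|P0].
- lra.
- have : 0 < b * complex.Re z by rewrite mulr_gt0.
  lra.
suff : 0 < \int[Pi]_(x in D) f x by lra.
rewrite lt_neqAle I0 andbT; apply/eqP => If0.
have fI : (\int[Pi]_(x in D) `|(f x)%:E|)%E = 0%E.
  transitivity (\int[Pi]_(x in D) f x)%:E; last by rewrite -If0.
  rewrite /Rintegral fineK; last exact: integrable_fin_num if_.
  apply: eq_integral => x; rewrite inE => /DP /fpos /ltW x0.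
  by rewrite abse_EFin ger0_norm.
have mf' : measurable_fun D (EFin \o f) by exact/measurable_EFinP.
have [N [mN N0 DN]] := (ae_eq_integral_abs Pi mD mf').1 fI.
suff PiD : (Pi D <= Pi N)%E.
  have DE : [set x : R | (0 < x)%R] = D.
    by apply/seteqP; split => x; rewrite /D /= in_itv/= andbT.
  by move: P0; rewrite DE => /lt_le_trans /(_ PiD); rewrite N0 ltxx.
apply: le_measure; rewrite ?inE// => x Dx; apply: DN => /(_ Dx) [].
apply/eqP; rewrite gt_eqF// fpos//; exact: DP.
Qed.

Section killed_subordinators.
Context d (Om : measurableType d) (R : realType) (P : probability Om R).
Local Notation mu := (@lebesgue_measure R).

(** The path properties that hold almost surely are gathered in one measurable set
    of full probability, on which the occupation measure is built. *)
Lemma potential_laplace (X : R -> Om -> option R) (Phi : R[i] -> R[i]) :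
  killed_subordinator P X -> laplace_exponent P X Phi ->
  (forall z, 0 < complex.Re z -> 0 < complex.Re (Phi z)) ->
  exists U : {measure set (measurableTypeR R) -> \bar R},
    [/\ forall A : set R, measurable A -> potential P X A = U A,
        laplace_admissible U (fun=> 1) &
        forall z, 0 < complex.Re z -> (Phi z)^-1 = laplace U (fun=> 1) z].
Proof.
move=> [Y [zeta [q [[[mY Y0 _ _ Yr] Ym] _ [mzeta _ _] _ XE]]]] hPhi Phi0.
have [G [mG G1 GP]] : exists G, [/\ measurable G, P (~` G) = 0%E &
    forall w, G w -> [/\ Y 0 w = 0, cadlag (Y ^~ w) &
      forall s t, 0 <= s -> s <= t -> Y s w <= Y t w]].
  have [N1 [mN1 N10 h1]] := Y0; have [N2 [mN2 N20 h2]] := Yr; have [N3 [mN3 N30 h3]] := Ym.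
  exists (~` (N1 `|` N2 `|` N3)); split.
  - by apply: measurableC; apply: measurableU => //; exact: measurableU.
  - by rewrite setCK !measureU0 //; exact: measurableU.
  - move=> w /not_orP[/not_orP[n1 n2] n3]; split; apply: contrapT => h.
    + by apply: n1; exact: h1.
    + by apply: n2; exact: h2.
    + by apply: n3; exact: h3.
have g1 w : G w -> Y 0 w = 0 by move=> /GP[].
have g2 w : G w -> forall s t, 0 <= s -> s <= t -> Y s w <= Y t w by move=> /GP[].
have g3 w : G w -> forall t, 0 <= t -> Y s w @[s --> t^'+] --> Y t w.
  by move=> /GP[_ [+ _] _].
exists (occupation P mY mzeta mG g2 g3); split.
- by move=> A mA; exact: potentialE.
- exact: occupation_admissible hPhi Phi0.
- by move=> z z0; rewrite (@laplace_occupation _ _ _ _ _ _ _ mY mzeta XE _ mG G1 g1 g2 g3 _ hPhi Phi0).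
Qed.

End killed_subordinators.

(** * Transforms on vertical lines *)

Section vertical_lines.
Context {R : realType}.
Local Notation T := (measurableTypeR R).
Local Notation mu := (@lebesgue_measure R).
Local Notation Do := (`]0%R, +oo[%classic : set T).

Let mDo : measurable Do. Proof. exact: measurable_itv. Qed.

Lemma cmeasurable_line (f : R[i] -> R[i]) (a : R) : 0 < a ->
  (forall z, 0 < complex.Re z -> exists l, cdiff f z l) ->
  cmeasurable setT (fun t : T => f (a +i* t)).
Proof.
move=> a0 df.
have E (t : R) : a +i* t = a%:C + t%:C * (0 +i* 1).
  by apply: complex_ext => /=; ring.
have dl (t : R) : exists l, cdiff f (a%:C + t%:C * (0 +i* 1)) l.
  by rewrite -E; exact: df.
split; apply: continuous_measurable_fun => t; have [l /cdiff_is_derive_line[h1 h2]] := dl t.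
- rewrite (_ : (fun t => _) = (fun s : R => complex.Re (f (a%:C + s%:C * (0 +i* 1))))).
    exact: derivable_continuous_at h1.
  by apply/funext => s; rewrite -E.
- rewrite (_ : (fun t => _) = (fun s : R => complex.Im (f (a%:C + s%:C * (0 +i* 1))))).
    exact: derivable_continuous_at h2.
  by apply/funext => s; rewrite -E.
Qed.

Lemma integrable_powR_shift (s : R) : 1 < s ->
  mu.-integrable Do (EFin \o (fun t : R => (1 + t) `^ (- s))).
Proof.
move=> s1; have p0 : 0 < s - 1 by rewrite subr_gt0.
have dpow (b t : R) : -1 < t ->
    is_derive t (1 : R) (fun t : R => (1 + t) `^ b) (b * (1 + t) `^ (b - 1)).
  move=> t0; have t1 : 0 < 1 + t by lra.
  have d1 : is_derive t (1 : R) (fun t : R => 1 + t) 1.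
    by have := @is_deriveD _ _ _ (cst (1 : R)) id t 1 _ _ (is_derive_cst _ _ _)
      (is_derive_id _ _); rewrite add0r.
  have d0 := is_derive1_powR b t1.
  have := @is_derive1_comp R (fun t : R => t `^ b) (fun t : R => 1 + t) t _ _ d0 d1.
  by rewrite mulr1.
pose F (t : R) : R := - (s - 1)^-1 * (1 + t) `^ (1 - s).
have dF (t : R) : -1 < t -> is_derive t (1 : R) F ((1 + t) `^ (- s)).
  move=> t0; have d1 := dpow (1 - s) t t0.
  rewrite /F; apply: is_derive_eq; rewrite /GRing.scale /=.
  have -> : 1 - s - 1 = - s by ring.
  by field; exact: lt0r_neq0.
have gtN (t : R) : 0 < t -> -1 < t by move=> t0; lra.
have F0 : F t @[t --> 0^'+] --> F 0.
  apply: cvg_at_right_filter; apply: derivable_continuous_at (dF 0 _); lra.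
have Fy : F t @[t --> +oo] --> (0 : R).
  rewrite -(mulr0 (- (s - 1)^-1)); apply: cvgMr.
  apply/cvgr0Pnorm_le => e e0.
  have /cvgryPge /(_ e^-1) := powR_cvgy p0; apply: filterS2 (nbhs_pinfty_ge (num_real 0)) => t t0 te.
  rewrite ger0_norm ?powR_ge0// -opprB powRN invf_ple ?posrE ?powR_gt0 ?ltr_wpDr//.
  by apply: (le_trans te); rewrite ge0_ler_powR ?nnegrE ?(ltW p0) ?lerDr ?addr_ge0.
have cf (t : R) : 0 < t -> {for t, continuous (fun t : R => (1 + t) `^ (- s))}.
  by move=> /gtN t0; exact: derivable_continuous_at (dpow (- s) t t0).
have f0 (t : R) : 0 < t -> 0 <= (1 + t) `^ (- s) by move=> _; exact: powR_ge0.
have := ge0_FTC_halfline (fun t t0 => dF t (gtN t t0)) cf F0 Fy f0 => I.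
apply/integrableP; split; first by apply/measurable_EFinP; exact: continuous_halfline_measurable.
by under eq_integral do rewrite /= ger0_norm ?powR_ge0//; rewrite I ltry.
Qed.

(** The hypothesis 1 + t <= K |z| expresses that |z| is bounded below and at least
    of the order of t, in a form that leads to an integrable majorant on the whole
    half-line. *)
Lemma powR_cmod_le (z : R[i]) (K s t : R) : 0 < K -> 0 <= s -> 0 <= t ->
  1 + t <= K * cmod z -> cmod z `^ (- s) <= K `^ s * (1 + t) `^ (- s).
Proof.
move=> K0 s0 t0 h; have t1 : 0 < 1 + t by rewrite ltr_wpDr.
have z0 : 0 < cmod z by rewrite -(pmulr_rgt0 _ K0); exact: lt_le_trans h.
rewrite !powRN ler_pdivlMr ?powR_gt0// mulrC ler_pdivrMr ?powR_gt0//.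
rewrite -powRM ?cmod_ge0 ?(ltW K0)//.
by rewrite ge0_ler_powR// nnegrE ?mulr_ge0 ?cmod_ge0// ltW.
Qed.

Variables (U : {measure set T -> \bar R}) (w : R -> R).
Hypothesis wadm : laplace_admissible U w.

Lemma cmod_laplace_le (a t : R) : 0 < a ->
  cmod (laplace U w (a +i* t)) <= \int[U]_(x in `[0%R, +oo[) (w x * expR (- (a * x))).
Proof.
move=> a0; have [mw w0 iw] := wadm.
have mDc : measurable (`[0%R, +oo[%classic : set T) by exact: measurable_itv.
apply: (le_trans (cmod_cintegral_le mDc (laplace_cintegrable wadm _))) => //.
rewrite le_eqVlt; apply/orP; left; apply/eqP.
apply: eq_Rintegral => x; rewrite inE/= in_itv/= andbT => x0.
by rewrite cmod_laplace_integrand//; apply: w0.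
Qed.

Lemma cmeasurable_laplace_line (a : R) : 0 < a ->
  cmeasurable setT (fun t : T => laplace U w (a +i* t)).
Proof.
move=> a0; apply: cmeasurable_line => // z z0.
by exists (- laplace U (fun x => x * w x) z); exact: cdiff_laplace.
Qed.

(** Below height 1 the transform is bounded by its value at the abscissa. *)
Lemma integrable_laplace_line (a : R) : 0 < a ->
  (\int[mu]_(t in `[1%R, +oo[) (cmod (laplace U w (a +i* t)))%:E < +oo)%E ->
  mu.-integrable Do (EFin \o (fun t : R => cmod (laplace U w (a +i* t)))).
Proof.
move=> a0 tail.
have mc A : measurable_fun A (fun t : T => cmod (laplace U w (a +i* t))).
  apply: measurable_funTS; apply: cmeasurable_cmod => //; exact: cmeasurable_laplace_line.
apply/integrableP; split; first exact/measurable_EFinP.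
under eq_integral do rewrite /= ger0_norm ?cmod_ge0//.
have m1 : measurable (`]0%R, 1%R[%classic : set T) by exact: measurable_itv.
have m2 : measurable (`[1%R, +oo[%classic : set T) by exact: measurable_itv.
have -> : Do = `]0%R, 1%R[%classic `|` `[1%R, +oo[%classic.
  by rewrite -itv_bndbnd_setU// bnd_simp.
have dj : [disjoint `]0%R, 1%R[%classic & `[1%R, +oo[%classic : set T].
  apply/disj_setPLR => x /=; rewrite !in_itv/= => /andP[_ x1]; rewrite andbT.
  by rewrite leNgt x1.
rewrite ge0_integral_setU//=; [|exact/measurable_EFinP|].
2: by move=> t _; rewrite lee_fin cmod_ge0.
apply: lte_add_pinfty tail.
set M := (\int[U]_(x in `[0%R, +oo[) (w x * expR (- (a * x)))).
apply: (@le_lt_trans _ _ (\int[mu]_(t in `]0%R, 1%R[) (cst M%:E t))%E).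
  apply: ge0_le_integral => //.
  - by move=> t _; rewrite lee_fin cmod_ge0.
  - exact/measurable_EFinP.
  - by move=> t _; rewrite lee_fin cmod_laplace_le.
have I1 : mu (`]0%R, 1%R[%classic : set R) = 1%:E.
  by rewrite lebesgue_measure_itv/= lte_fin ltr01 -EFinB subr0.
rewrite integral_cst// [X in (_ * X)%E](_ : _ = 1%E); last exact: I1.
by rewrite mule1 ltry.
Qed.

Lemma bromwich_density_segment (a p q : R) : 0 < a -> 0 < p ->
  mu.-integrable Do (EFin \o (fun t : R => cmod (laplace U w (a +i* t)))) ->
  (\int[U]_(x in `[p, q]) (w x)%:E = \int[mu]_(x in `[p, q]) (bromwich U w a x)%:E)%E.
Proof.
move=> a0 p0 im.
transitivity (\int[U]_(x in `[p, q]) (1 * w x)%:E)%E.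
  by apply: eq_integral => x _; rewrite mul1r.
rewrite (@bromwich_density _ _ _ wadm a _ a0 im (fun t _ => lexx _) _ (fun=> 1))//.
- by apply: eq_integral => x _; rewrite mul1r.
- by move=> x /=; rewrite !in_itv/= andbT => /andP[+ _]; apply/le_trans/ltW.
Qed.

Lemma bromwich_unique (a : R) (g : R -> R) : 0 < a ->
  mu.-integrable Do (EFin \o (fun t : R => cmod (laplace U w (a +i* t)))) ->
  (forall x : R, 0 < x -> {for x, continuous g}) ->
  (forall p q : R, 0 < p ->
     (\int[U]_(x in `[p, q]) (w x)%:E = \int[mu]_(x in `[p, q]) (g x)%:E)%E) ->
  forall x : R, 0 < x -> bromwich U w a x = g x.
Proof.
move=> a0 im cg wg; apply: continuous_density_unique => // [x _|p q p0].
  exact: (continuous_bromwich wadm a0 im (fun t _ => lexx _)).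
by rewrite /Rintegral -wg// -bromwich_density_segment.
Qed.

(** The abscissa is a free parameter of the inversion formula; the estimate of
    the density at x takes advantage of it. *)
Lemma bromwich_abscissa (a b x : R) : 0 < a -> 0 < b ->
  mu.-integrable Do (EFin \o (fun t : R => cmod (laplace U w (a +i* t)))) ->
  mu.-integrable Do (EFin \o (fun t : R => cmod (laplace U w (b +i* t)))) ->
  0 < x -> bromwich U w a x = bromwich U w b x.
Proof.
move=> a0 b0 ia ib; apply: bromwich_unique => // [y _|p q p0].
  exact: (continuous_bromwich wadm b0 ib (fun t _ => lexx _)).
exact: bromwich_density_segment.
Qed.

End vertical_lines.

Section inversion_of_differences.
Context {R : realType}.
Local Notation T := (measurableTypeR R).
Local Notation mu := (@lebesgue_measure R).
Local Notation Do := (`]0%R, +oo[%classic : set T).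

Let mDo : measurable Do. Proof. exact: measurable_itv. Qed.

Lemma cmod_laplace_powR (s : R) z : 0 < s -> 0 < complex.Re z ->
  cmod (laplace mu (fun x => x `^ (s - 1)) z) = Gamma s * cmod z `^ (- s).
Proof.
move=> s0 z0; rewrite laplace_powR// cmodM cmod_real cmod_cpow//.
by rewrite ger0_norm// ltW// Gamma_gt0.
Qed.

Lemma integrable_laplace_powR_line (s a : R) : 1 < s -> 0 < a ->
  mu.-integrable Do (EFin \o (fun t : R => cmod (laplace mu (fun x => x `^ (s - 1)) (a +i* t)))).
Proof.
move=> s1 a0; have s0 : 0 < s by apply: lt_trans s1.
have K0 : 0 < 1 + a^-1 by rewrite addr_gt0 ?invr_gt0.
have h := integrableZl mDo (Gamma s * (1 + a^-1) `^ s) (integrable_powR_shift s1).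
apply: (le_integrable mDo _ _ h).
  apply/measurable_EFinP; apply: measurable_funTS; apply: cmeasurable_cmod => //.
  exact: (cmeasurable_laplace_line (powR_admissible s0)).
move=> t /=; rewrite in_itv/= andbT => t0; rewrite lee_fin.
rewrite !ger0_norm ?cmod_ge0 ?mulr_ge0 ?powR_ge0 ?(ltW (Gamma_gt0 s0))//.
rewrite cmod_laplace_powR// -mulrA ler_wpM2l ?(ltW (Gamma_gt0 s0))//.
apply: powR_cmod_le => //; [exact: ltW|exact: ltW|].
have h1 := cmod_Re (a +i* t); have h2 := cmod_Im (a +i* t).
rewrite /= !gtr0_norm// in h1 h2.
have : 1 <= a^-1 * cmod (a +i* t) by rewrite ler_pdivlMl// mulr1.
lra.
Qed.

(** The function x^(s - 1) is its own continuous density. The condition s > 1 is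
    what makes its transform, of modulus Gamma (s) |z|^(- s), integrable along
    vertical lines. *)
Lemma bromwich_powR (s a x : R) : 1 < s -> 0 < a -> 0 < x ->
  bromwich mu (fun x => x `^ (s - 1)) a x = x `^ (s - 1).
Proof.
move=> s1 a0; have s0 : 0 < s by apply: lt_trans s1.
apply: (@bromwich_unique _ mu _ (powR_admissible s0) a (fun x => x `^ (s - 1)) a0
  (integrable_laplace_powR_line s1 a0)) => // y y0.
exact: derivable_continuous_at (is_derive1_powR _ y0).
Qed.

Lemma Rintegral_sum (I : Type) (r : seq I) (f : I -> T -> R) :
  (forall i, mu.-integrable Do (EFin \o f i)) ->
  \int[mu]_(t in Do) (\sum_(i <- r) f i t) = \sum_(i <- r) \int[mu]_(t in Do) f i t.
Proof.
move=> fi; apply: EFin_inj; rewrite -sumEFin.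
rewrite (eq_bigr (fun i => \int[mu]_(t in Do) (f i t)%:E)%E); last first.
  by move=> i _; rewrite /Rintegral fineK//; exact: integrable_fin_num (fi i).
rewrite -integral_sum// /Rintegral fineK; last first.
  apply: integrable_fin_num => //.
  rewrite (_ : (fun t => _) = (fun t => \sum_(i <- r) (f i t)%:E)%E).
    by apply: (integrable_sum mDo) => i _; exact: fi.
  by apply/funext => t; rewrite sumEFin.
by apply: eq_integral => t _; rewrite sumEFin.
Qed.

Variables (U : {measure set T -> \bar R}) (w : R -> R) (a : R).
Hypothesis wadm : laplace_admissible U w.
Hypothesis a0 : 0 < a.
Hypothesis im : mu.-integrable Do (EFin \o (fun t : R => cmod (laplace U w (a +i* t)))).

Let integrable_rotated (V : {measure set T -> \bar R}) (v : R -> R) (x : R) :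
  laplace_admissible V v ->
  mu.-integrable Do (EFin \o (fun t : R => cmod (laplace V v (a +i* t)))) ->
  mu.-integrable Do (EFin \o (fun t : R =>
    complex.Re (cexp (0 +i* (t * x)) * laplace V v (a +i* t)))).
Proof.
move=> vadm iv; have [mR mI] := cmeasurable_laplace_line vadm a0.
apply: (le_integrable mDo _ _ iv).
  apply/measurable_EFinP; apply: measurable_funTS.
  rewrite (_ : (fun t => _) = (fun t : R => cos (t * x) * complex.Re (laplace V v (a +i* t))
      - sin (t * x) * complex.Im (laplace V v (a +i* t)))).
    have mx : measurable_fun setT (fun t : T => t * x : T) by exact: measurable_funM.
    apply: measurable_funB; apply: measurable_funM => //.
      by apply: (measurableT_comp _ mx); apply: continuous_measurable_fun; exact: continuous_cos.
    by apply: (measurableT_comp _ mx); apply: continuous_measurable_fun; exact: continuous_sin.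
  by apply/funext => t; rewrite Re_mul /= expR0 !mul1r.
move=> t _; rewrite lee_fin (ger0_norm (cmod_ge0 _)).
by apply: (le_trans (cmod_Re _)); rewrite cmodM cmod_cexp expR0 mul1r.
Qed.

(** On a vertical line the inversion formula is linear, so that subtracting
    powers from the transform subtracts powers from the density. *)
Lemma bromwich_sub_powers (n : nat) (kappa s : 'I_n -> R) (x : R) :
  (forall k, 1 < s k) -> 0 < x ->
  let H (t : R) := laplace U w (a +i* t) -
    \sum_(k < n) (kappa k * Gamma (s k))%:C * cpow (a +i* t) (- s k)%:C in
  mu.-integrable Do (EFin \o (fun t => cmod (H t))) /\
  `|bromwich U w a x - \sum_(k < n) kappa k * x `^ (s k - 1)| <=
    expR (a * x) / pi * \int[mu]_(t in Do) cmod (H t).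
Proof.
move=> s1 x0 H.
have s0 k : 0 < s k by apply: lt_trans (s1 k).
pose L k (t : R) := laplace mu (fun x => x `^ (s k - 1)) (a +i* t).
have HE t : H t = laplace U w (a +i* t) - \sum_(k < n) (kappa k)%:C * L k t.
  rewrite /H; congr (_ - _); apply: eq_bigr => k _.
  by rewrite /L laplace_powR// rmorphM mulrA.
pose f (t : R) := complex.Re (cexp (0 +i* (t * x)) * laplace U w (a +i* t)).
pose g k (t : R) := complex.Re (cexp (0 +i* (t * x)) * L k t).
have if_ : mu.-integrable Do (EFin \o f) by exact: integrable_rotated.
have ig k : mu.-integrable Do (EFin \o g k).
  apply: integrable_rotated; first exact: powR_admissible.
  exact: integrable_laplace_powR_line.
have igk k : mu.-integrable Do (EFin \o (fun t => kappa k * g k t)).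
  by have := integrableZl mDo (kappa k) (ig k).
have isg : mu.-integrable Do (EFin \o (fun t => \sum_(k < n) kappa k * g k t)).
  rewrite (_ : EFin \o _ = (fun t => \sum_(k < n) (kappa k * g k t)%:E)%E).
    by apply: (integrable_sum mDo) => k _; exact: igk.
  by apply/funext => t; rewrite /= sumEFin.
have sumRe t : f t - \sum_(k < n) kappa k * g k t =
    complex.Re (cexp (0 +i* (t * x)) * H t).
  rewrite HE mulrBr Re_add Re_opp; congr (_ - _).
  rewrite mulr_sumr (big_morph (@complex.Re R) (@Re_add R) (id1 := 0))//.
  by apply: eq_bigr => k _; rewrite /g mulrCA [in RHS]Re_mul /= mul0r subr0.
have cline (V : {measure set T -> \bar R}) v (vadm : laplace_admissible V v)
    (iv : mu.-integrable Do (EFin \o (fun t : R => cmod (laplace V v (a +i* t))))) :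
    cintegrable mu Do (fun t : T => laplace V v (a +i* t)).
  apply: (cintegrable_le mDo _ iv) => //.
  by have [mR mI] := cmeasurable_laplace_line vadm a0; split; exact: measurable_funTS.
have cL k : cintegrable mu Do (L k).
  by apply: cline (powR_admissible (s0 k)) _; exact: integrable_laplace_powR_line.
have cH r : cintegrable mu Do (fun t : T => laplace U w (a +i* t) -
    \sum_(k <- r) (kappa k)%:C * L k t).
  elim: r => [|k r IH].
    have := cline _ _ wadm im; congr cintegrable.
    by apply/funext => t; rewrite big_nil subr0.
  have := cintegrableB mDo IH (cintegrableZ mDo (kappa k)%:C (cL k)); congr cintegrable.
  by apply/funext => t; rewrite big_cons opprD addrA addrAC.
have iH : mu.-integrable Do (EFin \o (fun t => cmod (H t))).
  have := cintegrable_cmod mDo (cH (index_enum 'I_n)); congr (mu.-integrable _ _).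
  by apply/funext => t; rewrite /= HE.
split=> //.
have -> : bromwich U w a x - \sum_(k < n) kappa k * x `^ (s k - 1) =
    expR (a * x) / pi * \int[mu]_(t in Do) (f t - \sum_(k < n) kappa k * g k t).
  rewrite RintegralB// Rintegral_sum// mulrBr; congr (_ - _); first by rewrite -mulrA.
  rewrite mulr_sumr; apply: eq_bigr => k _.
  rewrite RintegralZl// -(bromwich_powR (s1 k) a0 x0) /bromwich; ring.
rewrite normrM ger0_norm ?mulr_ge0 ?expR_ge0 ?invr_ge0 ?pi_ge0//.
rewrite ler_wpM2l ?mulr_ge0 ?expR_ge0 ?invr_ge0 ?pi_ge0//.
have ifg : mu.-integrable Do (EFin \o (fun t => f t - \sum_(k < n) kappa k * g k t)).
  by have := integrableB mDo if_ isg.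
apply: (le_trans (le_normr_Rintegral mDo ifg)).
apply: le_Rintegral => //; first by have := integrable_norm ifg.
move=> t _; rewrite sumRe; apply: (le_trans (cmod_Re _)).
by rewrite cmodM cmod_cexp expR0 mul1r.
Qed.

End inversion_of_differences.

(** * The error term *)

Section estimate.
Context {R : realType}.
Local Notation T := (measurableTypeR R).
Local Notation mu := (@lebesgue_measure R).
Local Notation Do := (`]0%R, +oo[%classic : set T).

Let mDo : measurable Do. Proof. exact: measurable_itv. Qed.

(** The three ranges of the ordinate t: below l, where |l + i t| is comparable
    to l; between l and r, where it is comparable to t; and above r, where no
    decay in l is available. *)
Lemma Rintegral_three_ranges (h rho : R -> R) (l r C M : R) :
  0 < l -> l < r -> r <= 1 -> 0 < C -> 0 <= M ->
  measurable_fun Do h -> (forall t, 0 <= h t) ->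
  measurable_fun Do rho -> (forall t, 0 < t -> 0 < rho t) ->
  mu.-integrable `[l, 1%R] (EFin \o rho) ->
  (forall t, 0 < t -> t <= l -> h t <= C * rho l) ->
  (forall t, l < t -> t < r -> h t <= C * rho t) ->
  (\int[mu]_(t in `[r, +oo[) (h t)%:E <= M%:E)%E ->
  \int[mu]_(t in Do) h t <= C * (l * rho l + \int[mu]_(t in `[l, 1%R]) rho t) + M.
Proof.
move=> l0 lr r1 C0 M0 mh h0 mrho rho0 irho h1 h2 h3.
have r0 := lt_trans l0 lr.
pose D1 := (`]0%R, l]%classic : set T).
pose D2 := (`]l, r[%classic : set T).
pose D3 := (`[r, +oo[%classic : set T).
have m1 : measurable D1 by exact: measurable_itv.
have m2 : measurable D2 by exact: measurable_itv.
have m3 : measurable D3 by exact: measurable_itv.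
have ml : measurable (`[l, 1%R]%classic : set T) by exact: measurable_itv.
have DE : Do = D1 `|` (D2 `|` D3).
  by rewrite /D2 /D3 -itv_bndbnd_setU ?bnd_simp// -itv_bndbnd_setU ?bnd_simp// ltW.
have d12 : [disjoint D1 & D2 `|` D3].
  apply/disj_setPLR => x; rewrite /D1 /D2 /D3 /= !in_itv/= => /andP[_ xl].
  by rewrite andbT => -[/andP[lx _]|rx]; move: (le_lt_trans xl lr); lra.
have d23 : [disjoint D2 & D3].
  apply/disj_setPLR => x; rewrite /D2 /D3 /= !in_itv/= => /andP[_ xl].
  by rewrite andbT; lra.
have s1 : D1 `<=` Do by rewrite DE => x; left.
have s2 : D2 `<=` Do by rewrite DE => x; right; left.
have s3 : D3 `<=` Do by rewrite DE => x; right; right.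
have mhE D : D `<=` Do -> measurable_fun D (EFin \o h).
  by move=> s; apply/measurable_EFinP; exact: measurable_funS mh.
have I1 : (\int[mu]_(t in D1) (h t)%:E <= (C * (l * rho l))%:E)%E.
  apply: (@le_trans _ _ (\int[mu]_(t in D1) (cst (C * rho l)%:E t))%E).
    apply: ge0_le_integral => //; try exact: mhE.
    - by move=> t _; rewrite lee_fin.
    - by move=> t; rewrite /D1 /= in_itv/= => /andP[t0 tl]; rewrite lee_fin h1.
  have mD1 : mu (`]0%R, l]%classic : set R) = l%:E.
    by rewrite lebesgue_measure_itv/= lte_fin l0 -EFinB subr0.
  rewrite integral_cst// [X in (_ * X)%E](_ : _ = l%:E); last exact: mD1.
  by rewrite -EFinM lee_fin -mulrA [rho l * l]mulrC.
have I2 : (\int[mu]_(t in D2) (h t)%:E <= (C * \int[mu]_(t in `[l, 1%R]) rho t)%:E)%E.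
  apply: (@le_trans _ _ (\int[mu]_(t in D2) (C * rho t)%:E)%E).
    apply: ge0_le_integral => //; try exact: mhE.
    - by move=> t _; rewrite lee_fin.
    - apply/measurable_EFinP; apply: measurable_funM => //; exact: measurable_funS mrho.
    - by move=> t; rewrite /D2 /= in_itv/= => /andP[t0 tl]; rewrite lee_fin h2.
  rewrite -RintegralZl// /Rintegral fineK; last first.
    by apply: integrable_fin_num => //; have := integrableZl ml C irho.
  apply: ge0_subset_integral => //.
  - by have /measurable_int := integrableZl ml C irho.
  - move=> t /=; rewrite in_itv/= => /andP[lt _]; rewrite lee_fin mulr_ge0 ?(ltW C0)//.
    by apply/ltW/rho0/(lt_le_trans l0).
  - by move=> t /=; rewrite !in_itv/= => /andP[a1 a2]; rewrite (ltW a1)/= ltW// (lt_le_trans a2).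
have H : (\int[mu]_(t in Do) (h t)%:E <=
    (C * (l * rho l + \int[mu]_(t in `[l, 1%R]) rho t) + M)%:E)%E.
  have hE0 (D : set T) : forall t, D t -> (0 <= (h t)%:E)%E.
    by move=> t _; rewrite lee_fin.
  have m23 : measurable (D2 `|` D3) by exact: measurableU.
  have mh23 : measurable_fun (D2 `|` D3) (EFin \o h) by apply: mhE => x [/s2|/s3].
  have mh123 : measurable_fun (D1 `|` (D2 `|` D3)) (EFin \o h) by rewrite -DE; exact: mhE.
  rewrite DE (ge0_integral_setU mu m1 m23 mh123 (hE0 _) d12).
  rewrite (ge0_integral_setU mu m2 m3 mh23 (hE0 _) d23).
  apply: (le_trans (leeD I1 (leeD I2 h3))); rewrite -!EFinD lee_fin; lra.
rewrite /Rintegral -[leRHS]/(fine (_)%:E) fine_le//.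
rewrite ge0_fin_numE; first exact: le_lt_trans H (ltry _).
by apply: integral_ge0 => t _; rewrite lee_fin.
Qed.

End estimate.

Section differences_of_transforms.
Context {R : realType}.
Local Notation T := (measurableTypeR R).
Local Notation mu := (@lebesgue_measure R).
Variables (U : {measure set T -> \bar R}) (w : R -> R).
Hypothesis wadm : laplace_admissible U w.

(** The N-th derivatives of 1 / z^alpha and of a Laplace transform carry the same
    sign (-1)^N, which can therefore be factored out. *)
Lemma cderivn_sub_powers (f : R[i] -> R[i]) m (c alpha : 'I_m -> R) N z :
  (forall s, 0 < complex.Re s -> f s = laplace U w s) -> 0 < complex.Re z ->
  cderivn N (fun s => f s - \sum_(k < m) ((c k)%:C * cpow s (alpha k)%:C)^-1) z =
  (-1) ^+ N * (laplace U (fun x => x ^+ N * w x) z -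
    \sum_(k < m) ((\prod_(i < N) (alpha k + i%:R)) / c k)%:C *
                 cpow z (- (alpha k + N%:R))%:C).
Proof.
move=> fE z0.
pose F j z := (-1) ^+ j * (laplace U (fun x => x ^+ j * w x) z -
    \sum_(k < m) ((\prod_(i < j) (alpha k + i%:R)) / c k)%:C *
                 cpow z (- (alpha k + j%:R))%:C).
apply: (cderivn_halfplane (F := F)) => //.
  move=> s s0; rewrite /F mul1r fE//; congr (_ - _).
    by congr laplace; apply/funext => x; rewrite mul1r.
  apply: eq_bigr => k _.
  by rewrite big_ord0 mul1r addr0 cpowN invfM fmorphV.
move=> j s s0.
have d0 := cdiff_laplace (laplace_admissible_mulXn j wadm) s0.
have d1 (k : 'I_m) := cdiffZ ((\prod_(i < j) (alpha k + i%:R)) / c k)%:C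
  (cdiff_cpow (- (alpha k + j%:R)) s0).
have d2 := cdiff_sum d1.
have d3 := cdiffZ ((-1) ^+ j) (cdiffD d0 (cdiffZ (-1) d2)).
rewrite /F; have -> : (fun s => (-1) ^+ j * (laplace U (fun x => x ^+ j * w x) s -
    \sum_(k < m) (\prod_(i < j) (alpha k + i%:R) / c k)%:C * cpow s (- (alpha k + j%:R))%:C)) =
  (fun s => (-1) ^+ j * (laplace U (fun x => x ^+ j * w x) s + -1 *
    \sum_(k < m) (\prod_(i < j) (alpha k + i%:R) / c k)%:C * cpow s (- (alpha k + j%:R))%:C)).
  by apply/funext => s'; rewrite mulN1r.
have -> : (fun x => x ^+ j.+1 * w x) = (fun x => x * (x ^+ j * w x)).
  by apply/funext => x; rewrite exprS mulrA.
move: d3; congr cdiff; rewrite exprS mulN1r mulNr -mulrN; congr (_ * _).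
rewrite opprB addrC mulN1r; congr (_ - _); rewrite -sumrN; apply: eq_bigr => k _.
have -> : - (alpha k + j.+1%:R) = - (alpha k + j%:R) - 1.
  by rewrite -natr1; ring.
rewrite big_ord_recr/= !mulrA -mulNr; congr (_ * _).
by rewrite -rmorphM -rmorphN; congr (_%:C); ring.
Qed.

(** A bound on f over the whole line |t| >= r controls the transform above
    height r, uniformly in the abscissa. *)
Lemma laplace_vertical_tail (f : R[i] -> R[i]) (r : R) : 0 < r ->
  (forall z, 0 < complex.Re z -> cmod (f z) = cmod (laplace U w z)) ->
  (ereal_sup [set \int[lebesgue_measure]_(theta in ~` `](- r)%R, r[)
        (cmod (f (lambda +i* theta)))%:E
      | lambda in [set lambda : R | (0 < lambda)%R]] < +oo)%E ->
  exists2 B : R, 0 <= B & forall a, 0 < a ->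
    (\int[mu]_(t in `[r, +oo[) (cmod (laplace U w (a +i* t)))%:E <= B%:E)%E.
Proof.
move=> r0 fE; set S := ereal_sup _ => Soo.
have key a : 0 < a ->
    (\int[mu]_(t in `[r, +oo[) (cmod (laplace U w (a +i* t)))%:E <= S)%E.
  move=> a0; apply: (@le_trans _ _ (\int[mu]_(t in ~` `](- r)%R, r[)
      (cmod (laplace U w (a +i* t)))%:E)%E).
    apply: ge0_subset_integral => //.
    - by apply: measurableC; exact: measurable_itv.
    - apply/measurable_EFinP; apply: measurable_funTS; apply: cmeasurable_cmod => //.
      exact: cmeasurable_laplace_line.
    - by move=> t _; rewrite lee_fin cmod_ge0.
    - by move=> t /=; rewrite !in_itv/= andbT => rt /andP[_]; rewrite ltNge rt.
  apply: ereal_sup_ubound; exists a => //.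
  by apply: eq_integral => t _; rewrite fE.
have S0 : (0 <= S)%E.
  apply: (le_trans _ (key 1 ltr01)); apply: integral_ge0 => t _.
  by rewrite lee_fin cmod_ge0.
exists (fine S); first exact: fine_ge0.
by move=> a a0; rewrite fineK ?ge0_fin_numE//; exact: key.
Qed.

End differences_of_transforms.

Section tauberian_estimate.
Context {R : realType}.
Local Notation T := (measurableTypeR R).
Local Notation mu := (@lebesgue_measure R).
Local Notation Do := (`]0%R, +oo[%classic : set T).

Let mDo : measurable Do. Proof. exact: measurable_itv. Qed.

Variables (U : {measure set T -> \bar R}) (w : R -> R).
Hypothesis wadm : laplace_admissible U w.
Hypothesis tail : forall r : R, 0 < r -> exists2 B : R, 0 <= B & forall a, 0 < a ->
  (\int[mu]_(t in `[r, +oo[) (cmod (laplace U w (a +i* t)))%:E <= B%:E)%E.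

Lemma integrable_laplace_line_of_tail a : 0 < a ->
  mu.-integrable Do (EFin \o (fun t : R => cmod (laplace U w (a +i* t)))).
Proof.
move=> a0; apply: integrable_laplace_line => //.
have [B _ /(_ a a0) HB] := tail ltr01.
exact: le_lt_trans HB (ltry _).
Qed.

Variables (m : nat) (kappa s : 'I_m -> R) (rho : R -> R) (C0 r0 r1 : R).
Hypothesis s1 : forall k, 1 < s k.
Hypothesis rho_gt0 : forall t : R, 0 < t -> 0 < rho t.
Hypothesis rho_int : locally_integrable `]0, +oo[ rho.
Hypothesis r1_gt0 : 0 < r1.
Hypothesis rho_mono : forall s t : R, 0 < s -> s <= t -> t < r1 -> rho t <= rho s.
Hypothesis C0_gt0 : 0 < C0.
Hypothesis r0_gt0 : 0 < r0.

Let H z := laplace U w z -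
  \sum_(k < m) (kappa k * Gamma (s k))%:C * cpow z (- s k)%:C.

Hypothesis H_le : forall z, 0 < complex.Re z -> cmod z < r0 ->
  cmod (H z) <= C0 * rho (cmod z).

Let irho (p q : R) : 0 < p -> mu.-integrable `[p, q] (EFin \o rho).
Proof.
move=> p0; have [mr _ rK] := rho_int.
have sub : `[p, q]%classic `<=` `]0, +oo[%classic.
  by move=> t /=; rewrite !in_itv/= andbT => /andP[+ _]; exact: lt_le_trans.
apply/integrableP; split; first by apply/measurable_EFinP; apply: measurable_funS mr.
by apply: rK => //; exact: segment_compact.
Qed.

(* The bound does not depend on the abscissa l: above height r one has
   |l + i t| >= t, whence 1 + t <= (1 + 1 / r) |l + i t|. *)
Let tail_powers (r : R) : 0 < r -> exists2 M : R, 0 <= M & forall l, 0 < l ->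
  (\int[mu]_(t in `[r, +oo[) (cmod (H (l +i* t)))%:E <= M%:E)%E.
Proof.
move=> r_gt0; have [B B0 HB] := tail r_gt0.
have s0 k : 0 < s k by apply: lt_trans (s1 k).
pose Q (t : R) := \sum_(k < m)
  `|kappa k * Gamma (s k)| * (1 + r^-1) `^ s k * (1 + t) `^ (- s k).
have Q0 t : 0 <= Q t.
  by apply: sumr_ge0 => k _; rewrite mulr_ge0 ?powR_ge0// mulr_ge0 ?powR_ge0.
have iQ : mu.-integrable Do (EFin \o Q).
  rewrite (_ : EFin \o _ = (fun t => \sum_(k < m)
    (`|kappa k * Gamma (s k)| * (1 + r^-1) `^ s k * (1 + t) `^ (- s k))%:E)%E).
    apply: (integrable_sum mDo) => k _.
    by have := integrableZl mDo (`|kappa k * Gamma (s k)| * (1 + r^-1) `^ s k)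
      (integrable_powR_shift (s1 k)).
  by apply/funext => t; rewrite /= sumEFin.
have q0 : 0 <= \int[mu]_(t in Do) Q t by apply: Rintegral_ge0 => t _; exact: Q0.
exists (B + \int[mu]_(t in Do) Q t); first exact: addr_ge0.
move=> l l0.
have mD : measurable (`[r, +oo[%classic : set T) by exact: measurable_itv.
have rDo : `[r, +oo[%classic `<=` Do.
  by move=> t /=; rewrite !in_itv/= !andbT; exact: lt_le_trans.
have mQ : measurable_fun Do (EFin \o Q) by exact: measurable_int iQ.
have mL A : measurable_fun A (fun t : T => cmod (laplace U w (l +i* t))).
  apply: measurable_funTS; apply: cmeasurable_cmod => //; exact: cmeasurable_laplace_line.
have [iH _] := @bromwich_sub_powers R U w l wadm l0 (integrable_laplace_line_of_tail l0)
  m kappa s 1 s1 ltr01.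
apply: (@le_trans _ _ (\int[mu]_(t in `[r, +oo[)
    ((cmod (laplace U w (l +i* t)))%:E + (Q t)%:E))%E).
  apply: ge0_le_integral => //.
  - by move=> t _; rewrite lee_fin cmod_ge0.
  - by apply: measurable_funS (measurable_int _ iH).
  - apply: emeasurable_funD; first exact/measurable_EFinP.
    exact: measurable_funS mQ.
  - move=> t /=; rewrite in_itv/= andbT => rt; rewrite -EFinD lee_fin.
    have t0 : 0 < t by exact: lt_le_trans rt.
    apply: (le_trans (cmodD _ _)); rewrite lerD2l cmodN.
    apply: (@le_trans _ _ (\sum_(k < m)
        cmod ((kappa k * Gamma (s k))%:C * cpow (l +i* t) (- s k)%:C))).
      elim/big_rec2: _ => [|k y z _ yz]; first by rewrite cmod0.
      by apply: (le_trans (cmodD _ _)); rewrite lerD2l.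
    apply: ler_sum => k _.
    rewrite cmodM cmod_real -mulrA ler_wpM2l// cmod_cpow//.
    apply: powR_cmod_le; rewrite ?(ltW t0) ?(ltW (s0 k))//.
      by rewrite addr_gt0 ?invr_gt0.
    have := cmod_Im (l +i* t); rewrite /= gtr0_norm// => tz.
    have : 1 <= r^-1 * cmod (l +i* t) by rewrite ler_pdivlMl// mulr1 (le_trans rt).
    lra.
have mQ' : measurable_fun (`[r, +oo[%classic : set T) (EFin \o Q) by exact: measurable_funS mQ.
have mL' : measurable_fun (`[r, +oo[%classic : set T)
    (EFin \o (fun t : T => cmod (laplace U w (l +i* t)))) by exact/measurable_EFinP.
have L0 (t : T) : `[r, +oo[%classic t -> (0 <= (EFin \o (fun t => cmod (laplace U w (l +i* t)))) t)%E.
  by move=> _; rewrite lee_fin cmod_ge0.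
have Q0' (t : T) : `[r, +oo[%classic t -> (0 <= (EFin \o Q) t)%E by move=> _; rewrite lee_fin.
rewrite (ge0_integralD mu mD L0 mL' Q0' mQ').
rewrite EFinD; apply: leeD; first exact: HB.
rewrite /Rintegral fineK; last exact: integrable_fin_num iQ.
by apply: ge0_subset_integral => // t _; rewrite lee_fin.
Qed.

(** At the point x the abscissa is taken to be 1 / x, so that the factor
    exp (l x) of the inversion formula is the constant e. *)
Lemma bromwich_asymptotics : exists C x0 : R, [/\ 0 < C, 0 < x0 &
  forall x, x0 < x ->
  `|bromwich U w x^-1 x - \sum_(k < m) kappa k * x `^ (s k - 1)| <=
  C * (x^-1 * rho x^-1 + \int[mu]_(t in `[x^-1, 1%R]) rho t)].
Proof.
(* |l + i t| <= l + t < 2 r for l, t < r *)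
pose r := Num.min 1 (Num.min r0 r1) / 2.
have mm : 0 < Num.min 1 (Num.min r0 r1) by rewrite !lt_min ltr01 r0_gt0 r1_gt0.
have r_gt0 : 0 < r by rewrite divr_gt0.
have [r2 rr0 rr1] : [/\ r * 2 <= 1, r * 2 <= r0 & r * 2 <= r1].
  by rewrite /r divfK// !ge_min !lexx !orbT.
have [M M0 HM] := tail_powers r_gt0.
pose i0 := rho r * (r / 2).
have i0_gt0 : 0 < i0 by rewrite mulr_gt0 ?rho_gt0 ?divr_gt0.
have e0 : 0 < expR 1 / pi :> R by rewrite divr_gt0 ?expR_gt0 ?pi_gt0.
exists (expR 1 / pi * (C0 + M / i0)), (2 / r); split.
- by rewrite mulr_gt0// ltr_wpDr// divr_ge0// ltW.
- by rewrite divr_gt0.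
move=> x xr; have x0 : 0 < x by apply: lt_trans xr; rewrite divr_gt0.
pose l := x^-1.
have l0 : 0 < l by rewrite invr_gt0.
have lr : l < r / 2.
  by rewrite /l -[r / 2]invrK ltf_pV2 ?posrE ?invr_gt0 ?divr_gt0// invf_div.
set I := \int[mu]_(t in `[x^-1, 1%R]) rho t.
(* the constant contribution of t >= r is absorbed by the integral of rho, at
   least that over [r / 2, r], where rho is bounded below by monotonicity *)
have I_ge : i0 <= I.
  have mJ : measurable (`[r / 2, r]%classic : set T) by exact: measurable_itv.
  have JI : `[r / 2, r]%classic `<=` `[l, 1]%classic.
    move=> t /=; rewrite !in_itv/= => /andP[t1 t2]; apply/andP; split; lra.
  have iJ : mu.-integrable `[r / 2, r] (EFin \o rho).
    by apply: irho; rewrite divr_gt0.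
  have iC : mu.-integrable `[r / 2, r] (EFin \o cst (rho r)).
    apply: continuous_compact_integrable; first exact: segment_compact.
    by apply: continuous_subspaceT => t; exact: cvg_cst.
  apply: (@le_trans _ _ (\int[mu]_(t in `[r / 2, r]) cst (rho r) t)).
    rewrite Rintegral_cst// /i0 (_ : fine _ = r / 2)//.
    have mE : mu (`[r / 2, r]%classic : set R) = (r / 2)%:E.
      rewrite lebesgue_measure_itv/= lte_fin ifT; last by lra.
      by rewrite -EFinB; congr EFin; lra.
    by transitivity (fine (mu (`[r / 2, r]%classic : set R))) => //; rewrite mE.
  apply: (@le_trans _ _ (\int[mu]_(t in `[r / 2, r]) rho t)).
    apply: le_Rintegral => // t; rewrite /= in_itv/= => /andP[t1 t2].
    apply: rho_mono => //; lra.
  rewrite /I -/l; apply: fine_le.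
  - exact: (integrable_fin_num _ iJ).
  - exact: (integrable_fin_num _ (irho 1 l0)).
  - apply: ge0_subset_integral => //.
    + by have /measurable_int := irho 1 l0.
    + move=> t; rewrite /= in_itv/= => /andP[lt _]; rewrite lee_fin ltW// rho_gt0//.
      exact: lt_le_trans lt.
have [iH] := @bromwich_sub_powers R U w l wadm l0 (integrable_laplace_line_of_tail l0)
  m kappa s x s1 x0.
rewrite /l mulVf ?lt0r_neq0// -/l => /le_trans; apply.
rewrite -[leRHS]mulrA ler_wpM2l ?(ltW e0)//.
have zl (t : R) : 0 < t -> [/\ l <= cmod (l +i* t), t <= cmod (l +i* t) & cmod (l +i* t) <= l + t].
  move=> t0; have := cmod_Re (l +i* t); have := cmod_Im (l +i* t).
  by have := cmod_le_ReIm (l +i* t); rewrite /= !gtr0_norm.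
have [mr _ _] := rho_int.
have mh : measurable_fun Do (fun t : T => cmod (H (l +i* t))).
  by apply/measurable_EFinP; exact: measurable_int iH.
apply: (le_trans (@Rintegral_three_ranges R (fun t => cmod (H (l +i* t))) rho l r C0 M
  l0 _ _ C0_gt0 M0 mh (fun t => cmod_ge0 _) mr rho_gt0 (irho 1 l0) _ _ (HM l l0))).
- lra.
- lra.
- move=> t t0 tl; have [z1 z2 z3] := zl t t0.
  apply: (le_trans (H_le _ _)) => //; first lra.
  rewrite ler_wpM2l ?(ltW C0_gt0)// rho_mono//; lra.
- move=> t lt tr; have t0 := lt_trans l0 lt; have [z1 z2 z3] := zl t t0.
  apply: (le_trans (H_le _ _)) => //; first lra.
  rewrite ler_wpM2l ?(ltW C0_gt0)// rho_mono//; lra.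
rewrite -/I.
have MI : M <= M / i0 * I.
  by rewrite mulrAC ler_pdivlMr// ler_wpM2l.
have : 0 <= M / i0 * (l * rho l).
  by rewrite mulr_ge0 ?divr_ge0 ?(ltW i0_gt0) ?mulr_ge0 ?(ltW l0) ?(ltW (rho_gt0 l0)).
rewrite -/l; lra.
Qed.

End tauberian_estimate.

(** * The density of the potential measure *)

Theorem theorem3p1 (d : measure_display) (T : measurableType d) (R : realType)
    (P : probability T R) (X : R -> T -> option R) (Phi : R[i] -> R[i])
    (a b : R) (Pi : {measure set (measurableTypeR R) -> \bar R})
    (hX : killed_subordinator P X)
    (hPhi : laplace_exponent P X Phi)
    (hLK : levy_khintchine Phi a b Pi)
    (hX0 : [\/ 0 < a, 0 < b | (0 < Pi [set x : R | (0 < x)%R])%E])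
    (N : nat) (hN : (0 < N)%N)
    (n : nat) (c alpha : 'I_n.+1 -> R)
    (hc0 : 0 < c ord0) (hc : forall k, c k != 0)
    (halpha : forall j k : 'I_n.+1, (j < k)%N -> alpha k < alpha j)
    (halphan : - N%:R + 1 < alpha ord_max)
    (halpha0 : 0 <= alpha ord0 <= 1)
    (rho : R -> R)
    (hrho_pos : forall t : R, 0 < t -> 0 < rho t)
    (hrho_int : locally_integrable `]0, +oo[ rho)
    (hrho_mono : exists2 r : R, 0 < r &
       forall s t : R, 0 < s -> s <= t -> t < r -> rho t <= rho s)
    (hrho_o : rho t / t `^ (- N%:R - alpha ord_max) @[t --> 0^'+] --> 0)
    (hA : exists C r : R, [/\ 0 < C, 0 < r &
       forall z : R[i], 0 < complex.Re z -> cmod z < r ->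
         cmod (cderivn N
           (fun s => (Phi s)^-1
              - \sum_(k < n.+1) ((c k)%:C * cpow s (alpha k)%:C)^-1) z)
         <= C * rho (cmod z)])
    (hB : forall r : R, 0 < r ->
       (ereal_sup [set \int[lebesgue_measure]_(theta in ~` `](- r)%R, r[)
            (cmod (cderivn N (fun s => (Phi s)^-1) (lambda +i* theta))%C)%R%:E
          | lambda in [set lambda : R | (0 < lambda)%R]] < +oo)%E) :
  exists u : R -> R,
    [/\ {in `]0, +oo[, continuous u},
        (forall x : R, 0 < x -> 0 <= u x),
        (forall A : set R, measurable A -> A `<=` `]0, +oo[ ->
           potential P X A = (\int[lebesgue_measure]_(x in A) (u x)%:E)%E) &
        exists C x0 : R, [/\ 0 < C, 0 < x0 &
          forall x : R, x0 < x ->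
            `| u x - \sum_(k < n.+1)
                 x `^ (alpha k - 1) * rgamma (alpha k) / c k |
            <= C * (x ^- N.+1 * rho x^-1 +
                    x ^- N *
                      \int[lebesgue_measure]_(t in `[x^-1, 1]) rho t)]].
Proof.
have Phi0 z : 0 < complex.Re z -> 0 < complex.Re (Phi z).
  exact: laplace_exponent_Re_gt0 hLK hX0.
have [U [PU Uadm PhiU]] := potential_laplace hX hPhi Phi0.
pose w (x : R) : R := x ^+ N * 1.
have wadm : laplace_admissible U w by exact: (laplace_admissible_mulXn N Uadm).
have sgn (z : R[i]) : cmod ((-1) ^+ N * z) = cmod z.
  by rewrite -signr_odd; case: (odd N); rewrite ?expr1 ?expr0 ?mulN1r ?mul1r ?cmodN.
have tail (r : R) (r0 : 0 < r) := @laplace_vertical_tail R U w wadm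
  (cderivn N (fun s => (Phi s)^-1)) r r0
  (fun z z0 => etrans (congr1 cmod (cderivn_laplace N Uadm PhiU z0)) (sgn _)) (hB r r0).
have im1 := integrable_laplace_line_of_tail wadm tail ltr01.
have hm1 (t : R) : 0 < t -> cmod (laplace U w (1 +i* t)) <= cmod (laplace U w (1 +i* t)) by [].
(* the abscissa 1 is an arbitrary choice, changed to 1 / x in the estimate *)
exists (fun x => x ^- N * bromwich U w 1 x); split.
- move=> x; rewrite in_itv/= andbT => x0; apply: cvgM.
    apply: cvgV; first by rewrite expf_neq0// lt0r_neq0.
    exact: exprn_continuous.
  exact: (continuous_bromwich wadm ltr01 im1 hm1).
- move=> x x0; rewrite mulr_ge0 ?(bromwich_ge0 wadm ltr01 im1 hm1)//.
  by rewrite invr_ge0 exprn_ge0// ltW.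
- move=> A mA A0.
  have A_gt0 x : A x -> 0 < x by move=> /A0; rewrite /= in_itv/= andbT.
  have mpow : measurable_fun A (fun x : R => x ^- N).
    suff mp : measurable_fun (`]0%R, +oo[%classic : set R) (fun x : R => x ^- N).
      by apply: measurable_funS A0 mp; exact: measurable_itv.
    apply: continuous_halfline_measurable => x x0.
    apply: cvgV; first by rewrite expf_neq0// lt0r_neq0.
    exact: exprn_continuous.
  rewrite PU// -(@bromwich_density _ U w wadm 1 _ ltr01 im1 hm1 A (fun x => x ^- N))//.
  + rewrite -[LHS]mul1e -integral_cst//; apply: eq_integral => x; rewrite inE => /A_gt0 x0.
    by rewrite /w mulr1 mulVf// expf_neq0// lt0r_neq0.
  + by move=> x /A_gt0 x0; rewrite /= in_itv/= andbT ltW.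
  + by move=> x /A_gt0 x0; rewrite invr_ge0 exprn_ge0// ltW.
have [C0 [r0 [C0_gt0 r0_gt0 H_le]]] := hA.
have [r1 r1_gt0 rho_mono] := hrho_mono.
pose s (k : 'I_n.+1) := alpha k + N%:R.
have s1 k : 1 < s k.
  suff : alpha ord_max <= alpha k by move: halphan; rewrite /s; lra.
  have [->//|kn] := eqVneq k ord_max.
  by apply/ltW/halpha; rewrite ltn_neqAle -ltnS ltn_ord andbT.
have s0 k : 0 < s k by apply: lt_trans (s1 k).
pose K (k : 'I_n.+1) := \prod_(i < N) (alpha k + i%:R) / c k.
pose kappa k := K k / Gamma (s k).
have KE k : kappa k * Gamma (s k) = K k by rewrite divfK// lt0r_neq0// Gamma_gt0.
have H_le' z : 0 < complex.Re z -> cmod z < r0 ->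
    cmod (laplace U w z - \sum_(k < n.+1) (kappa k * Gamma (s k))%:C * cpow z (- s k)%:C)
    <= C0 * rho (cmod z).
  move=> z0 zr; have := H_le z z0 zr.
  rewrite (cderivn_sub_powers Uadm c alpha N PhiU z0) sgn.
  by congr (cmod (_ - _) <= _); apply: eq_bigr => k _; rewrite KE.
have [C [x0 [C_gt0 x0_gt0 HC]]] := bromwich_asymptotics wadm tail s1 hrho_pos hrho_int
  r1_gt0 rho_mono C0_gt0 r0_gt0 H_le'.
exists C, x0; split => // x xx0; have x_gt0 := lt_trans x0_gt0 xx0.
have xi : 0 < x^-1 by rewrite invr_gt0.
have xN : 0 < x ^- N by rewrite invr_gt0 exprn_gt0.
rewrite -(bromwich_abscissa wadm xi ltr01 (integrable_laplace_line_of_tail wadm tail xi)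
  im1 x_gt0).
have -> : x ^- N * bromwich U w x^-1 x -
    \sum_(k < n.+1) x `^ (alpha k - 1) * rgamma (alpha k) / c k =
    x ^- N * (bromwich U w x^-1 x - \sum_(k < n.+1) kappa k * x `^ (s k - 1)).
  rewrite mulrBr mulr_sumr; congr (_ - _); apply: eq_bigr => k _.
  have -> : x `^ (s k - 1) = x `^ (alpha k - 1) * x ^+ N.
    rewrite -powR_mulrn ?(ltW x_gt0)// -powRD; last by rewrite (gt_eqF x_gt0) implybT.
    by congr (_ `^ _); rewrite /s; ring.
  rewrite /kappa /K -(rgamma_Gamma (s0 k)) -/(s k).
  have G0 := lt0r_neq0 (Gamma_gt0 (s0 k)); have c_neq0 := hc k.
  have y0 := lt0r_neq0 (exprn_gt0 N x_gt0).
  by move: (x ^+ N) (Gamma (s k)) y0 G0 => y g y0 G0; field; rewrite ?y0 ?G0 ?c_neq0.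
rewrite normrM (gtr0_norm xN).
apply: (le_trans (ler_wpM2l (ltW xN) (HC x xx0))).
rewrite mulrCA mulrDr mulrA; apply: ler_wpM2l; first exact: ltW.
by rewrite exprS invfM [x^-1 * _]mulrC.
Qed.
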